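(* Let $(a_{nk})_{n,k\ge0}$ be complex scalars with $\sum_k|a_{nk}|<\infty$ for each $n$. Then the following are equivalent: (i) $\sum_{k\ge0}a_{nk}\hat g(k)z^k\to g$ weakly in $H^1$, for all $g\in H^1$; (ii) $\sum_{k\ge0}a_{nk}\hat g(k)z^k\to g$ in $H^1$-norm, for all $g\in H^1$; (iii) $\sum_{k\ge0}a_{nk}\hat h(k)z^k\to h$ weak* in $\mathrm{BMOA}$, for all $h\in\mathrm{BMOA}$; (iv) $\sum_{k\ge0}a_{nk}\hat f(k)z^k\to f$ weakly in $\mathrm{VMOA}$, for all $f\in\mathrm{VMOA}$; (v) $\sum_{k\ge0}a_{nk}\hat f(k)z^k\to f$ in $\mathrm{BMOA}$-norm, for all $f\in\mathrm{VMOA}$.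
   Context: $\mathbb D$ is the unit disk, $\hat g(k)$ denote Taylor coefficients. $H^1$ is the Hardy space of holomorphic $f$ on $\mathbb D$ with $\|f\|_{H^1}=\sup_{r<1}\frac1{2\pi}\int_0^{2\pi}|f(re^{i\theta})|d\theta<\infty$. $\mathrm{BMOA}$ is the space of $f\in H^2$ with $\|f\|_{\mathrm{BMOA}}:=|f(0)|+\sup_{\mathbb D}(P|f|^2-|f|^2)^{1/2}<\infty$, where $P|f|^2$ is the Poisson integral of the boundary values of $|f|^2$; $\mathrm{VMOA}$ is the closed subspace of $f\in\mathrm{BMOA}$ with $(P|f|^2-|f|^2)(z)\to0$ as $|z|\to1$. Up to isomorphism $\mathrm{VMOA}^*\cong H^1$ and $(H^1)^*\cong\mathrm{BMOA}$ via the pairing $\langle g,h\rangle=\lim_{r\to1^-}\frac1{2\pi}\int_0^{2\pi}g(re^{i\theta})h(re^{-i\theta})d\theta$; weak* in $\mathrm{BMOA}$ refers to this duality with $H^1$. *)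

(* Defs.v *)
From Stdlib Require Import Reals.
From Coquelicot Require Import Coquelicot.
Open Scope R_scope.

(* A holomorphic function on the unit disk D is represented by its Taylor
   coefficient sequence c : nat -> C, i.e. f(z) = sum_k c k z^k; thus
   c k is \hat f(k). *)

(* Value of the power series at z (total; meaningful when it converges). *)
Definition psum (c : nat -> C) (z : C) : C :=
  lim (T := C_CompleteNormedModule) (filtermap (sum_n (fun k => (c k * pow_n z k)%C)) eventually).

Definition holo_disk (c : nat -> C) : Prop :=
  forall z : C, Cmod z < 1 -> ex_series (fun k => (c k * pow_n z k)%C).

Definition cis (r t : R) : C := (r * cos t, r * sin t)%R.

Definition circ_mean_pow (p : nat) (c : nat -> C) (r : R) : R :=
  / (2 * PI) * RInt (fun t => (Cmod (psum c (cis r t))) ^ p) 0 (2 * PI).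

Definition Hpnorm (p : nat) (c : nat -> C) : Rbar :=
  Lub_Rbar (fun x => exists r, 0 <= r < 1 /\ x = circ_mean_pow p c r).

Definition H1norm (c : nat -> C) : Rbar := Hpnorm 1 c.

Definition inH1 (c : nat -> C) : Prop :=
  holo_disk c /\ Rbar_lt (H1norm c) p_infty.

Definition inH2 (c : nat -> C) : Prop :=
  holo_disk c /\ Rbar_lt (Hpnorm 2 c) p_infty.

Definition poisson (z : C) (t : R) : R :=
  (1 - Cmod z ^ 2) / (Cmod (Cminus (cis 1 t) z)) ^ 2.

(* P|f|^2 (z): the Poisson integral of the boundary values of |f|^2, for
   f in H^2, computed as lim_{r -> 1^-} of the Poisson integrals of
   |f(r e^{it})|^2 (since f_r -> f* in L^2 of the circle). *)
Definition poisson_abs2 (c : nat -> C) (z : C) : R :=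
  lim (T := R_CompleteSpace) (filtermap
        (fun r => / (2 * PI) *
           RInt (fun t => poisson z t * (Cmod (psum c (cis r t))) ^ 2) 0 (2 * PI))
        (at_left 1)).

Definition garsia_sq (c : nat -> C) (z : C) : R :=
  poisson_abs2 c z - (Cmod (psum c z)) ^ 2.

Definition BMOAnorm (c : nat -> C) : Rbar :=
  Rbar_plus (Cmod (c 0%nat))
    (Lub_Rbar (fun x => exists z : C, Cmod z < 1 /\ x = sqrt (garsia_sq c z))).

Definition inBMOA (c : nat -> C) : Prop :=
  inH2 c /\ Rbar_lt (BMOAnorm c) p_infty.

Definition inVMOA (c : nat -> C) : Prop :=
  inBMOA c /\
  forall eps : R, 0 < eps -> exists delta : R, delta < 1 /\
    forall z : C, delta < Cmod z < 1 -> Rabs (garsia_sq c z) < eps.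

Definition pairing (g h : nat -> C) : C :=
  lim (T := C_CompleteNormedModule) (filtermap
        (fun r => (RtoC (/ (2 * PI)) *
           RInt (V := C_R_CompleteNormedModule)
             (fun t => (psum g (cis r t) * psum h (cis r (- t)))%C) 0 (2 * PI))%C)
        (at_left 1)).

Definition csub (f g : nat -> C) : nat -> C := fun k => (f k - g k)%C.
Definition cadd (f g : nat -> C) : nat -> C := fun k => (f k + g k)%C.
Definition cscal (l : C) (f : nat -> C) : nat -> C := fun k => (l * f k)%C.

Definition Tmult (a : nat -> nat -> C) (n : nat) (g : nat -> C) : nat -> C :=
  fun k => (a n k * g k)%C.

Definition bdd_lin_functional (X : (nat -> C) -> Prop) (N : (nat -> C) -> Rbar)
    (L : (nat -> C) -> C) : Prop :=
  (forall f g, X f -> X g -> L (cadd f g) = (L f + L g)%C) /\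
  (forall (l : C) f, X f -> L (cscal l f) = (l * L f)%C) /\
  exists M : R, forall f, X f -> Cmod (L f) <= M * real (N f).

Definition weak_cvg (X : (nat -> C) -> Prop) (N : (nat -> C) -> Rbar)
    (u : nat -> nat -> C) (v : nat -> C) : Prop :=
  forall L, bdd_lin_functional X N L ->
    filterlim (fun n => L (u n)) eventually (locally (L v)).

Definition norm_cvg (N : (nat -> C) -> Rbar) (u : nat -> nat -> C) (v : nat -> C) : Prop :=
  filterlim (fun n => N (csub (u n) v)) eventually (Rbar_locally (Finite 0)).

(* Weak* convergence in BMOA = (H^1)^* via the pairing *)
Definition weakstar_BMOA (u : nat -> nat -> C) (v : nat -> C) : Prop :=
  forall g, inH1 g ->
    filterlim (fun n => pairing g (u n)) eventually (locally (pairing g v)).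

(* Main.v *)
(* Every one of the five conditions implies that <g, T_n f> -> <g, f> for all g in H^1 and f in
   VMOA, and this already implies all of them.  Testing on monomials gives a_nk -> 1; applying the
   uniform boundedness principle in g and then in f bounds the operators T_n uniformly on VMOA,
   hence, by duality, on H^1; the rest is approximation by dilations.

   The duality rests on one computation.  If h has Garsia norm at most 1 then
   phi = |h|^2 - P|h|^2 lies in [-1, 0] and its Laplacian is 4 |h'|^2.  By Uchiyama's exponential
   trick, w / eta + eta w e^phi - Re (g conj h), with w a smoothing of |g|, is subharmonic up to
   normalisation of phi, and comparing its means over two circles bounds the increment of the
   pairing of g and h between the radii s < r by
   (M_r - M_s) / eta + C eta M_r, where M_r is the mean of |g| over the circle of radius r.
   Letting s -> 0 gives Fefferman's inequality; letting s, r -> 1 gives the existence of the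
   pairing and, taking the supremum over h, the convergence in H^1 of the dilations of g, without
   recourse to boundary values.  In the other direction the functions u x(u) / (1 - z u) show
   that a functional on H^1 has a Garsia norm controlled by its norm.

   The Garsia function is handled through the exact formula
   (P|h|^2 - |h|^2)(z) = (1 - |z|^2) sum_m |sum_j h_(m+1+j) z^j|^2. *)

Require Import Defs.
From Stdlib Require Import Reals Lra Lia Psatz Arith FunctionalExtensionality Classical ClassicalEpsilon.
From Coquelicot Require Import Coquelicot.
Open Scope R_scope.

(** The calculus is confined to polynomials, in the coordinate [log z = s + i t]: there the
    Laplacian is flat, differentiation multiplies the coefficient of index k by k or i k, and the
    mean of a subharmonic function over the circle of radius [exp s] is convex in s. Passing to
    polynomials has a cost. The truncation of a function of Garsia norm 1 is controlled only on a
    smaller disk, and only by 2; this makes the exponent range over [0, 4] and is the origin of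
    every [exp 4]. Weak convergence is tested on pairings alone, and norms are recovered from
    explicit functionals: a smoothed sign function for H^1 ([dual_witness]), normalised kernels for
    BMOA ([garsia_test]). The sequences that arise are summable or finite, so they lie in VMOA or
    H^1, where the operators are already under control. Each T_n f is absolutely summable as well;
    its pairings are ordinary series, hence T_n is symmetric for the pairing, and estimates move
    freely between H^1 and VMOA. Completeness and dilations rest on one remark: norm balls are
    closed under coefficientwise convergence. *)

(** * Finite sums of complex and of real numbers *)

Fixpoint csum (f : nat -> C) (n : nat) : C :=
  match n with O => RtoC 0 | S m => (csum f m + f m)%C end.

Fixpoint rsum (f : nat -> R) (n : nat) : R :=
  match n with O => 0 | S m => rsum f m + f m end.

Lemma csum_sum_n (f : nat -> C) (n : nat) : sum_n f n = csum f (S n).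
Proof.
  induction n as [|n IH].
  - rewrite sum_O. simpl. now rewrite Cplus_0_l.
  - rewrite sum_Sn, IH. reflexivity.
Qed.

Lemma rsum_sum_n (f : nat -> R) (n : nat) : sum_n f n = rsum f (S n).
Proof.
  induction n as [|n IH].
  - rewrite sum_O. simpl. ring.
  - rewrite sum_Sn, IH. reflexivity.
Qed.

Lemma csum_ext (f g : nat -> C) (n : nat) :
  (forall k, (k < n)%nat -> f k = g k) -> csum f n = csum g n.
Proof.
  induction n as [|n IH]; intros H; simpl; auto.
  rewrite IH, H; auto.
Qed.

Lemma rsum_ext (f g : nat -> R) (n : nat) :
  (forall k, (k < n)%nat -> f k = g k) -> rsum f n = rsum g n.
Proof.
  induction n as [|n IH]; intros H; simpl; auto.
  rewrite IH, H; auto.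
Qed.

Lemma csum_plus (f g : nat -> C) (n : nat) :
  csum (fun k => (f k + g k)%C) n = (csum f n + csum g n)%C.
Proof. induction n as [|n IH]; simpl; [ring | rewrite IH; ring]. Qed.

Lemma csum_minus (f g : nat -> C) (n : nat) :
  csum (fun k => (f k - g k)%C) n = (csum f n - csum g n)%C.
Proof. induction n as [|n IH]; simpl; [ring | rewrite IH; ring]. Qed.

Lemma csum_scal (l : C) (f : nat -> C) (n : nat) :
  csum (fun k => (l * f k)%C) n = (l * csum f n)%C.
Proof. induction n as [|n IH]; simpl; [ring | rewrite IH; ring]. Qed.

Lemma csum_zero (f : nat -> C) (n : nat) :
  (forall k, (k < n)%nat -> f k = RtoC 0) -> csum f n = RtoC 0.
Proof.
  induction n as [|n IH]; intros H; simpl; auto.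
  rewrite IH, H; auto. ring.
Qed.

Lemma csum_switch (f : nat -> nat -> C) (m n : nat) :
  csum (fun i => csum (fun j => f i j) n) m = csum (fun j => csum (fun i => f i j) m) n.
Proof.
  induction m as [|m IH]; simpl.
  - symmetry. now apply csum_zero.
  - rewrite IH. now rewrite <- csum_plus.
Qed.

Lemma csum_shift (f : nat -> C) (n : nat) :
  csum f (S n) = (f O + csum (fun k => f (S k)) n)%C.
Proof.
  induction n as [|n IH].
  - simpl. ring.
  - change (csum f (S (S n))) with (csum f (S n) + f (S n))%C. rewrite IH. simpl. ring.
Qed.

Lemma csum_split (f : nat -> C) (n m : nat) :
  csum f (n + m) = (csum f n + csum (fun k => f (n + k)%nat) m)%C.
Proof.
  induction m as [|m IH].
  - rewrite Nat.add_0_r. simpl. ring.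
  - rewrite Nat.add_succ_r. simpl. rewrite IH. ring.
Qed.

Lemma csum_delta (f : nat -> C) (j n : nat) :
  csum (fun k => if Nat.eq_dec k j then f k else RtoC 0) n
  = (if lt_dec j n then f j else RtoC 0).
Proof.
  induction n as [|n IH]; simpl.
  - destruct (lt_dec j 0); auto; lia.
  - rewrite IH. destruct (lt_dec j n), (Nat.eq_dec n j), (lt_dec j (S n)); subst;
      try lia; ring.
Qed.

Lemma Cmod_csum (f : nat -> C) (u : nat -> R) (n : nat) :
  (forall k, (k < n)%nat -> Cmod (f k) <= u k) -> Cmod (csum f n) <= rsum u n.
Proof.
  induction n as [|n IH]; intros H; simpl.
  - rewrite Cmod_0. lra.
  - eapply Rle_trans; [apply Cmod_triangle|]. apply Rplus_le_compat; auto.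
Qed.

Lemma Re_csum (f : nat -> C) (n : nat) : Re (csum f n) = rsum (fun k => Re (f k)) n.
Proof. induction n as [|n IH]; simpl; auto. rewrite <- IH. reflexivity. Qed.

Lemma Im_csum (f : nat -> C) (n : nat) : Im (csum f n) = rsum (fun k => Im (f k)) n.
Proof. induction n as [|n IH]; simpl; auto. rewrite <- IH. reflexivity. Qed.

Lemma Cconj_csum (f : nat -> C) (n : nat) :
  Cconj (csum f n) = csum (fun k => Cconj (f k)) n.
Proof.
  induction n as [|n IH]; simpl.
  - unfold Cconj; simpl. unfold RtoC. f_equal. ring.
  - now rewrite Cplus_conj, IH.
Qed.

Lemma RtoC_rsum (f : nat -> R) (n : nat) : RtoC (rsum f n) = csum (fun k => RtoC (f k)) n.
Proof. induction n as [|n IH]; simpl; auto. now rewrite RtoC_plus, IH. Qed.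

Lemma rsum_le (f g : nat -> R) (n : nat) :
  (forall k, (k < n)%nat -> f k <= g k) -> rsum f n <= rsum g n.
Proof.
  induction n as [|n IH]; intros H; simpl; [lra|].
  apply Rplus_le_compat; auto.
Qed.

Lemma rsum_nonneg (f : nat -> R) (n : nat) :
  (forall k, (k < n)%nat -> 0 <= f k) -> 0 <= rsum f n.
Proof.
  induction n as [|n IH]; intros H; simpl; [lra|].
  apply Rplus_le_le_0_compat; auto.
Qed.

Lemma rsum_plus (f g : nat -> R) (n : nat) :
  rsum (fun k => f k + g k) n = rsum f n + rsum g n.
Proof. induction n as [|n IH]; simpl; [ring | rewrite IH; ring]. Qed.

Lemma rsum_minus (f g : nat -> R) (n : nat) :
  rsum (fun k => f k - g k) n = rsum f n - rsum g n.
Proof. induction n as [|n IH]; simpl; [ring | rewrite IH; ring]. Qed.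

Lemma rsum_scal (l : R) (f : nat -> R) (n : nat) :
  rsum (fun k => l * f k) n = l * rsum f n.
Proof. induction n as [|n IH]; simpl; [ring | rewrite IH; ring]. Qed.

Lemma rsum_shift (f : nat -> R) (n : nat) :
  rsum f (S n) = f O + rsum (fun k => f (S k)) n.
Proof.
  induction n as [|n IH].
  - simpl. ring.
  - change (rsum f (S (S n))) with (rsum f (S n) + f (S n)). rewrite IH. simpl. ring.
Qed.

Lemma rsum_split (f : nat -> R) (n m : nat) :
  rsum f (n + m) = rsum f n + rsum (fun k => f (n + k)%nat) m.
Proof.
  induction m as [|m IH].
  - rewrite Nat.add_0_r. simpl. ring.
  - rewrite Nat.add_succ_r. simpl. rewrite IH. ring.
Qed.

Lemma rsum_incr (f : nat -> R) (n m : nat) :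
  (forall k, 0 <= f k) -> (n <= m)%nat -> rsum f n <= rsum f m.
Proof.
  intros H Hnm. replace m with (n + (m - n))%nat by lia. rewrite rsum_split.
  assert (0 <= rsum (fun k => f (n + k)%nat) (m - n)) by (apply rsum_nonneg; auto). lra.
Qed.

Lemma rsum_const (x : R) (n : nat) : rsum (fun _ => x) n = INR n * x.
Proof. induction n as [|n IH]; [simpl; ring|]. cbn [rsum]. rewrite IH, S_INR. ring. Qed.

Lemma rsum_support (f : nat -> R) (n m : nat) :
  (forall k, (n <= k)%nat -> f k = 0) -> (n <= m)%nat -> rsum f m = rsum f n.
Proof.
  intros H Hm. replace m with (n + (m - n))%nat by lia. rewrite rsum_split.
  rewrite (rsum_ext (fun k => f (n + k)%nat) (fun _ => 0)), rsum_const; [ring|].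
  intros; apply H; lia.
Qed.

Lemma rsum_geom (q : R) (n : nat) : (1 - q) * rsum (fun k => q ^ k) n = 1 - q ^ n.
Proof. induction n as [|n IH]; simpl; [ring | rewrite Rmult_plus_distr_l, IH; ring]. Qed.

Lemma rsum_geom_le (q : R) (n : nat) : 0 <= q < 1 -> rsum (fun k => q ^ k) n <= / (1 - q).
Proof.
  intros Hq. pose proof (rsum_geom q n) as H. pose proof (pow_le q n (proj1 Hq)).
  apply Rmult_le_reg_l with (1 - q); [lra|]. rewrite H, Rinv_r; lra.
Qed.

(** * Summable majorants *)

Definition tail (u : nat -> R) (n : nat) : R := Series u - rsum u n.

Lemma is_series_rsum (u : nat -> R) (l : R) :
  is_series u l <-> forall eps, 0 < eps -> exists N, forall n, (N <= n)%nat -> Rabs (rsum u n - l) < eps.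
Proof.
  unfold is_series. split.
  - intros H eps He.
    destruct (proj1 (filterlim_locally (F := eventually) (sum_n u) l) H (mkposreal eps He)) as [N HN].
    exists (S N). intros n Hn. destruct n as [|n]; [lia|].
    specialize (HN n ltac:(lia)). rewrite rsum_sum_n in HN. exact HN.
  - intros H. apply filterlim_locally. intros eps.
    destruct (H eps (cond_pos eps)) as [N HN]. exists N. intros n Hn.
    rewrite rsum_sum_n. apply HN. lia.
Qed.

Lemma tail_lim (u : nat -> R) (eps : R) :
  ex_series u -> 0 < eps -> exists N, forall n, (N <= n)%nat -> Rabs (tail u n) < eps.
Proof.
  intros Hu He. destruct (proj1 (is_series_rsum u _) (Series_correct u Hu) eps He) as [N HN].
  exists N. intros n Hn. unfold tail. rewrite Rabs_minus_sym. auto.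
Qed.

Lemma rsum_le_Series (u : nat -> R) (n : nat) :
  (forall k, 0 <= u k) -> ex_series u -> rsum u n <= Series u.
Proof.
  intros Hp Hu. apply Rnot_lt_le. intros Hlt.
  destruct (proj1 (is_series_rsum u _) (Series_correct u Hu) (rsum u n - Series u) ltac:(lra))
    as [N HN].
  specialize (HN (N + n)%nat ltac:(lia)).
  pose proof (rsum_incr u n (N + n)%nat Hp ltac:(lia)).
  apply Rabs_lt_between in HN. lra.
Qed.

Lemma tail_nonneg (u : nat -> R) (n : nat) :
  (forall k, 0 <= u k) -> ex_series u -> 0 <= tail u n.
Proof. intros Hp Hu. unfold tail. pose proof (rsum_le_Series u n Hp Hu). lra. Qed.

Lemma ex_series_bounded (u : nat -> R) (M : R) :
  (forall k, 0 <= u k) -> (forall n, rsum u n <= M) -> ex_series u.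
Proof.
  intros Hp HM.
  destruct (ex_finite_lim_seq_incr (sum_n u) M) as [l Hl].
  - intros n. rewrite !rsum_sum_n. apply rsum_incr; auto.
  - intros n. rewrite rsum_sum_n. apply HM.
  - exists l. exact Hl.
Qed.

Lemma Series_le_bound (u : nat -> R) (M : R) :
  ex_series u -> (forall n, rsum u n <= M) -> Series u <= M.
Proof.
  intros Hu HM. apply Rnot_lt_le. intros Hlt.
  destruct (proj1 (is_series_rsum u _) (Series_correct u Hu) (Series u - M) ltac:(lra)) as [N HN].
  specialize (HN N ltac:(lia)). specialize (HM N). apply Rabs_lt_between in HN. lra.
Qed.

Lemma ex_series_mono (u v : nat -> R) :
  (forall k, 0 <= u k <= v k) -> ex_series v -> ex_series u.
Proof.
  intros H Hv. apply ex_series_bounded with (Series v).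
  - intros k. apply H.
  - intros n. eapply Rle_trans; [apply rsum_le; intros; apply H|].
    apply rsum_le_Series; auto. intros k. specialize (H k). lra.
Qed.

(** * Limits in C *)

Lemma C_filterlim {T : Type} (F : (T -> Prop) -> Prop) {FF : Filter F} (f : T -> C) (l : C) :
  filterlim f F (locally l) <-> forall eps, 0 < eps -> F (fun x => Cmod (f x - l) < eps).
Proof.
  split.
  - intros H eps He.
    exact (proj1 (@filterlim_locally_ball_norm C_AbsRing T C_NormedModule F FF f l) H
             (mkposreal eps He)).
  - intros H. apply (proj2 (@filterlim_locally_ball_norm C_AbsRing T C_NormedModule F FF f l)).
    intros eps. exact (H eps (cond_pos eps)).
Qed.

(** Coquelicot specifies [lim] only up to closeness, and only for Cauchy filters. Separation turns
    closeness into equality, which is how the total limits in [psum], [pairing] and [poisson_abs2]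
    become usable. *)
Lemma lim_unique {T : CompleteSpace} (F : (T -> Prop) -> Prop) {FF : ProperFilter F} (l : T) :
  (forall x y : T, close x y -> x = y) ->
  (forall eps : posreal, F (ball l eps)) -> lim F = l.
Proof.
  intros Hsep HF. apply Hsep. intros eps.
  assert (Hc : cauchy F) by (intros e; exists l; apply HF).
  pose proof (complete_cauchy F FF Hc (pos_div_2 eps)) as H1.
  pose proof (HF (pos_div_2 eps)) as H2.
  destruct (filter_ex _ (filter_and _ _ H1 H2)) as [y [Hy1 Hy2]].
  rewrite (double_var eps). apply ball_triangle with y; auto. now apply ball_sym.
Qed.

Lemma C_lim_eq {T : Type} (F : (T -> Prop) -> Prop) {FF : ProperFilter F} (f : T -> C) (l : C) :
  filterlim f F (locally l) -> lim (T := C_CompleteNormedModule) (filtermap f F) = l.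
Proof.
  intros H. apply lim_unique.
  - apply filtermap_proper_filter; auto.
  - apply (@eq_close C_AbsRing C_NormedModule).
  - intros eps. exact (proj1 (filterlim_locally f l) H eps).
Qed.

Lemma R_lim_eq {T : Type} (F : (T -> Prop) -> Prop) {FF : ProperFilter F} (f : T -> R) (l : R) :
  filterlim f F (locally l) -> lim (T := R_CompleteSpace) (filtermap f F) = l.
Proof.
  intros H. apply lim_unique.
  - apply filtermap_proper_filter; auto.
  - apply (@eq_close R_AbsRing R_NormedModule).
  - intros eps. exact (proj1 (filterlim_locally f l) H eps).
Qed.

(** * Power series and their partial sums *)

Definition psum_upto (c : nat -> C) (n : nat) (z : C) : C := csum (fun k => (c k * pow_n z k)%C) n.

Lemma Cmod_pow_n (z : C) (k : nat) : Cmod (pow_n z k) = Cmod z ^ k.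
Proof.
  induction k as [|k IH].
  - apply Cmod_1.
  - change (pow_n z (S k)) with (z * pow_n z k)%C. rewrite Cmod_mult, IH. reflexivity.
Qed.

Lemma pow_n_S (z : C) (k : nat) : pow_n z (S k) = (z * pow_n z k)%C.
Proof. reflexivity. Qed.

Lemma pow_n_0 (z : C) : pow_n z 0 = RtoC 1.
Proof. reflexivity. Qed.

Lemma pow_n_add (z : C) (j k : nat) : pow_n z (j + k) = (pow_n z j * pow_n z k)%C.
Proof. exact (@pow_n_plus C_Ring z j k). Qed.

(** Weierstrass's test at [z]. Only the modulus of [z] occurs, so one majorant serves a whole circle
    and gives uniform convergence there. *)
Definition majorized (c : nat -> C) (z : C) (u : nat -> R) : Prop :=
  ex_series u /\ forall k, Cmod (c k) * Cmod z ^ k <= u k.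

Lemma majorized_nonneg (c : nat -> C) (z : C) (u : nat -> R) : majorized c z u -> forall k, 0 <= u k.
Proof.
  intros [_ H] k. eapply Rle_trans; [|apply H].
  apply Rmult_le_pos; [apply Cmod_ge_0 | apply pow_le, Cmod_ge_0].
Qed.

Lemma psum_upto_Cauchy (c : nat -> C) (z : C) (u : nat -> R) (n m : nat) :
  majorized c z u -> Cmod (psum_upto c (n + m) z - psum_upto c n z) <= tail u n.
Proof.
  intros H. unfold psum_upto. rewrite csum_split.
  replace (_ - _)%C with (csum (fun k => (c (n + k)%nat * pow_n z (n + k))%C) m) by ring.
  eapply Rle_trans; [apply Cmod_csum with (u := fun k => u (n + k)%nat)|].
  - intros k _. rewrite Cmod_mult, Cmod_pow_n. apply H.
  - unfold tail. pose proof (rsum_le_Series u (n + m)%nat (majorized_nonneg _ _ _ H) (proj1 H)) as H1.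
    rewrite rsum_split in H1. lra.
Qed.

Lemma ex_series_majorized (c : nat -> C) (z : C) (u : nat -> R) :
  majorized c z u -> ex_series (fun k => (c k * pow_n z k)%C).
Proof.
  intros [H1 H2]. apply (@ex_series_le C_AbsRing C_CompleteNormedModule) with u; auto.
  intros n. change (Cmod (c n * pow_n z n) <= u n). rewrite Cmod_mult, Cmod_pow_n. apply H2.
Qed.

Lemma psum_of_series (c : nat -> C) (z : C) (l : C) :
  is_series (fun k => (c k * pow_n z k)%C) l -> psum c z = l.
Proof. intros H. unfold psum. apply C_lim_eq. apply eventually_filter. exact H. Qed.

Lemma psum_lim (c : nat -> C) (z : C) :
  ex_series (fun k => (c k * pow_n z k)%C) ->
  forall eps, 0 < eps -> exists N, forall n, (N <= n)%nat -> Cmod (psum_upto c n z - psum c z) < eps.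
Proof.
  intros [l Hl] eps He. rewrite (psum_of_series c z l Hl).
  destruct (proj1 (C_filterlim eventually (FF := @filter_filter _ _ eventually_filter) _ _) Hl eps He)
    as [N HN].
  exists (S N). intros n Hn. destruct n as [|n]; [lia|]. specialize (HN n ltac:(lia)).
  rewrite csum_sum_n in HN. exact HN.
Qed.

Lemma psum_approx (c : nat -> C) (z : C) (u : nat -> R) (n : nat) :
  majorized c z u -> Cmod (psum_upto c n z - psum c z) <= tail u n.
Proof.
  intros H. apply le_epsilon. intros eps He.
  destruct (psum_lim c z (ex_series_majorized c z u H) eps He) as [N HN].
  replace (psum_upto c n z - psum c z)%C with
    (- (psum_upto c (n + N) z - psum_upto c n z) + (psum_upto c (n + N) z - psum c z))%C by ring.
  eapply Rle_trans; [apply Cmod_triangle|]. rewrite Cmod_opp.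
  pose proof (psum_upto_Cauchy c z u n N H). specialize (HN (n + N)%nat ltac:(lia)). lra.
Qed.

Lemma psum_unique (c : nat -> C) (z : C) (l : C) :
  (forall eps, 0 < eps -> exists N, forall n, (N <= n)%nat -> Cmod (psum_upto c n z - l) < eps) ->
  psum c z = l.
Proof.
  intros H. apply psum_of_series. unfold is_series.
  apply (C_filterlim eventually). intros eps He. destruct (H eps He) as [N HN].
  exists N. intros n Hn. rewrite csum_sum_n. exact (HN (S n) ltac:(lia)).
Qed.

Lemma psum_finite (c : nat -> C) (z : C) (n : nat) :
  (forall k, (n <= k)%nat -> c k = RtoC 0) -> psum c z = psum_upto c n z.
Proof.
  intros H. apply psum_unique. intros eps He. exists n. intros m Hm.
  replace m with (n + (m - n))%nat by lia. unfold psum_upto. rewrite csum_split.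
  rewrite (csum_zero (fun k => (c (n + k)%nat * pow_n z (n + k))%C)).
  - replace (_ - _)%C with (RtoC 0) by ring. now rewrite Cmod_0.
  - intros k _. rewrite H by lia. ring.
Qed.

Lemma cis_pow (r t : R) (k : nat) : pow_n (cis r t) k = cis (r ^ k) (INR k * t).
Proof.
  induction k as [|k IH].
  - rewrite pow_n_0. unfold cis. simpl. rewrite Rmult_0_l, cos_0, sin_0.
    unfold RtoC. f_equal; ring.
  - rewrite pow_n_S, IH. unfold cis, Cmult. rewrite S_INR.
    replace ((INR k + 1) * t) with (t + INR k * t) by ring.
    rewrite cos_plus, sin_plus. simpl. f_equal; ring.
Qed.

Lemma Cmod_cis (r t : R) : Cmod (cis r t) = Rabs r.
Proof.
  unfold Cmod, cis. simpl fst; simpl snd.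
  replace ((r * cos t) ^ 2 + (r * sin t) ^ 2) with (r * r * ((sin t)² + (cos t)²))
    by (unfold Rsqr; ring).
  rewrite sin2_cos2, Rmult_1_r. apply sqrt_Rsqr_abs.
Qed.

(** * Circle means *)

Definition cont (f : R -> R) : Prop := forall t, continuous f t.
Definition ccont (f : R -> C) : Prop := cont (fun t => Re (f t)) /\ cont (fun t => Im (f t)).

Definition mean (f : R -> R) : R := / (2 * PI) * RInt f 0 (2 * PI).
(** Complex means are taken componentwise, which reduces them to real integration; [cmean_RInt]
    returns to the integral that occurs in [pairing]. *)
Definition cmean (f : R -> C) : C := (mean (fun t => Re (f t)), mean (fun t => Im (f t))).

Lemma cont_const (x : R) : cont (fun _ => x).
Proof. intros t. apply continuous_const. Qed.

Lemma cont_plus (f g : R -> R) : cont f -> cont g -> cont (fun t => f t + g t).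
Proof. intros Hf Hg t. apply (continuous_plus f g); auto. Qed.

Lemma cont_minus (f g : R -> R) : cont f -> cont g -> cont (fun t => f t - g t).
Proof. intros Hf Hg t. apply (continuous_minus f g); auto. Qed.

Lemma cont_mult (f g : R -> R) : cont f -> cont g -> cont (fun t => f t * g t).
Proof. intros Hf Hg t. apply (continuous_mult f g); auto. Qed.

Lemma cont_comp (f g : R -> R) : cont f -> (forall t, continuous g (f t)) -> cont (fun t => g (f t)).
Proof. intros Hf Hg t. apply (continuous_comp f g); auto. Qed.

Lemma cont_ext (f g : R -> R) : (forall t, f t = g t) -> cont f -> cont g.
Proof. intros H Hf t. apply continuous_ext with f; auto. Qed.

Lemma cont_of_ex_derive (f : R -> R) : (forall t, ex_derive f t) -> cont f.
Proof. intros H t. apply (ex_derive_continuous (V := R_NormedModule)), H. Qed.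

Lemma cont_inv (f : R -> R) : cont f -> (forall t, f t <> 0) -> cont (fun t => / f t).
Proof.
  intros Hf H. apply (cont_comp f Rinv); auto. intros t.
  apply (ex_derive_continuous (V := R_NormedModule)).
  exists (- 1 / (f t) ^ 2). auto_derive; auto. field. auto.
Qed.

Lemma cont_sqrt (f : R -> R) : cont f -> cont (fun t => sqrt (f t)).
Proof. intros Hf. apply (cont_comp f sqrt); auto. intros t. apply continuous_sqrt. Qed.

Lemma cont_pow (f : R -> R) (k : nat) : cont f -> cont (fun t => f t ^ k).
Proof. intros Hf. induction k; simpl; [apply cont_const | apply cont_mult; auto]. Qed.

Lemma cont_unif (f : R -> R) :
  (forall eps, 0 < eps -> exists g, cont g /\ forall t, Rabs (g t - f t) <= eps) -> cont f.
Proof.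
  intros H t. apply continuity_pt_filterlim. intros eps He.
  destruct (H (eps / 4) ltac:(lra)) as [g [Hg Hfg]].
  pose proof (proj2 (continuity_pt_filterlim g t) (Hg t)) as Hc.
  destruct (Hc (eps / 4) ltac:(lra)) as [d [Hd Hdd]].
  exists d. split; auto. intros x Hx. specialize (Hdd x Hx).
  simpl in *. unfold R_dist in *.
  pose proof (Hfg x) as H1. pose proof (Hfg t) as H2.
  apply Rabs_le_between in H1. apply Rabs_le_between in H2. apply Rabs_lt_between in Hdd.
  apply Rabs_lt_between. lra.
Qed.

Lemma ccont_const (x : C) : ccont (fun _ => x).
Proof. split; apply cont_const. Qed.

Lemma ccont_plus (f g : R -> C) : ccont f -> ccont g -> ccont (fun t => (f t + g t)%C).
Proof. intros [H1 H2] [H3 H4]; split; simpl; apply cont_plus; auto. Qed.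

Lemma ccont_minus (f g : R -> C) : ccont f -> ccont g -> ccont (fun t => (f t - g t)%C).
Proof.
  intros [H1 H2] [H3 H4]; split; simpl; apply cont_minus; auto.
Qed.

Lemma ccont_mult (f g : R -> C) : ccont f -> ccont g -> ccont (fun t => (f t * g t)%C).
Proof.
  intros [H1 H2] [H3 H4]; split; simpl;
    [apply cont_minus | apply cont_plus]; apply cont_mult; auto.
Qed.

Lemma ccont_conj (f : R -> C) : ccont f -> ccont (fun t => Cconj (f t)).
Proof.
  intros [H1 H2]; split; simpl; auto.
  apply cont_ext with (fun t => (-1) * Im (f t)).
  - intros t; unfold Im; ring.
  - apply cont_mult; auto. apply cont_const.
Qed.

Lemma ccont_csum (f : nat -> R -> C) (n : nat) :
  (forall k, ccont (f k)) -> ccont (fun t => csum (fun k => f k t) n).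
Proof. intros H. induction n; simpl; [apply ccont_const | apply ccont_plus; auto]. Qed.

Lemma ccont_RtoC (f : R -> R) : cont f -> ccont (fun t => RtoC (f t)).
Proof. intros H; split; simpl; auto. apply cont_const. Qed.

Lemma cont_Cmod (f : R -> C) : ccont f -> cont (fun t => Cmod (f t)).
Proof.
  intros [H1 H2]. unfold Cmod. apply cont_sqrt. apply cont_plus; apply cont_pow; auto.
Qed.

Lemma ccont_pow_n_cis (r : R) (k : nat) : ccont (fun t => pow_n (cis r t) k).
Proof.
  induction k.
  - apply (ccont_const (RtoC 1)).
  - simpl. apply (ccont_mult (fun t => cis r t) (fun t => pow_n (cis r t) k)); auto.
    split; simpl; apply cont_of_ex_derive; intros t; auto_derive; auto.
Qed.

Lemma ccont_psum_upto (c : nat -> C) (n : nat) (r : R) : ccont (fun t => psum_upto c n (cis r t)).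
Proof.
  unfold psum_upto. apply ccont_csum. intros k. apply ccont_mult; [apply ccont_const|].
  apply ccont_pow_n_cis.
Qed.

Lemma im_le_Cmod (c : C) : Rabs (Im c) <= Cmod c.
Proof. eapply Rle_trans; [apply Rmax_r|]. apply Rmax_Cmod. Qed.

Lemma ccont_unif (f : R -> C) :
  (forall eps, 0 < eps -> exists g, ccont g /\ forall t, Cmod (g t - f t) <= eps) -> ccont f.
Proof.
  intros H; split; apply cont_unif; intros eps He; destruct (H eps He) as [g [[H1 H2] H3]].
  - exists (fun t => Re (g t)). split; auto. intros t. eapply Rle_trans; [|apply H3].
    eapply Rle_trans; [|apply re_le_Cmod]. simpl. right. reflexivity.
  - exists (fun t => Im (g t)). split; auto. intros t. eapply Rle_trans; [|apply H3].
    eapply Rle_trans; [|apply im_le_Cmod]. simpl. right. reflexivity.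
Qed.

Lemma cis_majorized (c : nat -> C) (r t : R) (u : nat -> R) :
  0 <= r -> majorized c (RtoC r) u -> majorized c (cis r t) u.
Proof.
  intros Hr [H1 H2]; split; auto. intros k. specialize (H2 k).
  rewrite Cmod_R in H2. now rewrite Cmod_cis.
Qed.

Lemma ccont_psum (c : nat -> C) (r : R) (u : nat -> R) :
  0 <= r -> majorized c (RtoC r) u -> ccont (fun t => psum c (cis r t)).
Proof.
  intros Hr H. apply ccont_unif. intros eps He.
  destruct (tail_lim u eps (proj1 H) He) as [N HN].
  exists (fun t => psum_upto c N (cis r t)). split; [apply ccont_psum_upto|]. intros t.
  eapply Rle_trans; [apply (psum_approx _ _ u), cis_majorized; auto|].
  specialize (HN N ltac:(lia)). apply Rabs_lt_between in HN. lra.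
Qed.

Lemma cont_RInt (f : R -> R) (a b : R) : cont f -> ex_RInt f a b.
Proof. intros H. apply (ex_RInt_continuous (V := R_CompleteNormedModule)). auto. Qed.

Lemma PI2_pos : 0 < 2 * PI.
Proof. pose proof PI_RGT_0. lra. Qed.

Lemma mean_ext (f g : R -> R) : (forall t, f t = g t) -> mean f = mean g.
Proof. intros H. unfold mean. f_equal. apply RInt_ext. auto. Qed.

Lemma mean_const (x : R) : mean (fun _ => x) = x.
Proof.
  unfold mean. rewrite RInt_const. unfold scal; simpl. unfold mult; simpl.
  pose proof PI2_pos. field. lra.
Qed.

Lemma mean_plus (f g : R -> R) : cont f -> cont g -> mean (fun t => f t + g t) = mean f + mean g.
Proof.
  intros Hf Hg. unfold mean.
  rewrite (RInt_plus f g); [unfold plus; simpl; ring | apply cont_RInt; auto | apply cont_RInt; auto].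
Qed.

Lemma mean_scal (l : R) (f : R -> R) : cont f -> mean (fun t => l * f t) = l * mean f.
Proof.
  intros Hf. unfold mean.
  rewrite (RInt_scal f); [unfold scal; simpl; unfold mult; simpl; ring | apply cont_RInt; auto].
Qed.

Lemma mean_minus (f g : R -> R) : cont f -> cont g -> mean (fun t => f t - g t) = mean f - mean g.
Proof.
  intros Hf Hg. unfold mean.
  rewrite (RInt_minus f g); [unfold minus, plus, opp; simpl; ring | apply cont_RInt; auto | apply cont_RInt; auto].
Qed.

Lemma mean_le (f g : R -> R) : cont f -> cont g -> (forall t, f t <= g t) -> mean f <= mean g.
Proof.
  intros Hf Hg H. unfold mean. pose proof PI2_pos.
  apply Rmult_le_compat_l; [left; apply Rinv_0_lt_compat; lra|].
  apply RInt_le; auto using cont_RInt. lra.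
Qed.

Lemma mean_nonneg (f : R -> R) : cont f -> (forall t, 0 <= f t) -> 0 <= mean f.
Proof. intros Hf H. rewrite <- (mean_const 0) at 1. apply mean_le; auto using cont_const. Qed.

Lemma mean_abs (f : R -> R) : cont f -> Rabs (mean f) <= mean (fun t => Rabs (f t)).
Proof.
  intros Hf.
  assert (Ha : cont (fun t => Rabs (f t))).
  { apply (cont_comp f Rabs); auto. intros t. apply continuous_Rabs. }
  apply Rabs_le. split.
  - replace (- mean (fun t => Rabs (f t))) with (mean (fun t => (-1) * Rabs (f t)))
      by (rewrite mean_scal; auto; ring).
    apply mean_le; auto. apply cont_mult; auto using cont_const.
    intros t. pose proof (Rle_abs (- f t)). rewrite Rabs_Ropp in H. lra.
  - apply mean_le; auto. intros t. apply Rle_abs.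
Qed.

Lemma small_scale (e L : R) : 0 < e -> 0 < L -> exists d, 0 < d <= 1 /\ d * L <= e.
Proof.
  intros He HL. exists (Rmin 1 (e / L)). split; [split|].
  - apply Rmin_pos; [lra | apply Rdiv_lt_0_compat; auto].
  - apply Rmin_l.
  - apply Rle_trans with (e / L * L); [|right; field; lra].
    apply Rmult_le_compat_r; [lra | apply Rmin_r].
Qed.

Lemma Cmod_diff (x y : C) : Rabs (Cmod x - Cmod y) <= Cmod (x - y).
Proof.
  pose proof (Cmod_triangle (x - y) y) as T1. pose proof (Cmod_triangle (- (x - y)) x) as T2.
  rewrite Cmod_opp in T2. replace (x - y + y)%C with x in T1 by ring.
  replace (- (x - y) + x)%C with y in T2 by ring. apply Rabs_le. lra.
Qed.

Lemma sq_close (a b K e : R) :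
  Rabs (a - b) <= e -> 0 <= a <= K -> 0 <= b <= K -> Rabs (a ^ 2 - b ^ 2) <= 2 * K * e.
Proof.
  intros H Ha Hb. replace (a ^ 2 - b ^ 2) with ((a - b) * (a + b)) by ring.
  rewrite Rabs_mult, (Rabs_pos_eq (a + b)) by lra.
  replace (2 * K * e) with (e * (2 * K)) by ring.
  apply Rmult_le_compat; auto; [apply Rabs_pos | lra | lra].
Qed.

Lemma Cmod2_close (x y : C) (K d : R) :
  d <= 1 -> Cmod y <= K -> Cmod (x - y) <= d -> Rabs (Cmod x ^ 2 - Cmod y ^ 2) <= 2 * (K + 1) * d.
Proof.
  intros Hd Hy Hxy. pose proof (Cmod_diff x y) as H. pose proof (Rle_trans _ _ _ H Hxy) as H1.
  pose proof (Rabs_le_between (Cmod x - Cmod y) d) as [H2 _]. specialize (H2 H1).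
  pose proof (Cmod_ge_0 x). pose proof (Cmod_ge_0 y). apply sq_close; lra.
Qed.

Lemma mean_close (f g : R -> R) (eps : R) :
  cont f -> cont g -> (forall t, Rabs (f t - g t) <= eps) -> Rabs (mean f - mean g) <= eps.
Proof.
  intros Hf Hg H. rewrite <- mean_minus; auto.
  eapply Rle_trans; [apply mean_abs, cont_minus; auto|].
  rewrite <- (mean_const eps). apply mean_le; auto using cont_const.
  apply (cont_comp (fun t => f t - g t) Rabs); [apply cont_minus; auto|].
  intros t; apply continuous_Rabs.
Qed.

Lemma cmean_ext (f g : R -> C) : (forall t, f t = g t) -> cmean f = cmean g.
Proof. intros H. unfold cmean. f_equal; apply mean_ext; intros t; now rewrite H. Qed.

Lemma cmean_const (x : C) : cmean (fun _ => x) = x.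
Proof. unfold cmean. rewrite !mean_const. destruct x; reflexivity. Qed.

Lemma cmean_plus (f g : R -> C) :
  ccont f -> ccont g -> cmean (fun t => (f t + g t)%C) = (cmean f + cmean g)%C.
Proof.
  intros [H1 H2] [H3 H4]. unfold cmean, Cplus. simpl.
  rewrite <- !mean_plus; auto.
Qed.

Lemma cmean_scal (l : C) (f : R -> C) : ccont f -> cmean (fun t => (l * f t)%C) = (l * cmean f)%C.
Proof.
  intros [H1 H2]. unfold cmean, Cmult. destruct l as [a b]. simpl.
  rewrite mean_minus, mean_plus, !mean_scal; auto;
    apply (cont_mult (fun _ => _)); auto using cont_const.
Qed.

Lemma cmean_csum (f : nat -> R -> C) (n : nat) :
  (forall k, ccont (f k)) -> cmean (fun t => csum (fun k => f k t) n) = csum (fun k => cmean (f k)) n.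
Proof.
  intros H. induction n as [|n IH]; simpl.
  - apply cmean_const.
  - rewrite <- IH. apply cmean_plus; auto. apply ccont_csum; auto.
Qed.

Lemma cmean_Re (f : R -> C) : Re (cmean f) = mean (fun t => Re (f t)).
Proof. reflexivity. Qed.

(** A unimodular factor makes the mean a nonnegative real; it then equals the mean of a real part,
    and monotonicity of real means suffices. *)
Lemma Cmod_cmean (f : R -> C) : ccont f -> Cmod (cmean f) <= mean (fun t => Cmod (f t)).
Proof.
  intros Hf. destruct (Req_dec (Cmod (cmean f)) 0) as [H0|H0].
  - rewrite H0. apply mean_nonneg; [apply cont_Cmod; auto | intros; apply Cmod_ge_0].
  - pose proof (Cmod_ge_0 (cmean f)) as Hp.
    set (m := cmean f) in *. set (l := (Cconj m / RtoC (Cmod m))%C).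
    assert (Hne : RtoC (Cmod m) <> RtoC 0) by (intros E; apply RtoC_inj in E; lra).
    assert (Hl : Cmod l = 1).
    { unfold l. rewrite Cmod_div; auto. rewrite Cmod_conj, Cmod_R, Rabs_pos_eq; auto.
      field; lra. }
    assert (E : (l * m)%C = RtoC (Cmod m)).
    { unfold l. replace (Cconj m / Cmod m * m)%C with ((m * Cconj m) / Cmod m)%C by (field; auto).
      rewrite <- Cmod2_conj. rewrite RtoC_pow. field; auto. }
    replace (Cmod m) with (Re (l * m)%C) by (rewrite E; reflexivity).
    unfold m. rewrite <- cmean_scal; auto. rewrite cmean_Re.
    apply mean_le.
    + apply (ccont_mult (fun _ => l) f); auto using ccont_const.
    + apply cont_Cmod; auto.
    + intros t. eapply Rle_trans; [apply Rle_abs|].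
      eapply Rle_trans; [apply re_le_Cmod|]. rewrite Cmod_mult, Hl. lra.
Qed.

Lemma cmean_close (f g : R -> C) (eps : R) :
  ccont f -> ccont g -> (forall t, Cmod (f t - g t) <= eps) -> Cmod (cmean f - cmean g) <= eps.
Proof.
  intros Hf Hg H.
  replace (cmean f - cmean g)%C with (cmean (fun t => (f t + (RtoC (-1)) * g t)%C)).
  2:{ rewrite cmean_plus, cmean_scal; auto; [ring|].
      apply ccont_mult; auto; apply ccont_const. }
  eapply Rle_trans; [apply Cmod_cmean|].
  - apply ccont_plus; auto. apply ccont_mult; auto; apply ccont_const.
  - rewrite <- (mean_const eps). apply mean_le; [|apply cont_const|].
    + apply cont_Cmod, ccont_plus; auto. apply ccont_mult; auto; apply ccont_const.
    + intros t. replace (f t + -1 * g t)%C with (f t - g t)%C by ring. auto.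
Qed.

Lemma cmean_RInt (f : R -> C) :
  ccont f -> (RtoC (/ (2 * PI)) * RInt (V := C_R_CompleteNormedModule) f 0 (2 * PI))%C = cmean f.
Proof.
  intros [H1 H2].
  assert (H : is_RInt (V := C_R_CompleteNormedModule) f 0 (2 * PI)
     (RInt (fun t => Re (f t)) 0 (2 * PI), RInt (fun t => Im (f t)) 0 (2 * PI))).
  { apply (is_RInt_fct_extend_pair (U := R_NormedModule) (V := R_NormedModule));
    apply (RInt_correct (V := R_CompleteNormedModule)); apply cont_RInt; auto. }
  rewrite (is_RInt_unique _ _ _ _ H). unfold cmean, mean, Cmult, RtoC. simpl. f_equal; ring.
Qed.

(** * Orthogonality *)

Lemma RInt_cos_period (m : nat) : (m <> 0)%nat -> mean (fun t => cos (INR m * t)) = 0.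
Proof.
  intros Hm. unfold mean.
  assert (Hn : INR m <> 0) by (apply not_0_INR; auto).
  rewrite (is_RInt_unique _ _ _ (minus (sin (INR m * (2 * PI)) / INR m) (sin (INR m * 0) / INR m))).
  - replace (INR m * (2 * PI)) with (0 + 2 * INR m * PI) by ring.
    rewrite sin_period, Rmult_0_r, sin_0. unfold minus, plus, opp; simpl. field.
    split; [auto | apply PI_neq0].
  - apply (is_RInt_derive (fun t => sin (INR m * t) / INR m) (fun t => cos (INR m * t))).
    + intros x _. auto_derive; auto. field; auto.
    + intros x _. apply (ex_derive_continuous (V := R_NormedModule)). auto_derive; auto.
Qed.

Lemma RInt_sin_period (m : nat) : mean (fun t => sin (INR m * t)) = 0.
Proof.
  destruct (Nat.eq_dec m 0) as [->|Hm].
  { rewrite (mean_ext _ (fun _ => 0)); [apply mean_const|].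
    intros t. simpl. rewrite Rmult_0_l. apply sin_0. }
  unfold mean.
  assert (Hn : INR m <> 0) by (apply not_0_INR; auto).
  rewrite (is_RInt_unique _ _ _ (minus (- cos (INR m * (2 * PI)) / INR m) (- cos (INR m * 0) / INR m))).
  - replace (INR m * (2 * PI)) with (0 + 2 * INR m * PI) by ring.
    rewrite cos_period, Rmult_0_r, cos_0. unfold minus, plus, opp; simpl. field.
    split; [auto | apply PI_neq0].
  - apply (is_RInt_derive (fun t => - cos (INR m * t) / INR m) (fun t => sin (INR m * t))).
    + intros x _. auto_derive; auto. field; auto.
    + intros x _. apply (ex_derive_continuous (V := R_NormedModule)). auto_derive; auto.
Qed.

Lemma cmean_pow_n (r : R) (m : nat) :
  cmean (fun t => pow_n (cis r t) m) = if Nat.eq_dec m 0 then RtoC 1 else RtoC 0.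
Proof.
  destruct (Nat.eq_dec m 0) as [->|Hm].
  - apply (cmean_const (RtoC 1)).
  - rewrite (cmean_ext _ (fun t => (RtoC (r ^ m) * (cos (INR m * t), sin (INR m * t)))%C)).
    + rewrite cmean_scal.
      * unfold cmean. simpl. rewrite RInt_cos_period, RInt_sin_period; auto.
        unfold Cmult, RtoC; simpl. f_equal; ring.
      * split; simpl; apply cont_of_ex_derive; intros t; auto_derive; auto.
    + intros t. rewrite cis_pow. unfold cis, Cmult, RtoC; simpl. f_equal; ring.
Qed.

Lemma cmean_conj (f : R -> C) : ccont f -> cmean (fun t => Cconj (f t)) = Cconj (cmean f).
Proof.
  intros [_ H]. unfold cmean, Cconj; simpl. f_equal.
  rewrite (mean_ext _ (fun t => (-1) * Im (f t))).
  - rewrite mean_scal; auto. ring.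
  - intros t. unfold Im. ring.
Qed.

Lemma pow_n_conj (z : C) (k : nat) : Cconj (pow_n z k) = pow_n (Cconj z) k.
Proof.
  induction k as [|k IH].
  - rewrite !pow_n_0. unfold Cconj, RtoC; simpl. f_equal; ring.
  - rewrite !pow_n_S, Cmult_conj, IH. reflexivity.
Qed.

Lemma z_conj (z : C) : (z * Cconj z)%C = RtoC (Cmod z ^ 2).
Proof. symmetry. rewrite RtoC_pow. rewrite <- Cmod2_conj. now rewrite RtoC_pow. Qed.

Lemma pow_n_conj_mult (z : C) (k : nat) :
  (pow_n z k * Cconj (pow_n z k))%C = RtoC ((Cmod z ^ 2) ^ k).
Proof. rewrite z_conj, Cmod_pow_n, <- !pow_mult. now rewrite Nat.mul_comm. Qed.

Lemma cmean_pow_conj (r : R) (k m : nat) :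
  cmean (fun t => (pow_n (cis r t) k * Cconj (pow_n (cis r t) m))%C)
  = if Nat.eq_dec k m then RtoC ((r ^ 2) ^ k) else RtoC 0.
Proof.
  assert (Hr : forall t, Cmod (cis r t) ^ 2 = r ^ 2)
    by (intros t; rewrite Cmod_cis; apply pow2_abs).
  destruct (le_lt_dec m k) as [H|H].
  - rewrite (cmean_ext _ (fun t => (RtoC ((r ^ 2) ^ m) * pow_n (cis r t) (k - m))%C)).
    + rewrite cmean_scal by apply ccont_pow_n_cis. rewrite cmean_pow_n.
      destruct (Nat.eq_dec (k - m) 0), (Nat.eq_dec k m); try lia; subst; ring.
    + intros t. replace k with (m + (k - m))%nat at 1 by lia. rewrite pow_n_add.
      rewrite <- (Hr t), <- pow_n_conj_mult. ring.
  - rewrite (cmean_ext _ (fun t => (RtoC ((r ^ 2) ^ k) * Cconj (pow_n (cis r t) (m - k)))%C)).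
    + rewrite cmean_scal by apply ccont_conj, ccont_pow_n_cis.
      rewrite cmean_conj by apply ccont_pow_n_cis. rewrite cmean_pow_n.
      destruct (Nat.eq_dec (m - k) 0), (Nat.eq_dec k m); try lia.
      unfold Cconj, Cmult, RtoC; simpl. f_equal; ring.
    + intros t. replace m with (k + (m - k))%nat at 1 by lia. rewrite pow_n_add.
      rewrite <- (Hr t), <- pow_n_conj_mult, Cmult_conj. ring.
Qed.

Lemma cmean_psum_upto_pow_conj (c : nat -> C) (n m : nat) (r : R) :
  cmean (fun t => (psum_upto c n (cis r t) * Cconj (pow_n (cis r t) m))%C)
  = if lt_dec m n then (c m * RtoC ((r ^ 2) ^ m))%C else RtoC 0.
Proof.
  rewrite (cmean_ext _ (fun t => csum (fun k =>
     (c k * (pow_n (cis r t) k * Cconj (pow_n (cis r t) m)))%C) n)).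
  - rewrite cmean_csum.
    + erewrite csum_ext; [apply (csum_delta (fun k => (c k * RtoC ((r ^ 2) ^ k))%C))|].
      intros k _. cbv beta. rewrite cmean_scal.
      * rewrite cmean_pow_conj. destruct (Nat.eq_dec k m); ring.
      * apply ccont_mult; [|apply ccont_conj]; apply ccont_pow_n_cis.
    + intros k. apply ccont_mult; [apply ccont_const|].
      apply ccont_mult; [|apply ccont_conj]; apply ccont_pow_n_cis.
  - intros t. unfold psum_upto. rewrite Cmult_comm, <- csum_scal. apply csum_ext. intros; ring.
Qed.

Lemma cmean_psum_upto_conj_psum_upto (c d : nat -> C) (n : nat) (r : R) :
  cmean (fun t => (psum_upto c n (cis r t) * Cconj (psum_upto d n (cis r t)))%C)
  = csum (fun k => (c k * Cconj (d k) * RtoC ((r ^ 2) ^ k))%C) n.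
Proof.
  rewrite (cmean_ext _ (fun t => csum (fun k =>
     (Cconj (d k) * (psum_upto c n (cis r t) * Cconj (pow_n (cis r t) k)))%C) n)).
  - rewrite cmean_csum.
    + apply csum_ext. intros k Hk. rewrite cmean_scal.
      * rewrite cmean_psum_upto_pow_conj. destruct (lt_dec k n); [ring | lia].
      * apply ccont_mult; [apply ccont_psum_upto | apply ccont_conj, ccont_pow_n_cis].
    + intros k. apply ccont_mult; [apply ccont_const|].
      apply ccont_mult; [apply ccont_psum_upto | apply ccont_conj, ccont_pow_n_cis].
  - intros t. unfold psum_upto at 2. rewrite Cconj_csum, <- csum_scal. apply csum_ext.
    intros k _. rewrite Cmult_conj. ring.
Qed.

Lemma Parseval_psum_upto (c : nat -> C) (n : nat) (r : R) :
  mean (fun t => Cmod (psum_upto c n (cis r t)) ^ 2) = rsum (fun k => Cmod (c k) ^ 2 * (r ^ 2) ^ k) n.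
Proof.
  pose proof (f_equal Re (cmean_psum_upto_conj_psum_upto c c n r)) as H. rewrite cmean_Re, Re_csum in H.
  rewrite (mean_ext _ (fun t => Re (psum_upto c n (cis r t) * Cconj (psum_upto c n (cis r t)))%C)).
  - rewrite H. apply rsum_ext. intros k _. rewrite z_conj, <- RtoC_mult. reflexivity.
  - intros t. rewrite z_conj. reflexivity.
Qed.

(** * Subharmonic functions in logarithmic polar coordinates *)

Definition cont2 (F : R -> R -> R) : Prop := forall s t, continuity_2d_pt F s t.

(* [C2 F Fs Ft L]: [F] is twice continuously differentiable with gradient [(Fs, Ft)] and
   Laplacian [L]. *)
Definition C2 (F Fs Ft L : R -> R -> R) : Prop :=
  exists Fss Ftt,
    (forall s t, is_derive (fun x => F x t) s (Fs s t)) /\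
    (forall s t, is_derive (fun x => F s x) t (Ft s t)) /\
    (forall s t, is_derive (fun x => Fs x t) s (Fss s t)) /\
    (forall s t, is_derive (fun x => Ft s x) t (Ftt s t)) /\
    cont2 F /\ cont2 Fs /\ cont2 Ft /\ cont2 Fss /\ cont2 Ftt /\
    (forall s t, Fss s t + Ftt s t = L s t).

Ltac split_C2 := refine (conj _ (conj _ (conj _ (conj _ (conj _ (conj _ (conj _ (conj _ (conj _ _))))))))).

Lemma is_derive_eq (f : R -> R) (x l l' : R) : is_derive f x l -> l = l' -> is_derive f x l'.
Proof. intros H <-; exact H. Qed.

Lemma is_derive_Rmult (f g : R -> R) (x df dg : R) :
  is_derive f x df -> is_derive g x dg ->
  is_derive (fun y => f y * g y) x (df * g x + f x * dg).
Proof.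
  intros Hf Hg. apply (is_derive_mult (K := R_AbsRing) f g); auto. intros; apply Rmult_comm.
Qed.

Lemma is_derive_Rplus (f g : R -> R) (x df dg : R) :
  is_derive f x df -> is_derive g x dg -> is_derive (fun y => f y + g y) x (df + dg).
Proof. intros Hf Hg. apply (is_derive_plus (K := R_AbsRing) (V := R_NormedModule) f g); auto. Qed.

Lemma is_derive_Rcomp (eta f : R -> R) (x df de : R) :
  is_derive eta (f x) de -> is_derive f x df -> is_derive (fun y => eta (f y)) x (de * df).
Proof.
  intros He Hf. eapply is_derive_eq.
  - apply (is_derive_comp (V := R_NormedModule) eta f); eauto.
  - unfold scal; simpl; unfold mult; simpl. ring.
Qed.

Lemma cont2_plus (F G : R -> R -> R) : cont2 F -> cont2 G -> cont2 (fun s t => F s t + G s t).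
Proof. intros HF HG s t. apply continuity_2d_pt_plus; auto. Qed.

Lemma cont2_mult (F G : R -> R -> R) : cont2 F -> cont2 G -> cont2 (fun s t => F s t * G s t).
Proof. intros HF HG s t. apply continuity_2d_pt_mult; auto. Qed.

Lemma cont2_const (x : R) : cont2 (fun _ _ => x).
Proof. intros s t. apply continuity_2d_pt_const. Qed.

Lemma cont2_comp (eta : R -> R) (F : R -> R -> R) :
  cont2 F -> (forall s t, continuity_pt eta (F s t)) -> cont2 (fun s t => eta (F s t)).
Proof. intros HF H s t. apply continuity_1d_2d_pt_comp; auto. Qed.

Lemma cont2_slice (F : R -> R -> R) (s : R) : cont2 F -> cont (fun t => F s t).
Proof.
  intros H t. apply continuity_pt_filterlim. intros eps He.
  destruct (H s t (mkposreal eps He)) as [d Hd]. exists d. split; [apply cond_pos|].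
  intros x [_ Hx]. apply Hd; [rewrite Rminus_diag, Rabs_R0; apply cond_pos | exact Hx].
Qed.

Lemma C2_const (x : R) : C2 (fun _ _ => x) (fun _ _ => 0) (fun _ _ => 0) (fun _ _ => 0).
Proof.
  exists (fun _ _ => 0), (fun _ _ => 0).
  split_C2; try apply cont2_const; intros;
    first [apply (is_derive_const (V := R_NormedModule)) | lra].
Qed.

Lemma C2_plus (F Fs Ft L G Gs Gt K : R -> R -> R) :
  C2 F Fs Ft L -> C2 G Gs Gt K ->
  C2 (fun s t => F s t + G s t) (fun s t => Fs s t + Gs s t)
     (fun s t => Ft s t + Gt s t) (fun s t => L s t + K s t).
Proof.
  intros (Fss & Ftt & H1 & H2 & H3 & H4 & H5 & H6 & H7 & H8 & H9 & H10)
         (Gss & Gtt & G1 & G2 & G3 & G4 & G5 & G6 & G7 & G8 & G9 & G10).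
  exists (fun s t => Fss s t + Gss s t), (fun s t => Ftt s t + Gtt s t).
  split_C2; [intros; apply is_derive_Rplus; auto .. | apply cont2_plus; auto
    | apply cont2_plus; auto | apply cont2_plus; auto | apply cont2_plus; auto
    | apply cont2_plus; auto | intros; rewrite <- H10, <- G10; ring].
Qed.

Lemma C2_mult (F Fs Ft L G Gs Gt K : R -> R -> R) :
  C2 F Fs Ft L -> C2 G Gs Gt K ->
  C2 (fun s t => F s t * G s t) (fun s t => Fs s t * G s t + F s t * Gs s t)
     (fun s t => Ft s t * G s t + F s t * Gt s t)
     (fun s t => L s t * G s t + F s t * K s t + 2 * (Fs s t * Gs s t + Ft s t * Gt s t)).
Proof.
  intros (Fss & Ftt & H1 & H2 & H3 & H4 & H5 & H6 & H7 & H8 & H9 & H10)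
         (Gss & Gtt & G1 & G2 & G3 & G4 & G5 & G6 & G7 & G8 & G9 & G10).
  exists (fun s t => (Fss s t * G s t + Fs s t * Gs s t) + (Fs s t * Gs s t + F s t * Gss s t)),
         (fun s t => (Ftt s t * G s t + Ft s t * Gt s t) + (Ft s t * Gt s t + F s t * Gtt s t)).
  split_C2;
    [ intros s t; apply (is_derive_Rmult (fun x => F x t) (fun x => G x t)); auto
    | intros s t; apply (is_derive_Rmult (fun x => F s x) (fun x => G s x)); auto
    | intros s t; apply (is_derive_Rplus (fun x => Fs x t * G x t) (fun x => F x t * Gs x t));
      [ apply (is_derive_Rmult (fun x => Fs x t) (fun x => G x t))
      | apply (is_derive_Rmult (fun x => F x t) (fun x => Gs x t))]; auto
    | intros s t; apply (is_derive_Rplus (fun x => Ft s x * G s x) (fun x => F s x * Gt s x));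
      [ apply (is_derive_Rmult (fun x => Ft s x) (fun x => G s x))
      | apply (is_derive_Rmult (fun x => F s x) (fun x => Gt s x))]; auto
    | repeat first [apply cont2_plus | apply cont2_mult]; auto ..
    | intros; rewrite <- H10, <- G10; ring].
Qed.

Lemma C2_comp (eta eta1 eta2 : R -> R) (F Fs Ft L : R -> R -> R) :
  C2 F Fs Ft L ->
  (forall s t, is_derive eta (F s t) (eta1 (F s t))) ->
  (forall s t, is_derive eta1 (F s t) (eta2 (F s t))) ->
  (forall s t, continuity_pt eta2 (F s t)) ->
  C2 (fun s t => eta (F s t)) (fun s t => eta1 (F s t) * Fs s t) (fun s t => eta1 (F s t) * Ft s t)
     (fun s t => eta1 (F s t) * L s t + eta2 (F s t) * (Fs s t ^ 2 + Ft s t ^ 2)).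
Proof.
  intros (Fss & Ftt & H1 & H2 & H3 & H4 & H5 & H6 & H7 & H8 & H9 & H10) E1 E2 E3.
  assert (C0 : forall f f1 : R -> R, (forall s t, is_derive f (F s t) (f1 (F s t))) ->
    forall s t, continuity_pt f (F s t)).
  { intros f f1 Hf s t. apply continuity_pt_filterlim.
    apply (ex_derive_continuous (V := R_NormedModule)). exists (f1 (F s t)). apply Hf. }
  exists (fun s t => (eta2 (F s t) * Fs s t) * Fs s t + eta1 (F s t) * Fss s t),
         (fun s t => (eta2 (F s t) * Ft s t) * Ft s t + eta1 (F s t) * Ftt s t).
  split_C2.
  - intros s t. apply (is_derive_Rcomp eta (fun x => F x t)); auto.
  - intros s t. apply (is_derive_Rcomp eta (fun x => F s x)); auto.
  - intros s t. apply (is_derive_Rmult (fun x => eta1 (F x t)) (fun x => Fs x t)); auto.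
    apply (is_derive_Rcomp eta1 (fun x => F x t)); auto.
  - intros s t. apply (is_derive_Rmult (fun x => eta1 (F s x)) (fun x => Ft s x)); auto.
    apply (is_derive_Rcomp eta1 (fun x => F s x)); auto.
  - apply cont2_comp; eauto.
  - apply cont2_mult; auto. apply cont2_comp; eauto.
  - apply cont2_mult; auto. apply cont2_comp; eauto.
  - apply cont2_plus; repeat apply cont2_mult; auto; apply cont2_comp; eauto.
  - apply cont2_plus; repeat apply cont2_mult; auto; apply cont2_comp; eauto.
  - intros s t. rewrite <- H10. ring.
Qed.

Lemma is_derive_mean (F Fs : R -> R -> R) (s : R) :
  (forall s t, is_derive (fun x => F x t) s (Fs s t)) -> cont2 F -> cont2 Fs ->
  is_derive (fun x => mean (F x)) s (mean (Fs s)).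
Proof.
  intros H HF HFs. unfold mean.
  apply (is_derive_scal (fun x => RInt (F x) 0 (2 * PI))).
  rewrite (RInt_ext _ (fun t => Derive (fun u => F u t) s)).
  - apply (is_derive_RInt_param F).
    + apply filter_forall. intros x t _. exists (Fs x t). apply H.
    + intros t _. apply continuity_2d_pt_ext with Fs; auto.
      intros x y. symmetry. apply is_derive_unique. apply H.
    + apply filter_forall. intros x. apply cont_RInt. apply cont2_slice; auto.
  - intros t _. symmetry. apply is_derive_unique, H.
Qed.

Lemma nondecreasing_of_derive (f df : R -> R) (b : R) :
  (forall x, x < b -> is_derive f x (df x)) -> (forall x, x < b -> 0 <= df x) ->
  forall x y, x <= y -> y < b -> f x <= f y.
Proof.
  intros Hd Hp x y Hxy Hy.
  destruct (MVT_gen f x y df) as [c [Hc E]].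
  - intros z Hz. apply Hd. rewrite Rmax_right in Hz; lra.
  - intros z Hz. apply continuity_pt_filterlim.
    apply (ex_derive_continuous (V := R_NormedModule)). exists (df z). apply Hd.
    rewrite Rmax_right in Hz; lra.
  - rewrite Rmin_left, Rmax_right in Hc by lra.
    assert (0 <= df c * (y - x)) by (apply Rmult_le_pos; [apply Hp|]; lra). lra.
Qed.

(** A negative slope of a convex function persists to the left, so the function would exceed every
    bound near minus infinity. *)
Lemma convex_bounded_nondecreasing (m dm ddm : R -> R) (b B : R) :
  (forall x, is_derive m x (dm x)) -> (forall x, is_derive dm x (ddm x)) ->
  (forall x, x < b -> 0 <= ddm x) -> (forall x, x < b -> m x <= B) ->
  forall x y, x <= y -> y < b -> m x <= m y.
Proof.
  intros D1 D2 Hddm HB. apply nondecreasing_of_derive with dm; auto.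
  intros x Hx. apply Rnot_lt_le. intros Hneg.
  assert (Hincr := nondecreasing_of_derive dm ddm b (fun s _ => D2 s) Hddm).
  set (d := - dm x). assert (Hd : 0 < d) by (unfold d; lra).
  (* Far enough to the left for the mean value theorem to give
     [m y >= m x + Rmax 0 (B - m x) + 1 > B]. *)
  set (y := x - (Rmax 0 (B - m x) + 1) / d).
  pose proof (Rmax_l 0 (B - m x)). pose proof (Rmax_r 0 (B - m x)).
  assert (Hy : y < x).
  { unfold y. assert (0 < (Rmax 0 (B - m x) + 1) / d) by (apply Rdiv_lt_0_compat; lra). lra. }
  destruct (MVT_gen m y x dm) as [c [Hc E]].
  - intros z _. apply D1.
  - intros z _. apply continuity_pt_filterlim.
    apply (ex_derive_continuous (V := R_NormedModule)). exists (dm z). apply D1.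
  - rewrite Rmin_left, Rmax_right in Hc by lra.
    pose proof (Hincr c x ltac:(lra) Hx) as Hcx.
    assert (Hle : dm c * (x - y) <= dm x * (x - y)) by (apply Rmult_le_compat_r; lra).
    assert (E2 : dm x * (x - y) = - (Rmax 0 (B - m x) + 1)) by (unfold y, d; field; lra).
    pose proof (HB y ltac:(lra)). lra.
Qed.

(* The mean over the circle of radius [exp s] is a convex function of [s], since its second
   derivative is the mean of the Laplacian; being bounded near minus infinity, it increases. *)
Lemma mean_subharmonic (Q Qs Qt L : R -> R -> R) (s1 B : R) :
  C2 Q Qs Qt L ->
  (forall s, Qt s (2 * PI) = Qt s 0) ->
  (forall s t, s < s1 -> 0 <= L s t) ->
  (forall s t, s < s1 -> Q s t <= B) ->
  forall x y, x <= y -> y < s1 -> mean (Q x) <= mean (Q y).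
Proof.
  intros (Qss & Qtt & H1 & H2 & H3 & H4 & H5 & H6 & H7 & H8 & H9 & H10) Hper HL HB.
  assert (D1 : forall s, is_derive (fun x => mean (Q x)) s (mean (Qs s)))
    by (intros; apply is_derive_mean; auto).
  assert (D2 : forall s, is_derive (fun x => mean (Qs x)) s (mean (Qss s)))
    by (intros; apply is_derive_mean; auto).
  assert (Htt : forall s, mean (Qtt s) = 0).
  { intros s. unfold mean.
    rewrite (is_RInt_unique _ _ _ (minus (Qt s (2 * PI)) (Qt s 0))).
    - rewrite Hper. unfold minus, plus, opp; simpl. ring.
    - apply (is_RInt_derive (fun t => Qt s t) (Qtt s)).
      + intros t _. apply H4.
      + intros t _. apply (cont2_slice Qtt s); auto. }
  assert (Hss : forall s, s < s1 -> 0 <= mean (Qss s)).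
  { intros s Hs.
    replace (mean (Qss s)) with (mean (fun t => Qss s t + Qtt s t))
      by (rewrite mean_plus by (apply (cont2_slice _ s); auto); rewrite Htt; ring).
    apply mean_nonneg.
    - apply cont_plus; apply (cont2_slice _ s); auto.
    - intros t. rewrite H10. auto. }
  apply (convex_bounded_nondecreasing (fun s => mean (Q s)) (fun s => mean (Qs s))
    (fun s => mean (Qss s)) s1 B); auto.
  intros y Hy. rewrite <- (mean_const B). apply mean_le; auto using cont_const.
  apply (cont2_slice Q y); auto.
Qed.

(** * Analytic polynomials in logarithmic polar coordinates *)

(** Real and imaginary part of the polynomial at the point [exp (s + i t)], expanded into real terms
    so that they can be differentiated one by one; the Cauchy-Riemann equations appear as the four
    derivative lemmas below. *)
Definition pRe (c : nat -> C) (n : nat) (s t : R) : R :=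
  rsum (fun k => exp (INR k * s) * (Re (c k) * cos (INR k * t) - Im (c k) * sin (INR k * t))) n.
Definition pIm (c : nat -> C) (n : nat) (s t : R) : R :=
  rsum (fun k => exp (INR k * s) * (Re (c k) * sin (INR k * t) + Im (c k) * cos (INR k * t))) n.
(* Coefficients of the derivative with respect to [log z]. *)
Definition dlog (c : nat -> C) : nat -> C := fun k => (RtoC (INR k) * c k)%C.

Lemma exp_INR_pow (s : R) (k : nat) : exp s ^ k = exp (INR k * s).
Proof.
  induction k as [|k IH].
  - simpl. now rewrite Rmult_0_l, exp_0.
  - simpl pow. rewrite IH, S_INR, <- exp_plus. f_equal. ring.
Qed.

Lemma psum_upto_polar (c : nat -> C) (n : nat) (s t : R) :
  psum_upto c n (cis (exp s) t) = (pRe c n s t, pIm c n s t).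
Proof.
  unfold psum_upto. apply injective_projections.
  - change (fst ?x) with (Re x). rewrite Re_csum. apply rsum_ext. intros k _.
    rewrite cis_pow, exp_INR_pow. unfold cis, Re, Im. simpl. ring.
  - change (snd ?x) with (Im x). rewrite Im_csum. apply rsum_ext. intros k _.
    rewrite cis_pow, exp_INR_pow. unfold cis, Re, Im. simpl. ring.
Qed.

Lemma is_derive_rsum (f df : nat -> R -> R) (n : nat) (x : R) :
  (forall k, is_derive (f k) x (df k x)) ->
  is_derive (fun y => rsum (fun k => f k y) n) x (rsum (fun k => df k x) n).
Proof.
  intros H. induction n as [|n IH]; simpl.
  - apply (is_derive_const (V := R_NormedModule)).
  - apply is_derive_Rplus; auto.
Qed.

Lemma cont2_rsum (f : nat -> R -> R -> R) (n : nat) :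
  (forall k, cont2 (f k)) -> cont2 (fun s t => rsum (fun k => f k s t) n).
Proof. intros H. induction n; simpl; [apply cont2_const | apply cont2_plus; auto]. Qed.

Lemma cont2_of_ex_derive_l (f : R -> R) : (forall x, ex_derive f x) -> cont2 (fun s _ => f s).
Proof.
  intros H. apply (cont2_comp f (fun s _ => s)); [intros s t; apply continuity_2d_pt_id1|].
  intros s _. apply continuity_pt_filterlim, (ex_derive_continuous (V := R_NormedModule)), H.
Qed.

Lemma cont2_of_ex_derive_r (f : R -> R) : (forall x, ex_derive f x) -> cont2 (fun _ t => f t).
Proof.
  intros H. apply (cont2_comp f (fun _ t => t)); [intros s t; apply continuity_2d_pt_id2|].
  intros s t. apply continuity_pt_filterlim, (ex_derive_continuous (V := R_NormedModule)), H.
Qed.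

Lemma cont2_pRe (c : nat -> C) (n : nat) : cont2 (pRe c n).
Proof.
  apply (cont2_rsum (fun k s t => exp (INR k * s) * (Re (c k) * cos (INR k * t) - Im (c k) * sin (INR k * t)))).
  intros k. apply cont2_mult.
  - apply (cont2_of_ex_derive_l (fun s => exp (INR k * s))). intros; auto_derive; auto.
  - apply (cont2_of_ex_derive_r (fun t => Re (c k) * cos (INR k * t) - Im (c k) * sin (INR k * t))).
    intros; auto_derive; auto.
Qed.

Lemma cont2_pIm (c : nat -> C) (n : nat) : cont2 (pIm c n).
Proof.
  apply (cont2_rsum (fun k s t => exp (INR k * s) * (Re (c k) * sin (INR k * t) + Im (c k) * cos (INR k * t)))).
  intros k. apply cont2_mult.
  - apply (cont2_of_ex_derive_l (fun s => exp (INR k * s))). intros; auto_derive; auto.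
  - apply (cont2_of_ex_derive_r (fun t => Re (c k) * sin (INR k * t) + Im (c k) * cos (INR k * t))).
    intros; auto_derive; auto.
Qed.

Lemma dlog_Re (c : nat -> C) (k : nat) : Re (dlog c k) = INR k * Re (c k).
Proof. unfold dlog, Re. simpl. ring. Qed.
Lemma dlog_Im (c : nat -> C) (k : nat) : Im (dlog c k) = INR k * Im (c k).
Proof. unfold dlog, Im. simpl. ring. Qed.

Lemma pRe_ds (c : nat -> C) (n : nat) (s t : R) :
  is_derive (fun x => pRe c n x t) s (pRe (dlog c) n s t).
Proof.
  apply (is_derive_rsum (fun k s => exp (INR k * s) * (Re (c k) * cos (INR k * t) - Im (c k) * sin (INR k * t)))
    (fun k s => exp (INR k * s) * (Re (dlog c k) * cos (INR k * t) - Im (dlog c k) * sin (INR k * t)))).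
  intros k. rewrite dlog_Re, dlog_Im. auto_derive; auto. ring.
Qed.

Lemma pIm_ds (c : nat -> C) (n : nat) (s t : R) :
  is_derive (fun x => pIm c n x t) s (pIm (dlog c) n s t).
Proof.
  apply (is_derive_rsum (fun k s => exp (INR k * s) * (Re (c k) * sin (INR k * t) + Im (c k) * cos (INR k * t)))
    (fun k s => exp (INR k * s) * (Re (dlog c k) * sin (INR k * t) + Im (dlog c k) * cos (INR k * t)))).
  intros k. rewrite dlog_Re, dlog_Im. auto_derive; auto. ring.
Qed.

Lemma pRe_dt (c : nat -> C) (n : nat) (s t : R) :
  is_derive (fun x => pRe c n s x) t (- pIm (dlog c) n s t).
Proof.
  eapply is_derive_eq.
  - apply (is_derive_rsum (fun k t => exp (INR k * s) * (Re (c k) * cos (INR k * t) - Im (c k) * sin (INR k * t)))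
    (fun k t => (-1) * (exp (INR k * s) * (Re (dlog c k) * sin (INR k * t) + Im (dlog c k) * cos (INR k * t))))).
    intros k. rewrite dlog_Re, dlog_Im. auto_derive; auto. ring.
  - rewrite rsum_scal. unfold pIm. ring.
Qed.

Lemma pIm_dt (c : nat -> C) (n : nat) (s t : R) :
  is_derive (fun x => pIm c n s x) t (pRe (dlog c) n s t).
Proof.
  apply (is_derive_rsum (fun k t => exp (INR k * s) * (Re (c k) * sin (INR k * t) + Im (c k) * cos (INR k * t)))
    (fun k t => exp (INR k * s) * (Re (dlog c k) * cos (INR k * t) - Im (dlog c k) * sin (INR k * t)))).
  intros k. rewrite dlog_Re, dlog_Im. auto_derive; auto. ring.
Qed.

Lemma cont2_opp (F : R -> R -> R) : cont2 F -> cont2 (fun s t => - F s t).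
Proof. intros H s t. apply continuity_2d_pt_opp, H. Qed.

Lemma is_derive_Ropp (f : R -> R) (x l : R) : is_derive f x l -> is_derive (fun y => - f y) x (- l).
Proof. intros H. apply (is_derive_opp (K := R_AbsRing) (V := R_NormedModule) f), H. Qed.

Lemma C2_pRe (c : nat -> C) (n : nat) :
  C2 (pRe c n) (pRe (dlog c) n) (fun s t => - pIm (dlog c) n s t) (fun _ _ => 0).
Proof.
  exists (pRe (dlog (dlog c)) n), (fun s t => - pRe (dlog (dlog c)) n s t).
  split_C2; intros; try apply cont2_opp; try apply cont2_pRe; try apply cont2_pIm;
    try apply pRe_ds; try apply pRe_dt; try apply is_derive_Ropp, pIm_dt. lra.
Qed.

Lemma C2_pIm (c : nat -> C) (n : nat) :
  C2 (pIm c n) (pIm (dlog c) n) (pRe (dlog c) n) (fun _ _ => 0).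
Proof.
  exists (pIm (dlog (dlog c)) n), (fun s t => - pIm (dlog (dlog c)) n s t).
  split_C2; intros; try apply cont2_opp; try apply cont2_pRe; try apply cont2_pIm;
    try apply pIm_ds; try apply pIm_dt; try apply pRe_dt. lra.
Qed.

Lemma psum_upto_period (c : nat -> C) (n : nat) (s : R) :
  pRe c n s (2 * PI) = pRe c n s 0 /\ pIm c n s (2 * PI) = pIm c n s 0.
Proof.
  assert (H : psum_upto c n (cis (exp s) (2 * PI)) = psum_upto c n (cis (exp s) 0)).
  { f_equal. unfold cis. now rewrite cos_2PI, sin_2PI, cos_0, sin_0. }
  rewrite !psum_upto_polar in H. now inversion H.
Qed.

(** * The basic subharmonic function *)

Lemma sqrt_der (x : R) : 0 < x -> is_derive sqrt x (/ (2 * sqrt x)).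
Proof.
  intros Hx. auto_derive; auto. ring.
Qed.

Lemma sqrt_der2 (x : R) : 0 < x ->
  is_derive (fun y => / (2 * sqrt y)) x (- / (4 * (sqrt x) ^ 3)).
Proof.
  intros Hx. pose proof (sqrt_lt_R0 x Hx). auto_derive.
  - split; [auto|]. split; [|exact I]. lra.
  - field. lra.
Qed.

(* The left side is the Laplacian of [Qfun] below; [p] and [q] stand for
   the derivatives of [g] and [h], [f] for the gradient of the exponent. *)
Lemma laplacian_nonneg (eta eps A E g1 g2 p1 p2 q1 q2 f1 f2 : R) :
  0 < eta -> 0 < A -> A ^ 2 = g1 ^ 2 + g2 ^ 2 + eps -> 0 <= eps -> 1 <= E ->
  let w1 := 2 * (g1 * p1 + g2 * p2) in
  let w2 := 2 * (g2 * p1 - g1 * p2) in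
  let LA := / (2 * A) * (4 * (p1 ^ 2 + p2 ^ 2)) + - / (4 * A ^ 3) * (w1 ^ 2 + w2 ^ 2) in
  0 <= / eta * LA
     + eta * (LA * E + A * (E * (4 * (q1 ^ 2 + q2 ^ 2)) + E * (f1 ^ 2 + f2 ^ 2))
              + 2 * (/ (2 * A) * w1 * (E * f1) + / (2 * A) * w2 * (E * f2)))
     - 4 * (p1 * q1 + p2 * q2).
Proof.
  intros Heta HA HA2 Heps HE w1 w2 LA.
  set (N := p1 ^ 2 + p2 ^ 2). set (H := q1 ^ 2 + q2 ^ 2).
  assert (HN : 0 <= N) by (unfold N; nra). assert (HH : 0 <= H) by (unfold H; nra).
  assert (Ew : w1 ^ 2 + w2 ^ 2 = 4 * (A ^ 2 - eps) * N) by (unfold w1, w2, N; rewrite HA2; ring).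
  assert (ELA : LA = N / A + eps * N / A ^ 3).
  { unfold LA. rewrite Ew. fold N. field. lra. }
  assert (HA3 : 0 < A ^ 3) by (apply pow_lt; auto).
  assert (H1 : N / A <= LA).
  { rewrite ELA. assert (0 <= eps * N / A ^ 3) by (apply Rdiv_le_0_compat; auto; nra). lra. }
  (* Completing the square in the gradient of the exponent. The Cauchy-Riemann relation [Ew] makes
     the square absorb [N / A], up to a nonnegative remainder due to the smoothing [eps]. *)
  assert (H2 : A * (f1 ^ 2 + f2 ^ 2) + 2 * (/ (2 * A) * w1 * f1 + / (2 * A) * w2 * f2) + LA >= 0).
  { assert (Hs : A * (f1 ^ 2 + f2 ^ 2) + 2 * (/ (2 * A) * w1 * f1 + / (2 * A) * w2 * f2) + LA
      = A * ((f1 + w1 / (2 * A ^ 2)) ^ 2 + (f2 + w2 / (2 * A ^ 2)) ^ 2) + 2 * eps * N / A ^ 3).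
    { rewrite ELA.
      replace (N / A + eps * N / A ^ 3) with
        ((w1 ^ 2 + w2 ^ 2) / (4 * A ^ 3) + 2 * eps * N / A ^ 3) by (rewrite Ew; field; lra).
      field. lra. }
    rewrite Hs.
    assert (0 <= 2 * eps * N / A ^ 3) by (apply Rdiv_le_0_compat; auto; nra).
    assert (0 <= A * ((f1 + w1 / (2 * A ^ 2)) ^ 2 + (f2 + w2 / (2 * A ^ 2)) ^ 2)).
    { apply Rmult_le_pos; [lra|]. apply Rplus_le_le_0_compat; apply pow2_ge_0. }
    lra. }
  replace (LA * E + A * (E * (4 * H) + E * (f1 ^ 2 + f2 ^ 2))
     + 2 * (/ (2 * A) * w1 * (E * f1) + / (2 * A) * w2 * (E * f2)))
    with (4 * (A * H) * E + E * (A * (f1 ^ 2 + f2 ^ 2)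
          + 2 * (/ (2 * A) * w1 * f1 + / (2 * A) * w2 * f2) + LA)) by ring.
  set (T := A * (f1 ^ 2 + f2 ^ 2) + _ + LA) in *.
  assert (HT : 0 <= E * T) by (apply Rmult_le_pos; lra).
  (* This is where a nonnegative exponent matters: [1 <= E] lets the factor [E] be removed from the
     term carrying [H]. *)
  assert (HAH : 4 * (A * H) <= 4 * (A * H) * E).
  { assert (0 <= A * H) by (apply Rmult_le_pos; lra). nra. }
  (* The inequality of the two means in exact form: the term with [N] comes from [w / eta], the term
     with [H] from the exponential, and together they dominate the pairing for every [eta]. *)
  assert (Hfin : / eta * (N / A) + eta * (4 * (A * H)) - 4 * (p1 * q1 + p2 * q2)
     = / (eta * A) * ((p1 - 2 * eta * A * q1) ^ 2 + (p2 - 2 * eta * A * q2) ^ 2)).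
  { unfold N, H. field. split; lra. }
  assert (0 <= / (eta * A) * ((p1 - 2 * eta * A * q1) ^ 2 + (p2 - 2 * eta * A * q2) ^ 2)).
  { apply Rmult_le_pos; [left; apply Rinv_0_lt_compat, Rmult_lt_0_compat; auto|].
    apply Rplus_le_le_0_compat; apply pow2_ge_0. }
  assert (/ eta * (N / A) <= / eta * LA).
  { apply Rmult_le_compat_l; auto. left; apply Rinv_0_lt_compat; auto. }
  assert (eta * (4 * (A * H)) <= eta * (4 * (A * H) * E + E * T)).
  { apply Rmult_le_compat_l; lra. }
  lra.
Qed.

Lemma C2_ext4 (F Fs Ft L F' Fs' Ft' L' : R -> R -> R) :
  C2 F Fs Ft L -> (forall s t, F s t = F' s t) -> (forall s t, Fs s t = Fs' s t) ->
  (forall s t, Ft s t = Ft' s t) -> (forall s t, L s t = L' s t) -> C2 F' Fs' Ft' L'.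
Proof.
  intros H E1 E2 E3 E4.
  assert (ext : forall G G' : R -> R -> R, (forall s t, G s t = G' s t) -> G = G').
  { intros G G' E. apply functional_extensionality; intros s.
    apply functional_extensionality; intros t. apply E. }
  now rewrite <- (ext _ _ E1), <- (ext _ _ E2), <- (ext _ _ E3), <- (ext _ _ E4).
Qed.

Lemma C2_scal (a : R) (F Fs Ft L : R -> R -> R) :
  C2 F Fs Ft L ->
  C2 (fun s t => a * F s t) (fun s t => a * Fs s t) (fun s t => a * Ft s t) (fun s t => a * L s t).
Proof.
  intros H. eapply C2_ext4; [apply (C2_mult _ _ _ _ _ _ _ _ (C2_const a) H)|..];
    intros; simpl; ring.
Qed.

Lemma C2_Cmod2 (c : nat -> C) (n : nat) :
  C2 (fun s t => pRe c n s t ^ 2 + pIm c n s t ^ 2)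
     (fun s t => 2 * (pRe c n s t * pRe (dlog c) n s t + pIm c n s t * pIm (dlog c) n s t))
     (fun s t => 2 * (pIm c n s t * pRe (dlog c) n s t - pRe c n s t * pIm (dlog c) n s t))
     (fun s t => 4 * (pRe (dlog c) n s t ^ 2 + pIm (dlog c) n s t ^ 2)).
Proof.
  eapply C2_ext4; [apply (C2_plus _ _ _ _ _ _ _ _
     (C2_mult _ _ _ _ _ _ _ _ (C2_pRe c n) (C2_pRe c n))
     (C2_mult _ _ _ _ _ _ _ _ (C2_pIm c n) (C2_pIm c n)))|..]; intros; simpl; ring.
Qed.

Lemma pRe_pIm_Cmod (c : nat -> C) (n : nat) (s t : R) :
  pRe c n s t ^ 2 + pIm c n s t ^ 2 = Cmod (psum_upto c n (cis (exp s) t)) ^ 2.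
Proof. rewrite Cmod2_alt, psum_upto_polar. reflexivity. Qed.

Lemma sqrt_der2_cont (x : R) : 0 < x -> continuity_pt (fun y => - / (4 * sqrt y ^ 3)) x.
Proof.
  intros Hx. pose proof (sqrt_lt_R0 x Hx) as Hs. pose proof (pow_lt _ 3 Hs).
  apply continuity_pt_filterlim.
  apply (ex_derive_continuous (V := R_NormedModule) (fun y => - / (4 * sqrt y ^ 3))).
  auto_derive. repeat split; auto. simpl in *. lra.
Qed.

(** Adding [eps] under the root keeps the modulus twice differentiable at the zeros of [g]. *)
Definition smooth_mod (eps : R) (g : nat -> C) (n : nat) (s t : R) : R :=
  sqrt (pRe g n s t ^ 2 + pIm g n s t ^ 2 + eps).

Lemma smooth_mod_pos_arg (eps : R) (g : nat -> C) (n : nat) (s t : R) :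
  0 < eps -> 0 < pRe g n s t ^ 2 + pIm g n s t ^ 2 + eps.
Proof. intros He. pose proof (pow2_ge_0 (pRe g n s t)). pose proof (pow2_ge_0 (pIm g n s t)). lra. Qed.

(** The exponent of Uchiyama's trick, shifted by [M]. Here [Re v] is harmonic and will be the
    harmonic extension of [|h|^2], so the Laplacian is that of [|h|^2] while the values stay in
    [[0, M]]. *)
Definition expo (M : R) (h v : nat -> C) (n : nat) (s t : R) : R :=
  M + (pRe h n s t ^ 2 + pIm h n s t ^ 2) - pRe v n s t.

(** The first term pays for the derivative of [g]. The second pays for the derivative of [h],
    because the Laplacian of its exponent is [4 |h'|^2]. The last is the integrand [Re (g conj h)]
    of the pairing. *)
Definition Qfun (eta eps M : R) (g h v : nat -> C) (n : nat) (s t : R) : R :=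
  / eta * smooth_mod eps g n s t + eta * (smooth_mod eps g n s t * exp (expo M h v n s t))
  - (pRe g n s t * pRe h n s t + pIm g n s t * pIm h n s t).

Lemma Qfun_C2 (eta eps M : R) (g h v : nat -> C) (n : nat) :
  0 < eta -> 0 < eps ->
  exists Qs Qt L, C2 (Qfun eta eps M g h v n) Qs Qt L /\
    (forall s, Qt s (2 * PI) = Qt s 0) /\
    (forall s t, 0 <= expo M h v n s t -> 0 <= L s t).
Proof.
  intros Heta Heps.
  pose proof (C2_plus _ _ _ _ _ _ _ _ (C2_Cmod2 g n) (C2_const eps)) as Hw.
  eapply C2_comp with (eta := sqrt) (eta1 := fun x => / (2 * sqrt x))
    (eta2 := fun x => - / (4 * sqrt x ^ 3)) in Hw.
  2:{ intros s t. apply sqrt_der, smooth_mod_pos_arg; auto. }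
  2:{ intros s t. apply sqrt_der2, smooth_mod_pos_arg; auto. }
  2:{ intros s t. apply sqrt_der2_cont, smooth_mod_pos_arg; auto. }
  assert (He : C2 (expo M h v n)
     (fun s t => 2 * (pRe h n s t * pRe (dlog h) n s t + pIm h n s t * pIm (dlog h) n s t)
        - pRe (dlog v) n s t)
     (fun s t => 2 * (pIm h n s t * pRe (dlog h) n s t - pRe h n s t * pIm (dlog h) n s t)
        + pIm (dlog v) n s t)
     (fun s t => 4 * (pRe (dlog h) n s t ^ 2 + pIm (dlog h) n s t ^ 2))).
  { eapply C2_ext4; [apply (C2_plus _ _ _ _ _ _ _ _
      (C2_plus _ _ _ _ _ _ _ _ (C2_const M) (C2_Cmod2 h n))
      (C2_scal (-1) _ _ _ _ (C2_pRe v n)))|..]; intros; unfold expo; simpl; ring. }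
  pose proof (C2_comp exp exp exp _ _ _ _ He) as HE.
  specialize (HE ltac:(intros; auto_derive; auto; ring) ltac:(intros; auto_derive; auto; ring)).
  specialize (HE ltac:(intros; apply derivable_continuous_pt, derivable_pt_exp)).
  pose proof (C2_plus _ _ _ _ _ _ _ _
     (C2_plus _ _ _ _ _ _ _ _ (C2_scal (/ eta) _ _ _ _ Hw)
        (C2_scal eta _ _ _ _ (C2_mult _ _ _ _ _ _ _ _ Hw HE)))
     (C2_scal (-1) _ _ _ _ (C2_plus _ _ _ _ _ _ _ _
        (C2_mult _ _ _ _ _ _ _ _ (C2_pRe g n) (C2_pRe h n))
        (C2_mult _ _ _ _ _ _ _ _ (C2_pIm g n) (C2_pIm h n))))) as HQ.
  eexists _, _, _. split; [|split].
  - eapply C2_ext4; [exact HQ|..]; intros; try reflexivity.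
    unfold Qfun, smooth_mod. ring.
  - intros s. cbv beta. unfold expo.
    rewrite (proj1 (psum_upto_period g n s)), (proj2 (psum_upto_period g n s)),
      (proj1 (psum_upto_period h n s)), (proj2 (psum_upto_period h n s)), (proj1 (psum_upto_period v n s)),
      (proj1 (psum_upto_period (dlog g) n s)), (proj2 (psum_upto_period (dlog g) n s)),
      (proj1 (psum_upto_period (dlog h) n s)), (proj2 (psum_upto_period (dlog h) n s)),
      (proj2 (psum_upto_period (dlog v) n s)).
    reflexivity.
  - intros s t Hpos. cbv beta.
    pose proof (smooth_mod_pos_arg eps g n s t Heps) as Hp.
    eapply Rle_trans; [apply (laplacian_nonneg eta eps
      (sqrt (pRe g n s t ^ 2 + pIm g n s t ^ 2 + eps)) (exp (expo M h v n s t))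
      (pRe g n s t) (pIm g n s t) (pRe (dlog g) n s t) (pIm (dlog g) n s t)
      (pRe (dlog h) n s t) (pIm (dlog h) n s t)
      (2 * (pRe h n s t * pRe (dlog h) n s t + pIm h n s t * pIm (dlog h) n s t)
        - pRe (dlog v) n s t)
      (2 * (pIm h n s t * pRe (dlog h) n s t - pRe h n s t * pIm (dlog h) n s t)
        + pIm (dlog v) n s t)); auto; try lra|].
    + apply sqrt_lt_R0; auto.
    + apply pow2_sqrt. lra.
    + rewrite <- exp_0. destruct (Rle_lt_or_eq_dec _ _ Hpos) as [Hl|<-]; [|lra].
      left. now apply exp_increasing.
    + right. cbv zeta. ring.
Qed.

Lemma smooth_mod_bounds (eps : R) (g : nat -> C) (n : nat) (s t : R) :
  0 < eps ->
  Cmod (psum_upto g n (cis (exp s) t)) <= smooth_mod (eps ^ 2) g n s t <= Cmod (psum_upto g n (cis (exp s) t)) + eps.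
Proof.
  intros He. unfold smooth_mod. rewrite pRe_pIm_Cmod.
  pose proof (Cmod_ge_0 (psum_upto g n (cis (exp s) t))) as Hp. set (x := Cmod _) in *.
  split.
  - rewrite <- (sqrt_pow2 x) at 1; auto. apply sqrt_le_1_alt. nra.
  - rewrite <- (sqrt_pow2 (x + eps)) by lra. apply sqrt_le_1_alt. nra.
Qed.

Lemma cont2_smooth_mod (eps : R) (g : nat -> C) (n : nat) : 0 < eps -> cont2 (smooth_mod eps g n).
Proof.
  intros He. apply (cont2_comp sqrt (fun s t => pRe g n s t ^ 2 + pIm g n s t ^ 2 + eps)).
  - apply cont2_plus; [apply cont2_plus|apply cont2_const]; simpl;
      repeat apply cont2_mult; auto using cont2_pRe, cont2_pIm, cont2_const.
  - intros s t. apply continuity_pt_sqrt. left. apply smooth_mod_pos_arg; auto.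
Qed.

Lemma cont2_expo (M : R) (h v : nat -> C) (n : nat) : cont2 (expo M h v n).
Proof.
  intros s t. apply continuity_2d_pt_minus; [|apply cont2_pRe].
  apply (cont2_plus (fun _ _ => M)); [apply cont2_const|].
  apply cont2_plus; simpl; repeat apply cont2_mult; auto using cont2_pRe, cont2_pIm, cont2_const.
Qed.

Lemma Cmod_psum_upto_le (c : nat -> C) (n : nat) (z : C) :
  Cmod z <= 1 -> Cmod (psum_upto c n z) <= rsum (fun k => Cmod (c k)) n.
Proof.
  intros Hz. apply Cmod_csum. intros k _. rewrite Cmod_mult, Cmod_pow_n.
  rewrite <- (Rmult_1_r (Cmod (c k))) at 2. apply Rmult_le_compat_l; [apply Cmod_ge_0|].
  rewrite <- (pow1 k). apply pow_incr. split; auto. apply Cmod_ge_0.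
Qed.

Lemma expo_psum_upto (M : R) (h v : nat -> C) (n : nat) (s t : R) :
  expo M h v n s t = M + Cmod (psum_upto h n (cis (exp s) t)) ^ 2 - Re (psum_upto v n (cis (exp s) t)).
Proof. unfold expo. now rewrite pRe_pIm_Cmod, !psum_upto_polar. Qed.

Definition circ_pair (g h : nat -> C) (n : nat) (r : R) : C :=
  csum (fun k => (g k * Cconj (h k) * RtoC ((r ^ 2) ^ k))%C) n.

Lemma mean_pair (g h : nat -> C) (n : nat) (s : R) :
  mean (fun t => pRe g n s t * pRe h n s t + pIm g n s t * pIm h n s t)
  = Re (circ_pair g h n (exp s)).
Proof.
  unfold circ_pair. rewrite <- cmean_psum_upto_conj_psum_upto, cmean_Re. apply mean_ext. intros t.
  rewrite !psum_upto_polar. unfold Cmult, Cconj, Re; simpl. ring.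
Qed.

(* The growth of the circle means of [g] and [h] controls their pairing: this is Green's
   formula for [Qfun], with Uchiyama's exponential weight making up for the missing
   Carleson embedding. *)
Lemma pairing_increment_poly (g h v : nat -> C) (n : nat) (M eta R0 s r : R) :
  0 < eta -> 0 < s <= r -> r < R0 <= 1 ->
  (forall z, Cmod z < R0 -> 0 <= M + Cmod (psum_upto h n z) ^ 2 - Re (psum_upto v n z) <= M) ->
  Re (circ_pair g h n r) - Re (circ_pair g h n s)
  <= / eta * (mean (fun t => Cmod (psum_upto g n (cis r t))) - mean (fun t => Cmod (psum_upto g n (cis s t))))
     + eta * exp M * mean (fun t => Cmod (psum_upto g n (cis r t))).
Proof.
  intros Heta Hs Hr HM.
  set (K := / eta + eta * exp M).
  assert (HK : 0 < K).
  { unfold K. pose proof (exp_pos M). pose proof (Rinv_0_lt_compat eta Heta).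
    assert (0 < eta * exp M) by (apply Rmult_lt_0_compat; auto). lra. }
  apply le_epsilon. intros e0 He0.
  (* The smoothing error [e] enters at the outer radius with the two weights [/ eta] and
     [eta * exp M], whose sum is [K]. *)
  set (e := e0 / K). assert (He : 0 < e) by (apply Rdiv_lt_0_compat; auto).
  assert (He2 : 0 < e ^ 2) by (apply pow_lt; auto).
  destruct (Qfun_C2 eta (e ^ 2) M g h v n Heta He2) as (Qs & Qt & L & HQ & Hper & HL).
  assert (Hin : forall x t, x < ln R0 -> Cmod (cis (exp x) t) < R0).
  { intros x t Hx. rewrite Cmod_cis, Rabs_pos_eq by (left; apply exp_pos).
    rewrite <- (exp_ln R0) by lra. now apply exp_increasing. }
  set (G := rsum (fun k => Cmod (g k)) n). set (H := rsum (fun k => Cmod (h k)) n).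
  assert (HG : 0 <= G) by (apply rsum_nonneg; intros; apply Cmod_ge_0).
  assert (HH : 0 <= H) by (apply rsum_nonneg; intros; apply Cmod_ge_0).
  assert (Hpair : forall x t, Rabs (pRe g n x t * pRe h n x t + pIm g n x t * pIm h n x t)
     <= Cmod (psum_upto g n (cis (exp x) t)) * Cmod (psum_upto h n (cis (exp x) t))).
  { intros x t.
    replace (pRe g n x t * pRe h n x t + pIm g n x t * pIm h n x t)
      with (Re (psum_upto g n (cis (exp x) t) * Cconj (psum_upto h n (cis (exp x) t)))%C)
      by (rewrite !psum_upto_polar; unfold Cmult, Cconj, Re; simpl; ring).
    eapply Rle_trans; [apply re_le_Cmod|]. rewrite Cmod_mult, Cmod_conj. lra. }
  (* The upper bound needed near minus infinity may be crude: in the unit disk the two polynomials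
     are at most the sums [G] and [H] of their coefficient moduli. *)
  assert (HQm := mean_subharmonic _ _ _ _ (ln R0)
     (/ eta * (G + e) + eta * ((G + e) * exp M) + G * H) HQ Hper).
  assert (Hexp : forall x t, x < ln R0 -> 0 <= expo M h v n x t <= M).
  { intros x t Hx. rewrite expo_psum_upto. apply HM; auto. }
  assert (HEM : forall x t, x < ln R0 -> exp (expo M h v n x t) <= exp M).
  { intros x t Hx. destruct (Hexp x t Hx) as [_ [Hl|Hl]].
    - left. now apply exp_increasing.
    - rewrite Hl. lra. }
  assert (Hie : 0 < / eta) by (apply Rinv_0_lt_compat; auto).
  specialize (HQm ltac:(intros x t Hx; apply HL, Hexp; auto)).
  specialize (HQm ltac:(
    intros x t Hx; unfold Qfun;
    assert (Hz : Cmod (cis (exp x) t) <= 1) by (pose proof (Hin x t Hx); lra);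
    pose proof (Cmod_psum_upto_le g n _ Hz) as HG1; pose proof (Cmod_psum_upto_le h n _ Hz) as HH1;
    fold G in HG1; fold H in HH1;
    destruct (smooth_mod_bounds e g n x t He) as [Hw1 Hw2];
    pose proof (Cmod_ge_0 (psum_upto g n (cis (exp x) t))); pose proof (Cmod_ge_0 (psum_upto h n (cis (exp x) t)));
    pose proof (exp_pos (expo M h v n x t));
    pose proof (HEM x t Hx);
    assert (Ha : smooth_mod (e ^ 2) g n x t * exp (expo M h v n x t) <= (G + e) * exp M)
      by (apply Rmult_le_compat; lra);
    assert (Hb : Cmod (psum_upto g n (cis (exp x) t)) * Cmod (psum_upto h n (cis (exp x) t)) <= G * H)
      by (apply Rmult_le_compat; lra);
    pose proof (Hpair x t) as Hc; apply Rabs_le_between in Hc;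
    assert (/ eta * smooth_mod (e ^ 2) g n x t <= / eta * (G + e)) by (apply Rmult_le_compat_l; lra);
    assert (eta * (smooth_mod (e ^ 2) g n x t * exp (expo M h v n x t)) <= eta * ((G + e) * exp M))
      by (apply Rmult_le_compat_l; lra);
    lra)).
  assert (Hln : ln r < ln R0) by (apply ln_increasing; lra).
  assert (Hls : ln s <= ln r) by (destruct (proj2 Hs) as [Hl|<-]; [left; apply ln_increasing; lra | lra]).
  specialize (HQm (ln s) (ln r) Hls Hln).
  assert (Cw : forall x, cont (smooth_mod (e ^ 2) g n x)) by (intros x; apply cont2_slice, cont2_smooth_mod; auto).
  assert (CE : forall x, cont (fun t => exp (expo M h v n x t))).
  { intros x. apply (cont_comp (expo M h v n x) exp).
    - apply cont2_slice, cont2_expo.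
    - intros t. apply continuity_pt_filterlim, derivable_continuous_pt, derivable_pt_exp. }
  assert (Cp : forall x, cont (fun t => pRe g n x t * pRe h n x t + pIm g n x t * pIm h n x t)).
  { intros x. apply cont_plus; apply cont_mult; apply (cont2_slice _ x);
      auto using cont2_pRe, cont2_pIm. }
  assert (EQ : forall x, mean (Qfun eta (e ^ 2) M g h v n x) =
     / eta * mean (smooth_mod (e ^ 2) g n x) + eta * mean (fun t => smooth_mod (e ^ 2) g n x t * exp (expo M h v n x t))
     - Re (circ_pair g h n (exp x))).
  { intros x. unfold Qfun.
    rewrite (mean_minus (fun t => / eta * smooth_mod (e ^ 2) g n x t + eta * (smooth_mod (e ^ 2) g n x t * exp (expo M h v n x t)))).
    - rewrite (mean_plus (fun t => / eta * smooth_mod (e ^ 2) g n x t)).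
      + rewrite (mean_scal (/ eta) (smooth_mod (e ^ 2) g n x)) by auto.
        rewrite (mean_scal eta (fun t => smooth_mod (e ^ 2) g n x t * exp (expo M h v n x t)))
          by (apply cont_mult; auto).
        rewrite mean_pair. reflexivity.
      + apply cont_mult; auto using cont_const.
      + apply cont_mult; auto using cont_const. apply cont_mult; auto.
    - apply cont_plus; apply cont_mult; auto using cont_const. apply cont_mult; auto.
    - apply Cp. }
  rewrite !EQ, !exp_ln in HQm by lra.
  assert (CP : forall x, cont (fun t => Cmod (psum_upto g n (cis x t)))) by (intros; apply cont_Cmod, ccont_psum_upto).
  assert (Hs1 : mean (fun t => Cmod (psum_upto g n (cis s t))) <= mean (smooth_mod (e ^ 2) g n (ln s))).
  { apply mean_le; auto. intros t. replace s with (exp (ln s)) at 1 by (apply exp_ln; lra).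
    apply smooth_mod_bounds; auto. }
  assert (Hr1 : mean (smooth_mod (e ^ 2) g n (ln r)) <= mean (fun t => Cmod (psum_upto g n (cis r t))) + e).
  { rewrite <- (mean_const e) at 2. rewrite <- mean_plus by auto using cont_const.
    apply mean_le; auto using cont_plus, cont_const. intros t.
    replace r with (exp (ln r)) at 2 by (apply exp_ln; lra). apply smooth_mod_bounds; auto. }
  (* At radius [s] the exponential term is dropped, being nonnegative; at radius [r] its exponent is
     at most [M]. *)
  assert (Hs2 : 0 <= mean (fun t => smooth_mod (e ^ 2) g n (ln s) t * exp (expo M h v n (ln s) t))).
  { apply mean_nonneg; [apply cont_mult; auto|]. intros t. apply Rmult_le_pos.
    - apply sqrt_pos.
    - left; apply exp_pos. }
  assert (Hr2 : mean (fun t => smooth_mod (e ^ 2) g n (ln r) t * exp (expo M h v n (ln r) t))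
     <= exp M * mean (smooth_mod (e ^ 2) g n (ln r))).
  { rewrite <- mean_scal by auto. apply mean_le; [apply cont_mult; auto | apply cont_mult; auto using cont_const |].
    intros t. rewrite Rmult_comm. apply Rmult_le_compat_r; [apply sqrt_pos | apply HEM; auto]. }
  set (a := mean (smooth_mod (e ^ 2) g n (ln s))) in *. set (b := mean (smooth_mod (e ^ 2) g n (ln r))) in *.
  set (c := mean (fun t => Cmod (psum_upto g n (cis r t)))) in *.
  set (d := mean (fun t => Cmod (psum_upto g n (cis s t)))) in *.
  assert (eta * mean (fun t => smooth_mod (e ^ 2) g n (ln r) t * exp (expo M h v n (ln r) t)) <= eta * (exp M * b))
    by (apply Rmult_le_compat_l; lra).
  assert (0 <= eta * mean (fun t => smooth_mod (e ^ 2) g n (ln s) t * exp (expo M h v n (ln s) t)))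
    by (apply Rmult_le_pos; lra).
  assert (/ eta * b <= / eta * (c + e)) by (apply Rmult_le_compat_l; lra).
  assert (/ eta * d <= / eta * a) by (apply Rmult_le_compat_l; lra).
  assert (eta * (exp M * b) <= eta * (exp M * (c + e))).
  { apply Rmult_le_compat_l; [lra|]. apply Rmult_le_compat_l; [left; apply exp_pos | lra]. }
  assert (E : e0 = K * e) by (unfold e; field; lra). unfold K in E. clearbody e.
  lra.
Qed.

(** * Square summable sequences *)

Lemma Cauchy_Schwarz (a b : nat -> R) (n : nat) :
  rsum (fun k => a k * b k) n ^ 2 <= rsum (fun k => a k ^ 2) n * rsum (fun k => b k ^ 2) n.
Proof.
  induction n as [|n IH]; [simpl; lra|].
  cbn [rsum]. set (S := rsum (fun k => a k * b k) n) in *.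
  set (A := rsum (fun k => a k ^ 2) n) in *. set (B := rsum (fun k => b k ^ 2) n) in *.
  assert (HA : 0 <= A) by (apply rsum_nonneg; intros; apply pow2_ge_0).
  assert (HB : 0 <= B) by (apply rsum_nonneg; intros; apply pow2_ge_0).
  set (x := a n). set (y := b n).
  assert (H : 2 * S * (x * y) <= A * y ^ 2 + B * x ^ 2).
  { apply Rabs_le_between.
    assert (H0 : 0 <= A * y ^ 2 + B * x ^ 2)
      by (apply Rplus_le_le_0_compat; apply Rmult_le_pos; auto; apply pow2_ge_0).
    rewrite <- (Rabs_pos_eq (A * y ^ 2 + B * x ^ 2)) by auto.
    apply Rsqr_le_abs_0. unfold Rsqr.
    assert (Hs : 4 * (S ^ 2 * (x * y) ^ 2) <= 4 * ((A * B) * (x * y) ^ 2)).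
    { apply Rmult_le_compat_l; [lra|]. apply Rmult_le_compat_r; auto. apply pow2_ge_0. }
    assert (0 <= (A * y ^ 2 - B * x ^ 2) ^ 2) by apply pow2_ge_0.
    lra. }
  lra.
Qed.

(** A norm bound in l^2 through partial sums, so that no convergence has to be proved before stating
    it; [l2norm] is the least such bound. *)
Definition l2_le (x : nat -> C) (M : R) : Prop :=
  0 <= M /\ forall n, rsum (fun k => Cmod (x k) ^ 2) n <= M ^ 2.

Definition l2norm (x : nat -> C) : R := sqrt (Series (fun k => Cmod (x k) ^ 2)).

(** Minkowski's inequality, with the cross term bounded by Cauchy-Schwarz. *)
Lemma l2_le_plus (x y : nat -> C) (M N : R) :
  l2_le x M -> l2_le y N -> l2_le (cadd x y) (M + N).
Proof.
  intros [HM Hx] [HN Hy]. split; [lra|]. intros n.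
  set (X := rsum (fun k => Cmod (x k) ^ 2) n). set (Y := rsum (fun k => Cmod (y k) ^ 2) n).
  set (S := rsum (fun k => Cmod (x k) * Cmod (y k)) n).
  assert (HS : S <= M * N).
  { apply Rsqr_incr_0_var; [|apply Rmult_le_pos; auto]. unfold Rsqr.
    replace (S * S) with (S ^ 2) by ring.
    eapply Rle_trans; [apply Cauchy_Schwarz|].
    replace (M * N * (M * N)) with (M ^ 2 * N ^ 2) by ring.
    apply Rmult_le_compat; auto; apply rsum_nonneg; intros; apply pow2_ge_0. }
  assert (H : rsum (fun k => Cmod (cadd x y k) ^ 2) n <= X + 2 * S + Y).
  { unfold X, S, Y. rewrite <- rsum_scal, <- !rsum_plus. apply rsum_le. intros k _.
    unfold cadd. pose proof (Cmod_triangle (x k) (y k)). pose proof (Cmod_ge_0 (x k + y k)%C).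
    replace (Cmod (x k) ^ 2 + 2 * (Cmod (x k) * Cmod (y k)) + Cmod (y k) ^ 2)
      with ((Cmod (x k) + Cmod (y k)) ^ 2) by ring.
    apply pow_incr. lra. }
  specialize (Hx n). specialize (Hy n). fold X in Hx. fold Y in Hy. nra.
Qed.

Lemma l2_le_scal (l : C) (x : nat -> C) (M : R) : l2_le x M -> l2_le (cscal l x) (Cmod l * M).
Proof.
  intros [HM Hx]. split; [apply Rmult_le_pos; auto; apply Cmod_ge_0|]. intros n.
  rewrite (rsum_ext _ (fun k => Cmod l ^ 2 * Cmod (x k) ^ 2)).
  - rewrite rsum_scal, Rpow_mult_distr. apply Rmult_le_compat_l; auto. apply pow2_ge_0.
  - intros k _. unfold cscal. rewrite Cmod_mult. ring.
Qed.

Lemma l2_le_ext (x y : nat -> C) (M : R) : (forall k, x k = y k) -> l2_le x M -> l2_le y M.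
Proof.
  intros E [HM Hx]. split; auto. intros n. rewrite (rsum_ext _ (fun k => Cmod (x k) ^ 2)); auto.
  intros k _. now rewrite E.
Qed.

Lemma l2_le_weaken (x : nat -> C) (M N : R) : l2_le x M -> M <= N -> l2_le x N.
Proof.
  intros [HM Hx] H. split; [lra|]. intros n. eapply Rle_trans; [apply Hx|]. apply pow_incr. lra.
Qed.

Lemma l2_le_ex_series (x : nat -> C) (M : R) : l2_le x M -> ex_series (fun k => Cmod (x k) ^ 2).
Proof.
  intros [_ H]. apply ex_series_bounded with (M ^ 2); auto. intros; apply pow2_ge_0.
Qed.

Lemma l2norm_le (x : nat -> C) (M : R) : l2_le x M -> l2norm x <= M.
Proof.
  intros H. unfold l2norm. rewrite <- (sqrt_pow2 M) by apply H. apply sqrt_le_1_alt.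
  apply Series_le_bound; [apply (l2_le_ex_series x M H) | apply H].
Qed.

Lemma l2norm_nonneg (x : nat -> C) : 0 <= l2norm x.
Proof. apply sqrt_pos. Qed.

Lemma l2_le_l2norm (x : nat -> C) : ex_series (fun k => Cmod (x k) ^ 2) -> l2_le x (l2norm x).
Proof.
  intros H. split; [apply l2norm_nonneg|]. intros n. unfold l2norm.
  assert (Hp : forall k, 0 <= Cmod (x k) ^ 2) by (intros; apply pow2_ge_0).
  rewrite pow2_sqrt.
  - apply rsum_le_Series; auto.
  - eapply Rle_trans; [|apply (rsum_le_Series _ 0%nat Hp H)]. simpl; lra.
Qed.

Lemma l2_le_coef (x : nat -> C) (M : R) (k : nat) : l2_le x M -> Cmod (x k) <= M.
Proof.
  intros [HM H]. apply Rsqr_incr_0_var; auto. unfold Rsqr.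
  specialize (H (S k)). cbn [rsum] in H.
  assert (0 <= rsum (fun k => Cmod (x k) ^ 2) k) by (apply rsum_nonneg; intros; apply pow2_ge_0).
  lra.
Qed.

Definition trunc (n : nat) (c : nat -> C) (k : nat) : C := if lt_dec k n then c k else RtoC 0.

Lemma l2_le_tail (x : nat -> C) (M eps : R) :
  l2_le x M -> 0 < eps -> exists N, forall n, (N <= n)%nat -> l2_le (csub x (trunc n x)) eps.
Proof.
  intros Hx He. pose proof (l2_le_ex_series x M Hx) as Hs.
  destruct (tail_lim _ (eps ^ 2) Hs (pow_lt eps 2 He)) as [N HN].
  exists N. intros n Hn. split; [lra|]. intros m.
  specialize (HN n Hn). apply Rabs_lt_between in HN. unfold tail in HN.
  assert (Hp : forall k, 0 <= Cmod (x k) ^ 2) by (intros; apply pow2_ge_0).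
  pose proof (rsum_le_Series _ (n + m)%nat Hp Hs) as H1. rewrite rsum_split in H1.
  assert (H2 : rsum (fun k => Cmod (csub x (trunc n x) k) ^ 2) (n + m)
     = rsum (fun k => Cmod (x (n + k)%nat) ^ 2) m).
  { rewrite rsum_split.
    rewrite (rsum_ext _ (fun _ => 0)).
    - rewrite rsum_const, Rmult_0_r, Rplus_0_l. apply rsum_ext. intros k _. unfold csub, trunc.
      destruct (lt_dec (n + k) n); [lia|]. f_equal. f_equal. ring.
    - intros k Hk. unfold csub, trunc. destruct (lt_dec k n); [|lia].
      replace (x k - x k)%C with (RtoC 0) by ring. rewrite Cmod_0. ring. }
  pose proof (rsum_incr (fun k => Cmod (csub x (trunc n x) k) ^ 2) m (n + m)%nat
    (fun k => pow2_ge_0 _) ltac:(lia)). lra.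
Qed.

(** * Sequences with bounded coefficients *)

Definition bdd (c : nat -> C) (B : R) : Prop := forall k, Cmod (c k) <= B.

Lemma bdd_nonneg (c : nat -> C) (B : R) : bdd c B -> 0 <= B.
Proof. intros H. eapply Rle_trans; [apply Cmod_ge_0 | apply (H 0%nat)]. Qed.

Lemma bdd_majorized (c : nat -> C) (B : R) (z : C) :
  bdd c B -> Cmod z < 1 -> majorized c z (fun k => B * Cmod z ^ k).
Proof.
  intros H Hz. split.
  - apply (ex_series_scal_l B (fun k => Cmod z ^ k)). apply ex_series_geom.
    rewrite Rabs_pos_eq; auto. apply Cmod_ge_0.
  - intros k. apply Rmult_le_compat_r; [apply pow_le, Cmod_ge_0 | apply H].
Qed.

Lemma bdd_ex (c : nat -> C) (B : R) (z : C) :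
  bdd c B -> Cmod z < 1 -> ex_series (fun k => (c k * pow_n z k)%C).
Proof. intros H Hz. eapply ex_series_majorized, bdd_majorized; eauto. Qed.

Lemma bdd_psum_le (c : nat -> C) (B : R) (z : C) :
  bdd c B -> Cmod z < 1 -> Cmod (psum c z) <= B / (1 - Cmod z).
Proof.
  intros H Hz. apply le_epsilon. intros eps He.
  destruct (psum_lim c z (bdd_ex c B z H Hz) eps He) as [N HN]. specialize (HN N ltac:(lia)).
  replace (psum c z) with (psum_upto c N z - (psum_upto c N z - psum c z))%C by ring.
  eapply Rle_trans; [apply Cmod_triangle|]. rewrite Cmod_opp.
  assert (Cmod (psum_upto c N z) <= B / (1 - Cmod z)); [|lra].
  eapply Rle_trans; [apply (Cmod_csum _ (fun k => B * Cmod z ^ k))|].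
  - intros k _. rewrite Cmod_mult, Cmod_pow_n.
    apply Rmult_le_compat_r; [apply pow_le, Cmod_ge_0 | apply H].
  - rewrite rsum_scal. apply Rmult_le_compat_l; [apply (bdd_nonneg c); auto|].
    apply rsum_geom_le. split; auto. apply Cmod_ge_0.
Qed.

Lemma psum_plus (c d : nat -> C) (z : C) :
  ex_series (fun k => (c k * pow_n z k)%C) -> ex_series (fun k => (d k * pow_n z k)%C) ->
  psum (cadd c d) z = (psum c z + psum d z)%C.
Proof.
  intros Hc Hd. apply psum_unique. intros eps He.
  destruct (psum_lim c z Hc (eps / 2) ltac:(lra)) as [N1 H1].
  destruct (psum_lim d z Hd (eps / 2) ltac:(lra)) as [N2 H2].
  exists (Nat.max N1 N2). intros n Hn.
  specialize (H1 n ltac:(lia)). specialize (H2 n ltac:(lia)).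
  replace (psum_upto (cadd c d) n z - (psum c z + psum d z))%C
    with ((psum_upto c n z - psum c z) + (psum_upto d n z - psum d z))%C.
  - eapply Rle_lt_trans; [apply Cmod_triangle | lra].
  - unfold psum_upto, cadd. rewrite (csum_ext (fun k => ((c k + d k) * pow_n z k)%C)
      (fun k => (c k * pow_n z k + d k * pow_n z k)%C)) by (intros; ring).
    rewrite csum_plus. ring.
Qed.

Lemma psum_scal (l : C) (c : nat -> C) (z : C) :
  ex_series (fun k => (c k * pow_n z k)%C) -> psum (cscal l c) z = (l * psum c z)%C.
Proof.
  intros Hc. apply psum_unique. intros eps He.
  pose proof (Cmod_ge_0 l).
  destruct (psum_lim c z Hc (eps / (Cmod l + 1)) ltac:(apply Rdiv_lt_0_compat; lra)) as [N HN].
  exists N. intros n Hn. specialize (HN n Hn).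
  replace (psum_upto (cscal l c) n z - l * psum c z)%C with (l * (psum_upto c n z - psum c z))%C.
  - rewrite Cmod_mult. pose proof (Cmod_ge_0 (psum_upto c n z - psum c z)%C).
    assert (Hm : (Cmod l + 1) * Cmod (psum_upto c n z - psum c z) < eps).
    { replace eps with ((Cmod l + 1) * (eps / (Cmod l + 1))) by (field; lra).
      apply Rmult_lt_compat_l; lra. }
    lra.
  - unfold psum_upto, cscal. rewrite (csum_ext (fun k => (l * c k * pow_n z k)%C)
      (fun k => (l * (c k * pow_n z k))%C)) by (intros; ring).
    rewrite csum_scal. ring.
Qed.

Definition shift (m : nat) (c : nat -> C) (k : nat) : C := c (m + k)%nat.

Lemma bdd_shift (c : nat -> C) (B : R) (m : nat) : bdd c B -> bdd (shift m c) B.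
Proof. intros H k. apply H. Qed.

Lemma psum_0 (c : nat -> C) : psum c (RtoC 0) = c 0%nat.
Proof.
  apply psum_unique. intros eps He. exists 1%nat. intros n Hn. destruct n as [|n]; [lia|].
  unfold psum_upto. rewrite csum_shift, csum_zero.
  - rewrite pow_n_0. replace (c 0%nat * 1 + 0 - c 0%nat)%C with (RtoC 0) by ring.
    now rewrite Cmod_0.
  - intros k _. rewrite pow_n_S. ring.
Qed.

(** Horner's recursion. All the telescoping identities for the Garsia function come from it. *)
Lemma psum_shift (c : nat -> C) (B : R) (z : C) (m : nat) :
  bdd c B -> Cmod z < 1 -> psum (shift m c) z = (c m + z * psum (shift (S m) c) z)%C.
Proof.
  intros H Hz. apply psum_unique. intros eps He.
  destruct (psum_lim (shift (S m) c) z (bdd_ex _ B z (bdd_shift c B (S m) H) Hz) eps He) as [N HN].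
  exists (S N). intros n Hn. destruct n as [|n]; [lia|]. specialize (HN n ltac:(lia)).
  replace (psum_upto (shift m c) (S n) z - (c m + z * psum (shift (S m) c) z))%C
    with (z * (psum_upto (shift (S m) c) n z - psum (shift (S m) c) z))%C.
  - rewrite Cmod_mult. pose proof (Cmod_ge_0 z).
    pose proof (Cmod_ge_0 (psum_upto (shift (S m) c) n z - psum (shift (S m) c) z)%C). nra.
  - unfold psum_upto. rewrite csum_shift.
    rewrite (csum_ext (fun k => (shift m c (S k) * pow_n z (S k))%C)
      (fun k => (z * (shift (S m) c k * pow_n z k))%C)).
    + rewrite csum_scal, pow_n_0. unfold shift at 3. rewrite Nat.add_0_r. ring.
    + intros k _. rewrite pow_n_S. unfold shift. replace (m + S k)%nat with (S m + k)%nat by lia. ring.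
Qed.

(** * The Garsia seminorm at a point *)

(* [garsia_coef h z] lists, up to the weight [sqrt (1 - |z|^2)], the Taylor coefficients of
   [w -> (h w - h z) / (w - z)]; its square norm is the Garsia function of [h] at [z]. *)
Definition garsia_coef (h : nat -> C) (z : C) (m : nat) : C :=
  (RtoC (sqrt (1 - Cmod z ^ 2)) * psum (shift (S m) h) z)%C.

Definition garsia (h : nat -> C) (z : C) : R := l2norm (garsia_coef h z).

Lemma garsia_coef_plus (h k : nat -> C) (B D : R) (z : C) (m : nat) :
  bdd h B -> bdd k D -> Cmod z < 1 -> garsia_coef (cadd h k) z m = cadd (garsia_coef h z) (garsia_coef k z) m.
Proof.
  intros Hh Hk Hz. unfold garsia_coef, cadd at 2.
  change (shift (S m) (cadd h k)) with (cadd (shift (S m) h) (shift (S m) k)).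
  rewrite psum_plus; [ring|..]; eapply bdd_ex; eauto using bdd_shift.
Qed.

Lemma garsia_coef_scal (l : C) (h : nat -> C) (B : R) (z : C) (m : nat) :
  bdd h B -> Cmod z < 1 -> garsia_coef (cscal l h) z m = cscal l (garsia_coef h z) m.
Proof.
  intros Hh Hz. unfold garsia_coef, cscal at 2.
  change (shift (S m) (cscal l h)) with (cscal l (shift (S m) h)).
  rewrite psum_scal; [ring|]. eapply bdd_ex; eauto using bdd_shift.
Qed.

Definition garsia_le (h : nat -> C) (z : C) (M : R) : Prop := l2_le (garsia_coef h z) M.

Lemma garsia_le_plus (h k : nat -> C) (B D M N : R) (z : C) :
  bdd h B -> bdd k D -> Cmod z < 1 -> garsia_le h z M -> garsia_le k z N -> garsia_le (cadd h k) z (M + N).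
Proof.
  intros Hh Hk Hz H1 H2. apply (l2_le_ext (cadd (garsia_coef h z) (garsia_coef k z))); [|apply l2_le_plus; auto].
  intros m. symmetry. eapply garsia_coef_plus; eauto.
Qed.

Lemma garsia_le_scal (l : C) (h : nat -> C) (B M : R) (z : C) :
  bdd h B -> Cmod z < 1 -> garsia_le h z M -> garsia_le (cscal l h) z (Cmod l * M).
Proof.
  intros Hh Hz H1. apply (l2_le_ext (cscal l (garsia_coef h z))); [|apply l2_le_scal; auto].
  intros m. symmetry. eapply garsia_coef_scal; eauto.
Qed.

Lemma csub_cadd (f g : nat -> C) : csub f g = cadd f (cscal (RtoC (-1)) g).
Proof. apply functional_extensionality. intros k. unfold csub, cadd, cscal. ring. Qed.

Lemma Cmod_m1' : Cmod (RtoC (-1)) = 1.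
Proof. rewrite Cmod_R. rewrite Rabs_left; lra. Qed.

Lemma bdd_scal (l : C) (c : nat -> C) (B : R) : bdd c B -> bdd (cscal l c) (Cmod l * B).
Proof.
  intros H k. unfold cscal. rewrite Cmod_mult. apply Rmult_le_compat_l; [apply Cmod_ge_0|auto].
Qed.

Lemma bdd_plus (c d : nat -> C) (B D : R) : bdd c B -> bdd d D -> bdd (cadd c d) (B + D).
Proof.
  intros H1 H2 k. unfold cadd. eapply Rle_trans; [apply Cmod_triangle|].
  apply Rplus_le_compat; auto.
Qed.

Lemma bdd_sub (c d : nat -> C) (B D : R) : bdd c B -> bdd d D -> bdd (csub c d) (B + D).
Proof.
  intros H1 H2. rewrite csub_cadd. replace D with (Cmod (RtoC (-1)) * D) by (rewrite Cmod_m1'; ring).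
  apply bdd_plus; auto. apply bdd_scal; auto.
Qed.

Lemma garsia_le_sub (h k : nat -> C) (B D M N : R) (z : C) :
  bdd h B -> bdd k D -> Cmod z < 1 -> garsia_le h z M -> garsia_le k z N -> garsia_le (csub h k) z (M + N).
Proof.
  intros Hh Hk Hz H1 H2. rewrite csub_cadd.
  replace N with (Cmod (RtoC (-1)) * N) by (rewrite Cmod_m1'; ring).
  eapply garsia_le_plus; eauto using bdd_scal, garsia_le_scal.
Qed.

Lemma l2_le_bdd (h : nat -> C) (M : R) : l2_le h M -> bdd h M.
Proof. intros H k. now apply l2_le_coef. Qed.

(** A crude comparison constant between the Garsia seminorm at a point of modulus [r] and the l^2
    norm. Its blow-up at the boundary is harmless: it is used at a fixed point or on a smaller
    disk. *)
Definition garsia_const (r : R) : R := 2 / (1 - r) ^ 2.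

Lemma garsia_const_mono (r s : R) : r <= s < 1 -> 0 < garsia_const r <= garsia_const s.
Proof.
  intros H. unfold garsia_const, Rdiv.
  assert (0 < (1 - s) ^ 2) by (apply pow_lt; lra).
  assert ((1 - s) ^ 2 <= (1 - r) ^ 2) by (apply pow_incr; lra).
  split.
  - apply Rmult_lt_0_compat; [lra|]. apply Rinv_0_lt_compat. lra.
  - apply Rmult_le_compat_l; [lra|]. apply Rinv_le_contravar; lra.
Qed.

(* With [b m = psum (shift m h) z] one has [b m = h m + z * b (m + 1)], so convexity gives
   [|b m|^2 <= |h m|^2 / (1 - |z|) + |z| |b (m + 1)|^2], which telescopes. *)
Lemma garsia_le_l2_le (h : nat -> C) (M : R) (z : C) :
  l2_le h M -> Cmod z < 1 -> garsia_le h z (garsia_const (Cmod z) * M).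
Proof.
  intros Hh Hz. pose proof (Cmod_ge_0 z) as Hz0. set (r := Cmod z) in *.
  pose proof (l2_le_bdd h M Hh) as Hb. pose proof (proj1 Hh) as HM.
  set (b := fun m => Cmod (psum (shift m h) z)).
  assert (Hb0 : forall m, 0 <= b m) by (intros; apply Cmod_ge_0).
  assert (Hb1 : forall m, b m <= M / (1 - r)).
  { intros m. apply bdd_psum_le; auto. now apply bdd_shift. }
  assert (Hstep : forall m, b m ^ 2 <= Cmod (h m) ^ 2 / (1 - r) + r * b (S m) ^ 2).
  { intros m. assert (Hle : b m <= Cmod (h m) + r * b (S m)).
    { unfold b. rewrite (psum_shift h M z m Hb Hz).
      eapply Rle_trans; [apply Cmod_triangle|]. rewrite Cmod_mult. fold r. lra. }
    pose proof (Cmod_ge_0 (h m)).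
    apply Rle_trans with ((Cmod (h m) + r * b (S m)) ^ 2); [apply pow_incr; auto|].
    assert (E : Cmod (h m) ^ 2 / (1 - r) + r * b (S m) ^ 2 - (Cmod (h m) + r * b (S m)) ^ 2
       = r / (1 - r) * (Cmod (h m) - (1 - r) * b (S m)) ^ 2) by (field; lra).
    assert (0 <= r / (1 - r) * (Cmod (h m) - (1 - r) * b (S m)) ^ 2).
    { apply Rmult_le_pos; [apply Rdiv_le_0_compat; lra | apply pow2_ge_0]. }
    lra. }
  assert (Hsum : forall n, (1 - r) * rsum (fun m => b m ^ 2) n <= M ^ 2 / (1 - r) + r * (M / (1 - r)) ^ 2).
  { intros n.
    assert (H1 : rsum (fun m => b m ^ 2) n <= / (1 - r) * rsum (fun m => Cmod (h m) ^ 2) n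
        + r * rsum (fun m => b (S m) ^ 2) n).
    { rewrite <- !rsum_scal, <- rsum_plus. apply rsum_le. intros k _.
      specialize (Hstep k). unfold Rdiv in Hstep. lra. }
    assert (H2 : rsum (fun m => b (S m) ^ 2) n = rsum (fun m => b m ^ 2) n + b n ^ 2 - b 0%nat ^ 2).
    { pose proof (rsum_shift (fun m => b m ^ 2) n) as E. cbn [rsum] in E. lra. }
    assert (H3 : / (1 - r) * rsum (fun m => Cmod (h m) ^ 2) n <= / (1 - r) * M ^ 2).
    { apply Rmult_le_compat_l; [left; apply Rinv_0_lt_compat; lra | apply Hh]. }
    assert (H4 : b n ^ 2 <= (M / (1 - r)) ^ 2) by (apply pow_incr; auto).
    assert (H5 : 0 <= b 0%nat ^ 2) by apply pow2_ge_0.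
    assert (r * (b n ^ 2 - b 0%nat ^ 2) <= r * (M / (1 - r)) ^ 2) by (apply Rmult_le_compat_l; lra).
    rewrite H2 in H1. unfold Rdiv at 1. lra. }
  split; [apply Rmult_le_pos; auto; left; apply (garsia_const_mono r r); lra|]. intros n.
  rewrite (rsum_ext _ (fun m => (1 - r ^ 2) * b (S m) ^ 2)).
  2:{ intros m _. unfold garsia_coef, b. fold r. rewrite Cmod_mult, Cmod_R, Rabs_pos_eq by apply sqrt_pos.
      rewrite Rpow_mult_distr, pow2_sqrt; auto. nra. }
  rewrite rsum_scal.
  pose proof (rsum_shift (fun m => b m ^ 2) n) as E.
  specialize (Hsum (S n)).
  assert (H0 : 0 <= b 0%nat ^ 2) by apply pow2_ge_0.
  set (X := rsum (fun k => b (S k) ^ 2) n) in *.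
  assert (HX : (1 - r) * X <= M ^ 2 / (1 - r) + r * (M / (1 - r)) ^ 2) by (rewrite E in Hsum; nra).
  assert (Hc : (1 - r ^ 2) * X <= 2 * ((1 - r) * X)).
  { assert (0 <= X) by (apply rsum_nonneg; intros; apply pow2_ge_0).
    assert (0 <= (1 - r) ^ 2 * X) by (apply Rmult_le_pos; auto; apply pow2_ge_0). lra. }
  assert (Hd : M ^ 2 / (1 - r) + r * (M / (1 - r)) ^ 2 <= 2 * (M / (1 - r) ^ 2) ^ 2).
  { set (u := / (1 - r)). assert (Hu : 1 <= u).
    { unfold u. rewrite <- Rinv_1. apply Rinv_le_contravar; lra. }
    replace (M / (1 - r) ^ 2) with (M * u ^ 2) by (unfold u; field; lra).
    unfold Rdiv. fold u.
    assert (HM2 : 0 <= M ^ 2) by apply pow2_ge_0.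
    assert (Hu2 : u <= u ^ 4) by (rewrite <- (pow_1 u) at 1; apply Rle_pow; auto; lia).
    assert (Hu3 : u ^ 2 <= u ^ 4) by (apply Rle_pow; auto; lia).
    assert (M ^ 2 * u <= M ^ 2 * u ^ 4) by (apply Rmult_le_compat_l; auto).
    assert (M ^ 2 * u ^ 2 <= M ^ 2 * u ^ 4) by (apply Rmult_le_compat_l; auto).
    assert (r * (M * u) ^ 2 <= 1 * (M * u) ^ 2) by (apply Rmult_le_compat_r; [apply pow2_ge_0 | lra]).
    replace (2 * (M * u ^ 2) ^ 2) with (2 * (M ^ 2 * u ^ 4)) by ring.
    replace ((M * u) ^ 2) with (M ^ 2 * u ^ 2) in * by ring. lra. }
  unfold garsia_const. replace (2 / (1 - r) ^ 2 * M) with (2 * (M / (1 - r) ^ 2)) by (field; lra).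
  nra.
Qed.

(** * The Garsia function of a polynomial *)

(* Coefficients of the analytic polynomial whose real part is the harmonic extension of
   [|h|^2] from the circle. *)
Definition harmonic_coef (h : nat -> C) (n j : nat) : C :=
  ((if Nat.eq_dec j 0 then RtoC 1 else RtoC 2)
   * csum (fun m => (Cconj (h m) * h (m + j)%nat)%C) n)%C.

Lemma psum_upto_harmonic_coef (h : nat -> C) (n : nat) (z : C) :
  psum_upto (harmonic_coef h n) (S n) z =
  csum (fun m => (Cconj (h m) * (h m + RtoC 2 * (z * psum_upto (shift (S m) h) n z)))%C) n.
Proof.
  unfold psum_upto at 1. rewrite csum_shift.
  rewrite (csum_ext (fun m => (Cconj (h m) * (h m + 2 * (z * psum_upto (shift (S m) h) n z)))%C)
    (fun m => (Cconj (h m) * h (m + 0)%nat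
       + csum (fun i => (2 * (Cconj (h m) * h (m + S i)%nat) * pow_n z (S i))%C) n)%C)).
  - rewrite csum_plus, csum_switch. f_equal.
    + unfold harmonic_coef. simpl Nat.eq_dec. cbv iota. rewrite pow_n_0. ring.
    + apply csum_ext. intros i _. unfold harmonic_coef. destruct (Nat.eq_dec (S i) 0); [lia|].
      rewrite (csum_ext (fun m => (2 * (Cconj (h m) * h (m + S i)%nat) * pow_n z (S i))%C)
        (fun m => ((2 * pow_n z (S i)) * (Cconj (h m) * h (m + S i)%nat))%C)) by (intros; ring).
      rewrite csum_scal. ring.
  - intros m _. rewrite Nat.add_0_r. unfold psum_upto.
    rewrite (csum_ext (fun i => (2 * (Cconj (h m) * h (m + S i)%nat) * pow_n z (S i))%C)
      (fun i => ((2 * Cconj (h m) * z) * (shift (S m) h i * pow_n z i))%C)).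
    + rewrite csum_scal. ring.
    + intros i _. rewrite pow_n_S. unfold shift.
      replace (S m + i)%nat with (m + S i)%nat by lia. ring.
Qed.

(** Meant for [a = h m] and [x = z * b (m + 1)]: by Horner's recursion it turns each summand of
    [psum_upto_harmonic_coef] into a difference of squares. *)
Lemma Cmod2_plus (a x : C) :
  Cmod (a + x) ^ 2 - Cmod x ^ 2 = Re (Cconj a * (a + RtoC 2 * x))%C.
Proof. rewrite !Cmod2_alt. destruct a, x. unfold Cconj, Cmult, Cplus, Re, Im, RtoC. simpl. ring. Qed.

(** With [b m] the value at [z] of the series shifted by [m], the harmonic polynomial is the sum of
    [|b m|^2 - |z|^2 |b (m + 1)|^2]. Comparing with the terms [(1 - |z|^2) |b (m + 1)|^2] telescopes
    to [|b 0|^2 - |b n|^2], where [b n] vanishes. *)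
Lemma garsia_harmonic (h : nat -> C) (n : nat) (z : C) (B : R) :
  bdd h B -> (forall k, (n <= k)%nat -> h k = RtoC 0) -> Cmod z < 1 ->
  Cmod (psum h z) ^ 2 + rsum (fun m => Cmod (garsia_coef h z m) ^ 2) n = Re (psum_upto (harmonic_coef h n) (S n) z).
Proof.
  intros Hb Hn Hz. rewrite psum_upto_harmonic_coef, Re_csum.
  set (b := fun m => psum (shift m h) z).
  assert (Hz0 := Cmod_ge_0 z).
  rewrite (rsum_ext (fun k => Re (Cconj (h k) * (h k + 2 * (z * psum_upto (shift (S k) h) n z)))%C)
    (fun m => Cmod (b m) ^ 2 - Cmod z ^ 2 * Cmod (b (S m)) ^ 2)).
  - rewrite (rsum_ext (fun m => Cmod (garsia_coef h z m) ^ 2)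
      (fun m => Cmod (b (S m)) ^ 2 - Cmod z ^ 2 * Cmod (b (S m)) ^ 2)).
    + rewrite !rsum_minus.
      pose proof (rsum_shift (fun m => Cmod (b m) ^ 2) n) as E. cbn [rsum] in E.
      assert (Ebn : b n = RtoC 0).
      { unfold b. rewrite (psum_finite _ _ 0); [reflexivity|]. intros k _. apply Hn. lia. }
      rewrite Ebn, Cmod_0 in E. change (psum h z) with (b 0%nat).
      replace (0 ^ 2) with 0 in E by ring. lra.
    + intros m _. unfold garsia_coef. rewrite Cmod_mult, Cmod_R, Rabs_pos_eq by apply sqrt_pos.
      rewrite Rpow_mult_distr, pow2_sqrt; [unfold b; ring | nra].
  - intros m _. rewrite <- Rpow_mult_distr, <- Cmod_mult. unfold b.
    rewrite (psum_shift h B z m Hb Hz).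
    rewrite <- (psum_finite (shift (S m) h) z n) by (intros k Hk; apply Hn; lia).
    now rewrite Cmod2_plus.
Qed.

(** * Growth of the circle means controls the pairing *)

Definition mean1 (g : nat -> C) (r : R) : R := mean (fun t => Cmod (psum g (cis r t))).
Definition cmul (g h : nat -> C) (k : nat) : C := (g k * h k)%C.
Definition cconj (h : nat -> C) (k : nat) : C := Cconj (h k).
(** The circle mean inside [pairing], summed as the power series of terms [g k * h k * r ^ (2 k)];
    see [circle_pairing]. Replacing [h] by [cconj h] passes to the sesquilinear mean of
    [g conj h]. *)
Definition beta (g h : nat -> C) (r : R) : C := psum (cmul g h) (RtoC (r ^ 2)).

Lemma pow_n_RtoC (x : R) (k : nat) : pow_n (RtoC x) k = RtoC (x ^ k).
Proof. induction k as [|k IH]; [reflexivity|]. rewrite pow_n_S, IH, <- RtoC_mult. reflexivity. Qed.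

Lemma bdd_cmul (g h : nat -> C) (B D : R) : bdd g B -> bdd h D -> bdd (cmul g h) (B * D).
Proof.
  intros H1 H2 k. unfold cmul. rewrite Cmod_mult.
  apply Rmult_le_compat; auto; apply Cmod_ge_0.
Qed.

Lemma bdd_conj (h : nat -> C) (B : R) : bdd h B -> bdd (cconj h) B.
Proof. intros H k. unfold cconj. rewrite Cmod_conj. apply H. Qed.

Lemma ccont_psum_bdd (g : nat -> C) (B r : R) :
  bdd g B -> 0 <= r < 1 -> ccont (fun t => psum g (cis r t)).
Proof.
  intros Hg Hr. apply (ccont_psum g r (fun k => B * Cmod (RtoC r) ^ k)); [lra|].
  apply bdd_majorized; auto. rewrite Cmod_R, Rabs_pos_eq; lra.
Qed.

Lemma mean1_close (g h : nat -> C) (B D r eps : R) :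
  bdd g B -> bdd h D -> 0 <= r < 1 ->
  (forall t, Cmod (psum g (cis r t) - psum h (cis r t)) <= eps) -> Rabs (mean1 g r - mean1 h r) <= eps.
Proof.
  intros Hg Hh Hr H. apply mean_close.
  - eapply cont_Cmod, ccont_psum_bdd; eauto.
  - eapply cont_Cmod, ccont_psum_bdd; eauto.
  - intros t. eapply Rle_trans; [apply Cmod_diff | apply H].
Qed.

Lemma bdd_trunc (g : nat -> C) (B : R) (n : nat) : bdd g B -> bdd (trunc n g) B.
Proof.
  intros H k. unfold trunc. destruct (lt_dec k n); [apply H|].
  rewrite Cmod_0. apply (bdd_nonneg g); auto.
Qed.

Lemma psum_trunc (g : nat -> C) (n : nat) (z : C) : psum (trunc n g) z = psum_upto g n z.
Proof.
  rewrite (psum_finite _ _ n).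
  - apply csum_ext. intros k Hk. unfold trunc. destruct (lt_dec k n); [auto|lia].
  - intros k Hk. unfold trunc. destruct (lt_dec k n); [lia|auto].
Qed.

Lemma trunc_out (g : nat -> C) (n k : nat) : (n <= k)%nat -> trunc n g k = RtoC 0.
Proof. intros H. unfold trunc. destruct (lt_dec k n); [lia|auto]. Qed.

Lemma bdd_unif (g : nat -> C) (B r eps : R) :
  bdd g B -> 0 <= r < 1 -> 0 < eps ->
  exists N, forall n, (N <= n)%nat -> forall z, Cmod z <= r -> Cmod (psum_upto g n z - psum g z) <= eps.
Proof.
  intros Hg Hr He.
  assert (Hs : ex_series (fun k => B * r ^ k)).
  { apply (ex_series_scal_l B (fun k => r ^ k)), ex_series_geom. rewrite Rabs_pos_eq; lra. }
  destruct (tail_lim _ eps Hs He) as [N HN]. exists N. intros n Hn z Hz.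
  eapply Rle_trans; [apply (psum_approx g z (fun k => B * r ^ k))|].
  - split; auto. intros k. apply Rmult_le_compat; auto using Cmod_ge_0, pow_le.
    apply pow_incr. split; auto. apply Cmod_ge_0.
  - specialize (HN n Hn). apply Rabs_lt_between in HN. lra.
Qed.

(** Both functions are truncated. The tail of [h] has small l^2 norm, hence Garsia seminorm at most
    1 on the disk of radius [R0], strictly between [r] and 1. The truncation of [h] therefore has
    seminorm at most 1 + 1 there, and 4 is the square of this bound. *)
Lemma pairing_increment (g h : nat -> C) (B H eta s r : R) :
  bdd g B -> l2_le h H -> (forall z, Cmod z < 1 -> garsia_le h z 1) ->
  0 < eta -> 0 < s <= r -> r < 1 ->
  Re (beta g (cconj h) r) - Re (beta g (cconj h) s)
  <= / eta * (mean1 g r - mean1 g s) + eta * exp 4 * mean1 g r.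
Proof.
  intros Hg Hh Hgb Heta Hs Hr. pose proof (l2_le_bdd h H Hh) as Hhb.
  set (K := 2 + 2 * / eta + eta * exp 4).
  assert (Hie : 0 < / eta) by (apply Rinv_0_lt_compat; auto).
  assert (Hex : 0 < eta * exp 4) by (apply Rmult_lt_0_compat; [auto | apply exp_pos]).
  assert (HK : 0 < K) by (unfold K; lra).
  apply le_epsilon. intros e0 He0.
  set (e := e0 / K). assert (He : 0 < e) by (apply Rdiv_lt_0_compat; auto).
  set (R0 := (1 + r) / 2).
  assert (HG : 0 < garsia_const R0) by (apply (garsia_const_mono R0 R0); unfold R0; lra).
  destruct (l2_le_tail h H (/ garsia_const R0) Hh ltac:(apply Rinv_0_lt_compat; auto)) as [N1 HN1].
  destruct (bdd_unif g B r e Hg ltac:(lra) He) as [N2 HN2].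
  assert (Hgh : bdd (cmul g (cconj h)) (B * H)) by (apply bdd_cmul; auto using bdd_conj).
  assert (Hr2 : 0 <= r ^ 2 < 1) by (simpl; nra).
  destruct (bdd_unif (cmul g (cconj h)) (B * H) (r ^ 2) e Hgh Hr2 He) as [N3 HN3].
  set (N := Nat.max N1 (Nat.max N2 N3)).
  specialize (HN1 N ltac:(lia)). specialize (HN2 N ltac:(lia)). specialize (HN3 N ltac:(lia)).
  set (gN := trunc N g). set (hN := trunc N h).
  assert (HgN : bdd gN B) by (apply bdd_trunc; auto).
  assert (HhN : bdd hN H) by (apply bdd_trunc; auto).
  assert (Hgb2 : forall z, Cmod z < R0 -> garsia_le hN z 2).
  { intros z Hz. assert (Hz1 : Cmod z < 1) by (unfold R0 in Hz; lra).
    assert (Hsub : garsia_le (csub h hN) z 1).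
    { eapply l2_le_weaken; [apply (garsia_le_l2_le _ _ z HN1 Hz1)|].
      apply Rle_trans with (garsia_const R0 * / garsia_const R0); [|right; field; lra].
      apply Rmult_le_compat_r; [left; apply Rinv_0_lt_compat; auto|].
      apply garsia_const_mono. unfold R0 in *. lra. }
    replace hN with (csub h (csub h hN)) at 1.
    - replace 2 with (1 + 1) by ring.
      apply (garsia_le_sub h (csub h hN) H (H + H)); auto. apply bdd_sub; auto.
    - apply functional_extensionality. intros k. unfold csub. ring. }
  (* The harmonic polynomial has one coefficient more than [gN] and [hN], so these are padded to
     length [S N]. *)
  assert (HPsum : forall (c : nat -> C) (z : C), psum_upto (trunc N c) (S N) z = psum_upto c N z).
  { intros c z. rewrite <- (psum_trunc c). symmetry. apply psum_finite.
    intros k Hk. apply trunc_out. lia. }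
  assert (Hpair : forall x, circ_pair gN hN (S N) x = psum_upto (cmul g (cconj h)) N (RtoC (x ^ 2))).
  { intros x. unfold circ_pair. simpl csum. unfold gN at 2, hN at 2.
    rewrite !trunc_out by lia. rewrite Cmult_0_l, Cmult_0_l, Cplus_0_r.
    apply csum_ext. intros k Hk. rewrite pow_n_RtoC. unfold gN, hN, trunc, cmul, cconj.
    destruct (lt_dec k N); [reflexivity | lia]. }
  assert (Hm : forall x, mean (fun t => Cmod (psum_upto gN (S N) (cis x t))) = mean1 gN x).
  { intros x. apply mean_ext. intros t. unfold gN. now rewrite psum_trunc, HPsum. }
  pose proof (pairing_increment_poly gN hN (harmonic_coef hN N) (S N) 4 eta R0 s r Heta Hs
    ltac:(unfold R0; lra)) as HP.
  rewrite !Hpair, !Hm in HP.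
  assert (HPc : forall z, Cmod z < R0 ->
    0 <= 4 + Cmod (psum_upto hN (S N) z) ^ 2 - Re (psum_upto (harmonic_coef hN N) (S N) z) <= 4).
  { intros z Hz. assert (Hz1 : Cmod z < 1) by (unfold R0 in Hz; lra).
    rewrite <- (garsia_harmonic hN N z H); auto.
    2:{ intros k Hk. apply trunc_out; auto. }
    replace (psum_upto hN (S N) z) with (psum hN z) by (unfold hN; now rewrite psum_trunc, HPsum).
    destruct (Hgb2 z Hz) as [_ H2]. specialize (H2 N).
    assert (0 <= rsum (fun m => Cmod (garsia_coef hN z m) ^ 2) N)
      by (apply rsum_nonneg; intros; apply pow2_ge_0).
    lra. }
  specialize (HP HPc).
  assert (Hclose : forall x, 0 <= x <= r -> Rabs (mean1 gN x - mean1 g x) <= e).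
  { intros x Hx. apply (mean1_close gN g B B); auto; [lra|]. intros t.
    unfold gN. rewrite psum_trunc. apply HN2. rewrite Cmod_cis, Rabs_pos_eq; lra. }
  assert (Hbeta : forall x, 0 <= x <= r ->
     Rabs (Re (psum_upto (cmul g (cconj h)) N (RtoC (x ^ 2))) - Re (beta g (cconj h) x)) <= e).
  { intros x Hx. replace (Re _ - Re _) with (Re (psum_upto (cmul g (cconj h)) N (RtoC (x ^ 2)) - beta g (cconj h) x)%C)
      by reflexivity.
    eapply Rle_trans; [apply re_le_Cmod|]. apply HN3. rewrite Cmod_R, Rabs_pos_eq.
    - apply pow_incr. lra.
    - apply pow2_ge_0. }
  pose proof (Hclose r ltac:(lra)) as A1. pose proof (Hclose s ltac:(lra)) as A2.
  pose proof (Hbeta r ltac:(lra)) as A3. pose proof (Hbeta s ltac:(lra)) as A4.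
  apply Rabs_le_between in A1. apply Rabs_le_between in A2.
  apply Rabs_le_between in A3. apply Rabs_le_between in A4.
  assert (/ eta * (mean1 gN r - mean1 gN s) <= / eta * (mean1 g r - mean1 g s + 2 * e))
    by (apply Rmult_le_compat_l; lra).
  assert (eta * exp 4 * mean1 gN r <= eta * exp 4 * (mean1 g r + e)) by (apply Rmult_le_compat_l; lra).
  assert (E : e0 = K * e) by (unfold e; field; lra). unfold K in E. clearbody e. lra.
Qed.

Lemma psum_conj (c : nat -> C) (B : R) (z : C) :
  bdd c B -> Cmod z < 1 -> psum (cconj c) z = Cconj (psum c (Cconj z)).
Proof.
  intros Hc Hz. apply psum_unique. intros eps He.
  assert (Hz' : Cmod (Cconj z) < 1) by (rewrite Cmod_conj; auto).
  destruct (psum_lim c (Cconj z) (bdd_ex c B _ Hc Hz') eps He) as [N HN].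
  exists N. intros n Hn. specialize (HN n Hn).
  replace (psum_upto (cconj c) n z - Cconj (psum c (Cconj z)))%C
    with (Cconj (psum_upto c n (Cconj z) - psum c (Cconj z)))%C.
  - now rewrite Cmod_conj.
  - rewrite Cminus_conj. f_equal. unfold psum_upto. rewrite Cconj_csum. apply csum_ext. intros k _.
    rewrite Cmult_conj, pow_n_conj, Cconj_conj. reflexivity.
Qed.

Lemma garsia_le_conj (h : nat -> C) (B M : R) (z : C) :
  bdd h B -> Cmod z < 1 -> garsia_le h (Cconj z) M -> garsia_le (cconj h) z M.
Proof.
  intros Hh Hz [HM H]. split; auto. intros n.
  rewrite (rsum_ext _ (fun m => Cmod (garsia_coef h (Cconj z) m) ^ 2)); auto.
  intros m _. f_equal. unfold garsia_coef. rewrite !Cmod_mult, Cmod_conj.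
  change (shift (S m) (cconj h)) with (cconj (shift (S m) h)).
  rewrite (psum_conj _ B), Cmod_conj; auto. now apply bdd_shift.
Qed.

Lemma mean1_scal (l : C) (g : nat -> C) (B r : R) :
  bdd g B -> 0 <= r < 1 -> mean1 (cscal l g) r = Cmod l * mean1 g r.
Proof.
  intros Hg Hr. unfold mean1. rewrite <- mean_scal by (eapply cont_Cmod, ccont_psum_bdd; eauto).
  apply mean_ext. intros t. rewrite psum_scal, Cmod_mult; auto.
  apply (bdd_ex g B); auto. rewrite Cmod_cis, Rabs_pos_eq; lra.
Qed.

Lemma Cmod_rotate (w : C) : exists l, Cmod l = 1 /\ Re (l * w)%C = Cmod w.
Proof.
  destruct (Req_dec (Cmod w) 0) as [H0|H0].
  - exists (RtoC 1). split; [apply Cmod_1|]. apply Cmod_eq_0 in H0. subst.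
    rewrite Cmod_0, Cmult_0_r. reflexivity.
  - assert (Hne : RtoC (Cmod w) <> RtoC 0) by (intros E; apply RtoC_inj in E; lra).
    exists (Cconj w / RtoC (Cmod w))%C. split.
    + rewrite Cmod_div, Cmod_conj, Cmod_R, Rabs_pos_eq; auto using Cmod_ge_0. field; auto.
    + replace (Cconj w / Cmod w * w)%C with ((w * Cconj w) / Cmod w)%C by (field; auto).
      rewrite z_conj, RtoC_pow. replace (RtoC (Cmod w) ^ 2 / Cmod w)%C with (RtoC (Cmod w)) by (field; auto).
      reflexivity.
Qed.

(** Three normalisations of [pairing_increment]: a unimodular factor on [g] makes the increment a
    nonnegative real, division by [M] brings the Garsia bound to 1, and conjugating the coefficients
    of [h] makes the form bilinear. *)
Lemma beta_increment (g h : nat -> C) (B H M eta s r : R) :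
  bdd g B -> l2_le h H -> 0 < M -> (forall z, Cmod z < 1 -> garsia_le h z M) ->
  0 < eta -> 0 < s <= r -> r < 1 ->
  Cmod (beta g h r - beta g h s) <= M * (/ eta * (mean1 g r - mean1 g s) + eta * exp 4 * mean1 g r).
Proof.
  intros Hg Hh HM Hgb Heta Hs Hr.
  destruct (Cmod_rotate (beta g h r - beta g h s)%C) as [l [Hl1 Hl]].
  rewrite <- Hl. pose proof (l2_le_bdd h H Hh) as Hhb.
  set (h' := cscal (RtoC (/ M)) (cconj h)).
  assert (HiM : Cmod (RtoC (/ M)) = / M).
  { rewrite Cmod_R, Rabs_pos_eq; auto. left. now apply Rinv_0_lt_compat. }
  assert (Hh' : l2_le h' (/ M * H)).
  { rewrite <- HiM. apply l2_le_scal. destruct Hh as [H1 H2]. split; auto. intros n.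
    rewrite (rsum_ext _ (fun k => Cmod (h k) ^ 2)); auto. intros k _. unfold cconj. now rewrite Cmod_conj. }
  assert (Hgb' : forall z, Cmod z < 1 -> garsia_le h' z 1).
  { intros z Hz. replace 1 with (Cmod (RtoC (/ M)) * M) by (rewrite HiM; field; lra).
    apply (garsia_le_scal _ _ H); auto using bdd_conj. apply (garsia_le_conj h H); auto.
    apply Hgb. now rewrite Cmod_conj. }
  pose proof (pairing_increment (cscal l g) h' (Cmod l * B) (/ M * H) eta s r
    (bdd_scal l g B Hg) Hh' Hgb' Heta Hs Hr) as HP.
  rewrite !(mean1_scal l g B) in HP by (auto; lra). rewrite Hl1, !Rmult_1_l in HP.
  assert (Hb : forall x, 0 <= x < 1 -> beta (cscal l g) (cconj h') x = (RtoC (/ M) * (l * beta g h x))%C).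
  { intros x Hx. unfold beta.
    assert (Hx2 : Cmod (RtoC (x ^ 2)) < 1) by (rewrite Cmod_R, Rabs_pos_eq; simpl; nra).
    rewrite <- !psum_scal.
    - f_equal. apply functional_extensionality. intros k.
      unfold cmul, cscal, h', cconj, cscal. rewrite Cmult_conj, Cconj_conj.
      replace (Cconj (RtoC (/ M))) with (RtoC (/ M)) by (unfold Cconj, RtoC; simpl; f_equal; ring).
      ring.
    - apply (bdd_ex _ (Cmod l * (B * H))); auto using bdd_cmul, bdd_scal.
    - apply (bdd_ex _ (B * H)); auto using bdd_cmul. }
  rewrite !Hb in HP by lra.
  replace (Re (RtoC (/ M) * (l * beta g h r))%C) with (/ M * Re (l * beta g h r)%C) in HP
    by (unfold Re, Cmult, RtoC; simpl; ring).
  replace (Re (RtoC (/ M) * (l * beta g h s))%C) with (/ M * Re (l * beta g h s)%C) in HP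
    by (unfold Re, Cmult, RtoC; simpl; ring).
  replace (Re (l * (beta g h r - beta g h s))%C) with (Re (l * beta g h r)%C - Re (l * beta g h s)%C)
    by (unfold Re, Cmult, Cminus, Cplus, Copp; simpl; ring).
  apply Rmult_le_reg_l with (/ M); [now apply Rinv_0_lt_compat|].
  rewrite <- Rmult_assoc, Rinv_l, Rmult_1_l by lra. lra.
Qed.

(** * The Hardy space *)

(** [real] sends infinite values to 0, so this number is the norm only for members of H^1; the same
    holds for [bmo]. *)
Definition h1 (g : nat -> C) : R := real (H1norm g).

(** Abel's lemma: convergence at the intermediate radius [x] bounds the terms there, and the ratio
    [r / x] leaves a geometric majorant. *)
Lemma holo_majorized (g : nat -> C) (r : R) : holo_disk g -> 0 <= r < 1 -> exists u, majorized g (RtoC r) u.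
Proof.
  intros Hg Hr. set (x := (1 + r) / 2). assert (Hx : 0 < x < 1) by (unfold x; lra).
  destruct (Hg (RtoC x)) as [l Hl]; [rewrite Cmod_R, Rabs_pos_eq; lra|].
  assert (Hex : ex_series (fun k => (g k * pow_n (RtoC x) k)%C)) by (exists l; exact Hl).
  destruct (psum_lim g (RtoC x) Hex 1 ltac:(lra)) as [N HN].
  assert (HB : exists B, forall k, Cmod (g k) * x ^ k <= B).
  { exists (2 + rsum (fun k => Cmod (g k) * x ^ k) N). intros k.
    assert (Hp : forall j, 0 <= Cmod (g j) * x ^ j)
      by (intros; apply Rmult_le_pos; [apply Cmod_ge_0 | apply pow_le; lra]).
    destruct (le_lt_dec N k) as [Hk|Hk].
    - pose proof (HN k Hk) as H1. pose proof (HN (S k) ltac:(lia)) as H2.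
      assert (E : (g k * pow_n (RtoC x) k)%C
        = ((psum_upto g (S k) (RtoC x) - psum g (RtoC x)) - (psum_upto g k (RtoC x) - psum g (RtoC x)))%C)
        by (unfold psum_upto; simpl; ring).
      replace (Cmod (g k) * x ^ k) with (Cmod (g k * pow_n (RtoC x) k)%C).
      2:{ rewrite Cmod_mult, Cmod_pow_n, Cmod_R, Rabs_pos_eq by lra. reflexivity. }
      rewrite E. unfold Cminus at 1. eapply Rle_trans; [apply Cmod_triangle|]. rewrite Cmod_opp.
      pose proof (rsum_nonneg (fun k => Cmod (g k) * x ^ k) N (fun j _ => Hp j)). lra.
    - pose proof (rsum_incr (fun k => Cmod (g k) * x ^ k) (S k) N Hp ltac:(lia)) as H1.
      cbn [rsum] in H1.
      pose proof (rsum_nonneg (fun k => Cmod (g k) * x ^ k) k (fun j _ => Hp j)). lra. }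
  destruct HB as [B HB]. exists (fun k => B * (r / x) ^ k). split.
  - apply (ex_series_scal_l B (fun k => (r / x) ^ k)), ex_series_geom.
    rewrite Rabs_pos_eq by (apply Rdiv_le_0_compat; lra).
    apply Rmult_lt_reg_r with x; [lra|]. unfold Rdiv. rewrite Rmult_assoc, Rinv_l by lra.
    unfold x. lra.
  - intros k. rewrite Cmod_R, Rabs_pos_eq by lra.
    replace (Cmod (g k) * r ^ k) with (Cmod (g k) * x ^ k * (r / x) ^ k).
    + apply Rmult_le_compat_r; auto. apply pow_le, Rdiv_le_0_compat; lra.
    + unfold Rdiv. rewrite Rpow_mult_distr, pow_inv. field. apply pow_nonzero. lra.
Qed.

Lemma bdd_holo (g : nat -> C) (B : R) : bdd g B -> holo_disk g.
Proof. intros Hg z Hz. eapply bdd_ex; eauto. Qed.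

Lemma circ_mean_pow_1 (g : nat -> C) (r : R) : circ_mean_pow 1 g r = mean1 g r.
Proof. apply mean_ext. intros t. ring. Qed.

Lemma cmean_psum_pow_conj (g : nat -> C) (r : R) (u : nat -> R) (k : nat) :
  0 <= r <= 1 -> majorized g (RtoC r) u ->
  cmean (fun t => (psum g (cis r t) * Cconj (pow_n (cis r t) k))%C) = (g k * RtoC ((r ^ 2) ^ k))%C.
Proof.
  intros Hr Hu.
  assert (Hz : forall eps, 0 < eps -> Cmod (cmean (fun t => (psum g (cis r t) * Cconj (pow_n (cis r t) k))%C)
     - g k * RtoC ((r ^ 2) ^ k)) <= eps).
  { intros eps He. destruct (tail_lim u eps (proj1 Hu) He) as [N HN].
    set (n := Nat.max N (S k)). specialize (HN n ltac:(lia)). apply Rabs_lt_between in HN.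
    assert (E : (g k * RtoC ((r ^ 2) ^ k))%C
      = cmean (fun t => (psum_upto g n (cis r t) * Cconj (pow_n (cis r t) k))%C)).
    { rewrite cmean_psum_upto_pow_conj. destruct (lt_dec k n); [reflexivity | lia]. }
    rewrite E. apply cmean_close.
    - apply ccont_mult; [apply (ccont_psum g r u); auto; lra | apply ccont_conj, ccont_pow_n_cis].
    - apply ccont_mult; [apply ccont_psum_upto | apply ccont_conj, ccont_pow_n_cis].
    - intros t. replace (psum g (cis r t) * Cconj (pow_n (cis r t) k) -
        psum_upto g n (cis r t) * Cconj (pow_n (cis r t) k))%C
        with (- (psum_upto g n (cis r t) - psum g (cis r t)) * Cconj (pow_n (cis r t) k))%C by ring.
      rewrite Cmod_mult, Cmod_opp, Cmod_conj, Cmod_pow_n, Cmod_cis, Rabs_pos_eq by lra.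
      assert (H1 : Cmod (psum_upto g n (cis r t) - psum g (cis r t)) <= eps).
      { eapply Rle_trans; [apply (psum_approx _ _ u), cis_majorized; auto; lra|]. lra. }
      assert (H2 : 0 <= r ^ k <= 1) by (split; [apply pow_le; lra | rewrite <- (pow1 k); apply pow_incr; lra]).
      pose proof (Cmod_ge_0 (psum_upto g n (cis r t) - psum g (cis r t))). nra. }
  assert (H0 : Cmod (cmean (fun t => (psum g (cis r t) * Cconj (pow_n (cis r t) k))%C)
     - g k * RtoC ((r ^ 2) ^ k)) = 0).
  { apply Rle_antisym; [|apply Cmod_ge_0]. apply le_epsilon. intros e He. rewrite Rplus_0_l. auto. }
  apply Cmod_eq_0 in H0.
  replace (cmean _) with ((cmean (fun t => (psum g (cis r t) * Cconj (pow_n (cis r t) k))%C)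
     - g k * RtoC ((r ^ 2) ^ k)) + g k * RtoC ((r ^ 2) ^ k))%C by ring.
  rewrite H0. ring.
Qed.

Lemma coef_le_mean1 (g : nat -> C) (r : R) (k : nat) :
  holo_disk g -> 0 <= r < 1 -> Cmod (g k) * r ^ k <= mean1 g r.
Proof.
  intros Hg Hr. destruct (holo_majorized g r Hg Hr) as [u Hu].
  assert (Hc : ccont (fun t => psum g (cis r t))) by (apply (ccont_psum g r u); auto; lra).
  pose proof (cmean_psum_pow_conj g r u k ltac:(lra) Hu) as E.
  assert (H1 : Cmod (g k) * (r ^ 2) ^ k <= r ^ k * mean1 g r).
  { replace (Cmod (g k) * (r ^ 2) ^ k) with (Cmod (g k * RtoC ((r ^ 2) ^ k))%C).
    2:{ rewrite Cmod_mult, Cmod_R, Rabs_pos_eq; auto. apply pow_le, pow2_ge_0. }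
    rewrite <- E. unfold mean1. rewrite <- mean_scal by (apply cont_Cmod; auto).
    eapply Rle_trans; [apply Cmod_cmean|].
    - apply ccont_mult; auto. apply ccont_conj, ccont_pow_n_cis.
    - right. apply mean_ext. intros t.
      rewrite Cmod_mult, Cmod_conj, Cmod_pow_n, Cmod_cis, Rabs_pos_eq by lra. ring. }
  destruct (Req_dec r 0) as [->|Hr0].
  - destruct k as [|k].
    + simpl in *. lra.
    + rewrite pow_i by lia. rewrite Rmult_0_r. apply mean_nonneg; [apply cont_Cmod; auto|].
      intros; apply Cmod_ge_0.
  - assert (Hp : 0 < r ^ k) by (apply pow_lt; lra).
    apply Rmult_le_reg_l with (r ^ k); auto.
    replace (r ^ k * (Cmod (g k) * r ^ k)) with (Cmod (g k) * (r ^ 2) ^ k); auto.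
    rewrite <- pow_mult. replace (2 * k)%nat with (k + k)%nat by lia. rewrite pow_add. ring.
Qed.

(** Cauchy's estimates as the radius tends to 1. They place H^1 among the sequences with bounded
    coefficients, the hypothesis [bdd] of the lemmas on power series. *)
Lemma bdd_of_mean1 (g : nat -> C) (M : R) :
  holo_disk g -> (forall r, 0 <= r < 1 -> mean1 g r <= M) -> bdd g M.
Proof.
  intros Hg HM k. apply Rnot_lt_le. intros Hlt.
  assert (HM0 : 0 <= M).
  { eapply Rle_trans; [|apply (HM 0); lra]. apply (Rle_trans _ (Cmod (g 0%nat) * 0 ^ 0)).
    - simpl. rewrite Rmult_1_r. apply Cmod_ge_0.
    - apply coef_le_mean1; auto; lra. }
  destruct (Req_dec (Cmod (g k)) 0) as [E|E]; [lra|].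
  pose proof (Cmod_ge_0 (g k)).
  assert (Hlim : continuity_pt (fun r => Cmod (g k) * r ^ k) 1).
  { apply continuity_pt_filterlim.
    apply (ex_derive_continuous (V := R_NormedModule) (fun r => Cmod (g k) * r ^ k)).
    auto_derive; auto. }
  destruct (Hlim (Cmod (g k) - M) ltac:(lra)) as [d [Hd HH]].
  set (r := Rmax 0 (1 - d / 2)).
  assert (Hr : 0 <= r < 1 /\ 1 - r < d).
  { unfold r. pose proof (Rmax_l 0 (1 - d / 2)). pose proof (Rmax_r 0 (1 - d / 2)).
    split; [split; auto|lra]. apply Rmax_lub_lt; lra. }
  specialize (HH r). simpl in HH. unfold R_dist in HH.
  assert (Hc : Rabs (Cmod (g k) * r ^ k - Cmod (g k) * 1 ^ k) < Cmod (g k) - M).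
  { apply HH. split; [split; [exact I|lra]|]. apply Rabs_lt_between. lra. }
  rewrite pow1 in Hc. apply Rabs_lt_between in Hc.
  pose proof (coef_le_mean1 g r k Hg ltac:(lra)). pose proof (HM r ltac:(lra)). lra.
Qed.

Lemma Lub_bounded (E : R -> Prop) (M x : R) :
  E x -> (forall y, E y -> y <= M) ->
  is_finite (Lub_Rbar E) /\ (forall y, E y -> y <= real (Lub_Rbar E)) /\ real (Lub_Rbar E) <= M.
Proof.
  intros Hx HM. destruct (Lub_Rbar_correct E) as [H1 H2].
  pose proof (H2 (Finite M) HM) as H3. pose proof (H1 x Hx) as H4.
  destruct (Lub_Rbar E) as [l| |]; simpl in *; try tauto.
  repeat split; auto.
Qed.

Lemma inH1_spec (g : nat -> C) :
  inH1 g -> bdd g (h1 g) /\ (forall r, 0 <= r < 1 -> mean1 g r <= h1 g).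
Proof.
  intros [Hg Hn].
  assert (HM : forall r, 0 <= r < 1 -> mean1 g r <= h1 g).
  { intros r Hr. unfold h1, H1norm, Hpnorm in *.
    destruct (Lub_Rbar_correct (fun x => exists r, 0 <= r < 1 /\ x = circ_mean_pow 1 g r)) as [H1 _].
    specialize (H1 (mean1 g r)). destruct (Lub_Rbar _) as [l| |]; simpl in *; try tauto.
    - apply H1. exists r. split; auto. now rewrite circ_mean_pow_1.
    - exfalso. apply H1. exists r. split; auto. now rewrite circ_mean_pow_1. }
  split; auto. apply bdd_of_mean1; auto.
Qed.

Lemma inH1_intro (g : nat -> C) (M : R) :
  holo_disk g -> (forall r, 0 <= r < 1 -> mean1 g r <= M) ->
  inH1 g /\ is_finite (H1norm g) /\ h1 g <= M.
Proof.
  intros Hg HM.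
  destruct (Lub_bounded (fun x => exists r, 0 <= r < 1 /\ x = circ_mean_pow 1 g r) M (mean1 g 0))
    as (H1 & H2 & H3).
  - exists 0. split; [lra|]. now rewrite circ_mean_pow_1.
  - intros y [r [Hr ->]]. rewrite circ_mean_pow_1. auto.
  - split; [|split; auto]. split; auto. unfold H1norm, Hpnorm. rewrite <- H1. exact I.
Qed.

Lemma mean1_nonneg (g : nat -> C) (r : R) : holo_disk g -> 0 <= r < 1 -> 0 <= mean1 g r.
Proof.
  intros Hg Hr. destruct (holo_majorized g r Hg Hr) as [u Hu].
  apply mean_nonneg; [apply cont_Cmod, (ccont_psum g r u); auto; lra | intros; apply Cmod_ge_0].
Qed.

Lemma h1_nonneg (g : nat -> C) : inH1 g -> 0 <= h1 g.
Proof.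
  intros H. eapply Rle_trans; [|apply (proj2 (inH1_spec g H) 0); lra].
  apply mean1_nonneg; [apply H | lra].
Qed.

Lemma mean1_plus (f g : nat -> C) (B D r : R) :
  bdd f B -> bdd g D -> 0 <= r < 1 -> mean1 (cadd f g) r <= mean1 f r + mean1 g r.
Proof.
  intros Hf Hg Hr. unfold mean1. rewrite <- mean_plus by (eapply cont_Cmod, ccont_psum_bdd; eauto).
  apply mean_le.
  - eapply cont_Cmod, ccont_psum_bdd; eauto using bdd_plus.
  - apply cont_plus; eapply cont_Cmod, ccont_psum_bdd; eauto.
  - intros t. rewrite psum_plus; [apply Cmod_triangle|..]; eapply bdd_ex; eauto;
      rewrite Cmod_cis, Rabs_pos_eq; lra.
Qed.

Lemma inH1_plus (f g : nat -> C) : inH1 f -> inH1 g -> inH1 (cadd f g) /\ h1 (cadd f g) <= h1 f + h1 g.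
Proof.
  intros Hf Hg. destruct (inH1_spec f Hf) as [Bf Mf]. destruct (inH1_spec g Hg) as [Bg Mg].
  destruct (inH1_intro (cadd f g) (h1 f + h1 g)) as (H1 & _ & H2); auto.
  - eapply bdd_holo, bdd_plus; eauto.
  - intros r Hr. eapply Rle_trans; [eapply mean1_plus; eauto|]. apply Rplus_le_compat; auto.
Qed.

Lemma inH1_scal (l : C) (g : nat -> C) : inH1 g -> inH1 (cscal l g) /\ h1 (cscal l g) <= Cmod l * h1 g.
Proof.
  intros Hg. destruct (inH1_spec g Hg) as [Bg Mg].
  destruct (inH1_intro (cscal l g) (Cmod l * h1 g)) as (H1 & _ & H2); auto.
  - eapply bdd_holo, bdd_scal; eauto.
  - intros r Hr. rewrite (mean1_scal l g (h1 g)) by auto. apply Rmult_le_compat_l; auto using Cmod_ge_0.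
Qed.

Lemma inH1_sub (f g : nat -> C) : inH1 f -> inH1 g -> inH1 (csub f g) /\ h1 (csub f g) <= h1 f + h1 g.
Proof.
  intros Hf Hg. rewrite csub_cadd. destruct (inH1_scal (RtoC (-1)) g Hg) as [H1 H2].
  rewrite Cmod_m1' in H2. destruct (inH1_plus f _ Hf H1) as [H3 H4]. split; auto. lra.
Qed.

Lemma bdd_coef_lim (y : nat -> nat -> C) (x : nat -> C) (B : R) :
  (forall i, bdd (y i) B) ->
  (forall k eps, 0 < eps -> exists I, forall i, (I <= i)%nat -> Cmod (y i k - x k) < eps) -> bdd x B.
Proof.
  intros Hy Hlim k. apply le_epsilon. intros eps He. destruct (Hlim k eps He) as [I HI].
  specialize (HI I ltac:(lia)).
  replace (x k) with (y I k - (y I k - x k))%C by ring. unfold Cminus at 1.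
  eapply Rle_trans; [apply Cmod_triangle|]. rewrite Cmod_opp. specialize (Hy I k). lra.
Qed.

(** The common bound controls all tails by one geometric series; only finitely many coefficients
    remain, and these converge. *)
Lemma psum_coef_lim (y : nat -> nat -> C) (x : nat -> C) (B r eps : R) :
  (forall i, bdd (y i) B) -> 0 <= r < 1 ->
  (forall k eps, 0 < eps -> exists I, forall i, (I <= i)%nat -> Cmod (y i k - x k) < eps) ->
  0 < eps ->
  exists I, forall i, (I <= i)%nat -> forall z, Cmod z <= r -> Cmod (psum (y i) z - psum x z) <= eps.
Proof.
  intros Hy Hr Hlim He. pose proof (bdd_coef_lim y x B Hy Hlim) as Hx.
  assert (Hs : ex_series (fun k => (B + B) * r ^ k)).
  { apply (ex_series_scal_l (B + B) (fun k => r ^ k)), ex_series_geom. rewrite Rabs_pos_eq; lra. }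
  destruct (tail_lim _ (eps / 2) Hs ltac:(lra)) as [N HN]. specialize (HN N ltac:(lia)).
  apply Rabs_lt_between in HN. pose proof (pos_INR N) as HNp.
  set (d := eps / 2 / (INR N + 1)). assert (Hd : 0 < d) by (repeat apply Rdiv_lt_0_compat; lra).
  assert (HI : forall n, exists I, forall i k, (I <= i)%nat -> (k < n)%nat -> Cmod (y i k - x k) <= d).
  { induction n as [|n [I HI]]; [exists 0%nat; intros; lia|].
    destruct (Hlim n _ Hd) as [I2 HI2]. exists (Nat.max I I2). intros i k Hi Hk.
    destruct (Nat.eq_dec k n) as [->|Hne].
    - left. apply HI2. lia.
    - apply HI; lia. }
  destruct (HI N) as [I HI']. exists I. intros i Hi z Hz.
  pose proof (Cmod_ge_0 z) as Hz0.
  pose proof (bdd_sub (y i) x B B (Hy i) Hx) as HD.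
  assert (E : (psum (y i) z - psum x z)%C = psum (csub (y i) x) z).
  { rewrite csub_cadd, psum_plus, psum_scal.
    - ring.
    - apply (bdd_ex x B); auto; lra.
    - apply (bdd_ex (y i) B); auto; lra.
    - apply (bdd_ex _ (Cmod (RtoC (-1)) * B)); auto using bdd_scal; lra. }
  rewrite E.
  replace (psum (csub (y i) x) z) with (psum_upto (csub (y i) x) N z
     - (psum_upto (csub (y i) x) N z - psum (csub (y i) x) z))%C by ring.
  unfold Cminus at 1. eapply Rle_trans; [apply Cmod_triangle|]. rewrite Cmod_opp.
  assert (Hpow : forall k, 0 <= Cmod z ^ k <= r ^ k)
    by (intros k; split; [apply pow_le; auto | apply pow_incr; lra]).
  assert (H1 : Cmod (psum_upto (csub (y i) x) N z) <= eps / 2).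
  { eapply Rle_trans; [apply (Cmod_csum _ (fun _ => d * 1))|].
    - intros k Hk. rewrite Cmod_mult, Cmod_pow_n. specialize (HI' i k Hi Hk).
      apply Rmult_le_compat; auto using Cmod_ge_0; [apply Hpow|].
      rewrite <- (pow1 k). apply pow_incr. lra.
    - rewrite rsum_scal.
      rewrite rsum_const. apply Rle_trans with (d * (INR N + 1)); [apply Rmult_le_compat_l; lra|].
      unfold d. right. field. lra. }
  assert (H2 : Cmod (psum_upto (csub (y i) x) N z - psum (csub (y i) x) z) <= eps / 2).
  { eapply Rle_trans; [apply (psum_approx _ _ (fun k => (B + B) * r ^ k))|lra].
    split; auto. intros k. apply Rmult_le_compat; auto using Cmod_ge_0; apply Hpow. }
  lra.
Qed.

(** Balls of H^1 are closed under bounded coefficientwise convergence, since this convergence is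
    uniform on each circle. Limits of dilations and of Cauchy sequences are treated in this way. *)
Lemma mean1_lsc (y : nat -> nat -> C) (x : nat -> C) (B M r : R) :
  (forall i, bdd (y i) B) -> 0 <= r < 1 -> (forall i, mean1 (y i) r <= M) ->
  (forall k eps, 0 < eps -> exists I, forall i, (I <= i)%nat -> Cmod (y i k - x k) < eps) ->
  bdd x B /\ mean1 x r <= M.
Proof.
  intros Hy Hr HM Hlim. pose proof (bdd_coef_lim y x B Hy Hlim) as Hx. split; auto.
  apply le_epsilon. intros eps He.
  destruct (psum_coef_lim y x B r eps Hy Hr Hlim He) as [I HI]. specialize (HI I ltac:(lia)).
  assert (Hc : Rabs (mean1 (y I) r - mean1 x r) <= eps).
  { apply (mean1_close (y I) x B B); auto. intros t. apply HI. rewrite Cmod_cis, Rabs_pos_eq; lra. }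
  apply Rabs_le_between in Hc. specialize (HM I). lra.
Qed.

(** * The pairing *)

(** The case [h = 0] of [beta_increment]: the right side is nonnegative for every [eta], and letting
    [eta] tend to 0 forces the difference of the means to be nonnegative. *)
Lemma mean1_mono (g : nat -> C) (B s r : R) : bdd g B -> 0 <= s <= r -> r < 1 -> mean1 g s <= mean1 g r.
Proof.
  (* The increment needs a positive inner radius. At radius 0 the mean is the modulus of the
     constant coefficient, which Cauchy's estimate bounds. *)
  intros Hg Hs Hr. destruct (Req_dec s 0) as [->|Hs0].
  { rewrite <- (Rmult_1_r (mean1 g 0)). unfold mean1 at 1.
    rewrite (mean_ext _ (fun _ => Cmod (g 0%nat))).
    - rewrite mean_const. replace 1 with (r ^ 0) by ring.
      apply (coef_le_mean1 g r 0); [eapply bdd_holo; eauto | lra].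
    - intros t. f_equal. replace (cis 0 t) with (RtoC 0) by (unfold cis, RtoC; f_equal; ring).
      apply psum_0. }
  assert (H0 : forall z, Cmod z < 1 -> garsia_le (fun _ => RtoC 0) z 1).
  { intros z Hz. split; [lra|]. intros n. rewrite (rsum_ext _ (fun _ => 0)).
    - rewrite rsum_const. lra.
    - intros m _. unfold garsia_coef. rewrite (psum_finite _ _ 0) by reflexivity.
      unfold psum_upto; simpl. rewrite Cmult_0_r, Cmod_0. ring. }
  assert (Hl : l2_le (fun _ => RtoC 0) 1).
  { split; [lra|]. intros n. rewrite (rsum_ext _ (fun _ => 0)).
    - rewrite rsum_const. lra.
    - intros m _. rewrite Cmod_0. ring. }
  assert (Hm0 : 0 <= mean1 g r) by (apply mean1_nonneg; [eapply bdd_holo; eauto | lra]).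
  apply le_epsilon. intros eps He. apply Rnot_lt_le. intros Hlt.
  set (K := exp 4 * mean1 g r + 1). pose proof (exp_pos 4).
  assert (HK : 1 <= K) by (unfold K; nra).
  (* [eta * K <= eps] makes the error term small, and [eta <= 1] makes division by [eta] enlarge a
     negative difference of means. *)
  set (eta := Rmin 1 (eps / K)).
  assert (Heta : 0 < eta) by (apply Rmin_pos; [lra | apply Rdiv_lt_0_compat; lra]).
  assert (He1 : eta <= 1) by apply Rmin_l.
  assert (He2 : eta * K <= eps).
  { apply Rle_trans with (eps / K * K); [|right; field; lra].
    apply Rmult_le_compat_r; [lra | apply Rmin_r]. }
  pose proof (beta_increment g (fun _ => RtoC 0) B 1 1 eta s r Hg Hl ltac:(lra) H0 Heta ltac:(lra) Hr) as HI.
  assert (Hpos : 0 <= / eta * (mean1 g r - mean1 g s) + eta * exp 4 * mean1 g r).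
  { rewrite Rmult_1_l in HI. eapply Rle_trans; [apply Cmod_ge_0 | exact HI]. }
  assert (Hm : eta * exp 4 * mean1 g r < eps).
  { apply Rlt_le_trans with (eta * K); auto. unfold K. nra. }
  assert (H1 : 1 <= / eta) by (rewrite <- Rinv_1; apply Rinv_le_contravar; lra).
  assert (/ eta * (mean1 g r - mean1 g s) <= 1 * (mean1 g r - mean1 g s)).
  { assert (0 <= (/ eta - 1) * (mean1 g s - mean1 g r)) by (apply Rmult_le_pos; lra). lra. }
  lra.
Qed.

(** One unit for the product of the constant coefficients, left over at small radii, and [1 + exp 4]
    for the increment taken with [eta = 1]. *)
Definition fefferman : R := 2 + exp 4.

Lemma fefferman_pos : 0 < fefferman.
Proof. unfold fefferman. pose proof (exp_pos 4). lra. Qed.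

Lemma psum_near_0 (c : nat -> C) (B : R) (z : C) :
  bdd c B -> Cmod z < 1 -> Cmod (psum c z - c 0%nat) <= Cmod z * (B / (1 - Cmod z)).
Proof.
  intros Hc Hz. change (psum c z) with (psum (shift 0 c) z).
  rewrite (psum_shift c B z 0 Hc Hz).
  replace (c 0%nat + z * psum (shift 1 c) z - c 0%nat)%C with (z * psum (shift 1 c) z)%C by ring.
  rewrite Cmod_mult. apply Rmult_le_compat_l; [apply Cmod_ge_0|].
  apply bdd_psum_le; auto. now apply bdd_shift.
Qed.

Lemma beta_bound (g h : nat -> C) (H M r : R) :
  inH1 g -> l2_le h H -> 0 < M -> (forall z, Cmod z < 1 -> garsia_le h z M) -> Cmod (h 0%nat) <= M ->
  0 <= r < 1 -> Cmod (beta g h r) <= fefferman * M * h1 g.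
Proof.
  intros Hg Hh HM Hgb Hh0 Hr. destruct (inH1_spec g Hg) as [Bg Mg].
  pose proof (h1_nonneg g Hg) as Hn. pose proof (l2_le_bdd h H Hh) as Hhb.
  pose proof (bdd_cmul g h _ _ Bg Hhb) as Hc. pose proof (bdd_nonneg _ _ Hc) as HB.
  apply le_epsilon. intros eps He.
  set (B := h1 g * H) in *.
  (* A radius up to which the pairing stays within [eps] of the product of the constant
     coefficients, by [psum_near_0]. *)
  assert (Hs0 : exists s, 0 < s < 1 /\ s ^ 2 * (B / (1 - s ^ 2)) <= eps).
  { exists (Rmin (1 / 2) (eps / (2 * B + 1))).
    set (s := Rmin _ _). assert (H1 : s <= 1 / 2) by apply Rmin_l.
    assert (H2 : s <= eps / (2 * B + 1)) by apply Rmin_r.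
    assert (H3 : 0 < s) by (apply Rmin_pos; [lra | apply Rdiv_lt_0_compat; lra]).
    split; [lra|].
    assert (H4 : s * (2 * B + 1) <= eps).
    { apply Rle_trans with (eps / (2 * B + 1) * (2 * B + 1)); [|right; field; lra].
      apply Rmult_le_compat_r; lra. }
    assert (H5 : s ^ 2 <= s / 2) by (simpl; nra).
    assert (H6 : B / (1 - s ^ 2) <= B * 2).
    { unfold Rdiv. apply Rmult_le_compat_l; auto. rewrite <- (Rinv_inv 2).
      apply Rinv_le_contravar; simpl in *; lra. }
    assert (H7 : 0 <= B / (1 - s ^ 2)) by (apply Rdiv_le_0_compat; simpl in *; lra).
    apply Rle_trans with (s / 2 * (B * 2)); [apply Rmult_le_compat; auto; apply pow2_ge_0|].
    nra. }
  destruct Hs0 as (s & Hs & Hse).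
  assert (Hnear : forall x, 0 <= x <= s -> Cmod (beta g h x) <= h1 g * M + eps).
  { intros x Hx. unfold beta.
    assert (Ex : Cmod (RtoC (x ^ 2)) = x ^ 2) by (rewrite Cmod_R; apply Rabs_pos_eq, pow2_ge_0).
    assert (Hx2 : x ^ 2 <= s ^ 2) by (apply pow_incr; lra).
    assert (Hs2 : s ^ 2 < 1) by (simpl; nra).
    pose proof (psum_near_0 (cmul g h) B (RtoC (x ^ 2)) Hc ltac:(rewrite Ex; lra)) as H1.
    rewrite Ex in H1.
    assert (H2 : x ^ 2 * (B / (1 - x ^ 2)) <= s ^ 2 * (B / (1 - s ^ 2))).
    { apply Rmult_le_compat; auto; [apply pow2_ge_0 | apply Rdiv_le_0_compat; lra |].
      unfold Rdiv. apply Rmult_le_compat_l; auto. apply Rinv_le_contravar; lra. }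
    replace (psum (cmul g h) (RtoC (x ^ 2))) with
      ((psum (cmul g h) (RtoC (x ^ 2)) - cmul g h 0%nat) + cmul g h 0%nat)%C by ring.
    eapply Rle_trans; [apply Cmod_triangle|].
    assert (Cmod (cmul g h 0%nat) <= h1 g * M).
    { unfold cmul. rewrite Cmod_mult. apply Rmult_le_compat; auto using Cmod_ge_0. }
    lra. }
  destruct (Rle_lt_dec r s) as [Hrs|Hrs].
  - specialize (Hnear r ltac:(lra)). unfold fefferman. pose proof (exp_pos 4).
    assert (0 <= h1 g * M) by (apply Rmult_le_pos; lra).
    assert (0 <= exp 4 * (h1 g * M)) by (apply Rmult_le_pos; lra). lra.
  - pose proof (beta_increment g h (h1 g) H M 1 s r Bg Hh HM Hgb ltac:(lra) ltac:(lra) ltac:(lra)) as HI.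
    specialize (Hnear s ltac:(lra)).
    replace (beta g h r) with ((beta g h r - beta g h s) + beta g h s)%C by ring.
    eapply Rle_trans; [apply Cmod_triangle|].
    assert (H1 : 0 <= mean1 g s) by (apply mean1_nonneg; [apply Hg | lra]).
    pose proof (Mg r ltac:(lra)) as H2. pose proof (exp_pos 4) as H3.
    assert (H4 : / 1 * (mean1 g r - mean1 g s) + 1 * exp 4 * mean1 g r <= (1 + exp 4) * h1 g).
    { rewrite Rinv_1. assert (exp 4 * mean1 g r <= exp 4 * h1 g) by (apply Rmult_le_compat_l; lra). lra. }
    assert (M * (/ 1 * (mean1 g r - mean1 g s) + 1 * exp 4 * mean1 g r) <= M * ((1 + exp 4) * h1 g))
      by (apply Rmult_le_compat_l; lra).
    unfold fefferman. lra.
Qed.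

Lemma mean1_sup (g : nat -> C) (eps : R) :
  inH1 g -> 0 < eps -> exists r0, 0 < r0 < 1 /\ h1 g - eps < mean1 g r0.
Proof.
  intros Hg He. apply NNPP. intros Hno.
  destruct (inH1_spec g Hg) as [Bg Mg].
  destruct (inH1_intro g (h1 g - eps)) as (_ & _ & H); [apply Hg| |lra].
  intros r Hr. destruct (Req_dec r 0) as [->|Hr0].
  - apply Rle_trans with (mean1 g (1 / 2)); [eapply mean1_mono; eauto; lra|].
    apply Rnot_lt_le. intros Hlt. apply Hno. exists (1 / 2). split; [lra | auto].
  - apply Rnot_lt_le. intros Hlt. apply Hno. exists r. split; [lra | auto].
Qed.

(* The radius depends on [g] only, which is what makes the dilations of [g] converge in norm. *)
Lemma beta_Cauchy (g : nat -> C) (eps : R) :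
  inH1 g -> 0 < eps -> exists r0, 0 < r0 < 1 /\ forall h H M s r,
    l2_le h H -> 0 < M -> (forall z, Cmod z < 1 -> garsia_le h z M) -> r0 <= s <= r -> r < 1 ->
    Cmod (beta g h r - beta g h s) <= M * eps.
Proof.
  intros Hg He. destruct (inH1_spec g Hg) as [Bg Mg].
  pose proof (h1_nonneg g Hg) as Hn. pose proof (exp_pos 4) as Hexp.
  set (K := exp 4 * h1 g + 1). assert (HK : 0 < K) by (unfold K; nra).
  (* First [eta] makes [eta * exp 4 * mean1 g r] small; then [r0] is taken so close to 1 that the
     means grow by at most [eta * (eps / 2)] beyond it, which survives division by [eta]. *)
  set (eta := eps / 2 / K). assert (Heta : 0 < eta) by (repeat apply Rdiv_lt_0_compat; lra).
  assert (Hee : 0 < eta * (eps / 2)) by (apply Rmult_lt_0_compat; lra).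
  destruct (mean1_sup g (eta * (eps / 2)) Hg Hee) as (r0 & Hr0 & Hsup).
  exists r0. split; auto. intros h H M s r Hh HM Hgb Hs Hr.
  pose proof (beta_increment g h (h1 g) H M eta s r Bg Hh HM Hgb Heta ltac:(lra) Hr) as HI.
  eapply Rle_trans; [exact HI|]. apply Rmult_le_compat_l; [lra|].
  assert (H1 : mean1 g r - mean1 g s <= eta * (eps / 2)).
  { pose proof (mean1_mono g (h1 g) r0 s Bg ltac:(lra) ltac:(lra)). pose proof (Mg r ltac:(lra)). lra. }
  assert (H2 : / eta * (mean1 g r - mean1 g s) <= eps / 2).
  { apply Rle_trans with (/ eta * (eta * (eps / 2))); [|right; field; lra].
    apply Rmult_le_compat_l; auto. left. now apply Rinv_0_lt_compat. }
  assert (H3 : eta * exp 4 * mean1 g r <= eps / 2).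
  { apply Rle_trans with (eta * K); [|unfold eta; right; field; lra].
    rewrite Rmult_assoc. apply Rmult_le_compat_l; [lra|]. unfold K.
    pose proof (Mg r ltac:(lra)).
    assert (exp 4 * mean1 g r <= exp 4 * h1 g) by (apply Rmult_le_compat_l; lra). lra. }
  lra.
Qed.

Lemma at_left_1 (r0 : R) (Q : R -> Prop) : r0 < 1 -> (forall r, r0 < r < 1 -> Q r) -> at_left 1 Q.
Proof.
  intros Hr0 H. unfold at_left, within. exists (mkposreal (1 - r0) ltac:(lra)).
  intros y Hy Hy1. apply H. split; auto. unfold ball in Hy. simpl in Hy.
  unfold AbsRing_ball, abs, minus, plus, opp in Hy. simpl in Hy.
  apply Rabs_lt_between in Hy. lra.
Qed.

Lemma beta_limit (g h : nat -> C) (H M : R) :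
  inH1 g -> l2_le h H -> 0 < M -> (forall z, Cmod z < 1 -> garsia_le h z M) ->
  exists L, filterlim (beta g h) (at_left 1) (locally L).
Proof.
  intros Hg Hh HM Hgb.
  apply (filterlim_locally_cauchy (U := C_CompleteNormedModule) (F := at_left 1)).
  intros eps.
  destruct (beta_Cauchy g (eps / 2 / M) Hg) as (r0 & Hr0 & Hc).
  { pose proof (cond_pos eps). repeat apply Rdiv_lt_0_compat; lra. }
  specialize (fun s r => Hc h H M s r Hh HM Hgb).
  assert (E : M * (eps / 2 / M) = eps / 2) by (field; lra). rewrite E in Hc.
  exists (fun r => r0 < r < 1). split; [now apply (at_left_1 r0)|].
  intros u v Hu Hv. apply C_NormedModule_mixin_compat1.
  change (minus (beta g h v) (beta g h u)) with (beta g h v - beta g h u)%C.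
  pose proof (cond_pos eps).
  destruct (Rle_lt_dec u v).
  - specialize (Hc u v ltac:(lra) ltac:(lra)). lra.
  - specialize (Hc v u ltac:(lra) ltac:(lra)).
    replace (beta g h v - beta g h u)%C with (- (beta g h u - beta g h v))%C by ring.
    rewrite Cmod_opp. lra.
Qed.

Lemma cis_opp (r t : R) : cis r (- t) = Cconj (cis r t).
Proof. unfold cis, Cconj. simpl. rewrite cos_neg, sin_neg. f_equal. ring. Qed.

Lemma circle_pairing (g h : nat -> C) (B D r : R) :
  bdd g B -> bdd h D -> 0 <= r < 1 ->
  cmean (fun t => (psum g (cis r t) * psum h (cis r (- t)))%C) = beta g h r.
Proof.
  intros Hg Hh Hr.
  assert (Hz : forall t, Cmod (cis r t) < 1) by (intros; rewrite Cmod_cis, Rabs_pos_eq; lra).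
  rewrite (cmean_ext _ (fun t => (psum g (cis r t) * Cconj (psum (cconj h) (cis r t)))%C)).
  2:{ intros t. rewrite cis_opp, (psum_conj h D), Cconj_conj; auto. }
  pose proof (bdd_conj h D Hh) as Hhc. pose proof (bdd_cmul g h B D Hg Hh) as Hgh.
  assert (HB := bdd_nonneg g B Hg). assert (HD := bdd_nonneg h D Hh).
  assert (Hr2 : 0 <= r ^ 2 < 1) by (simpl; nra).
  (* [K - 1] collects the three error terms of a product of two approximated factors; the last unit
     is for the truncation of [beta]. *)
  set (K := B / (1 - r) + 1 + D / (1 - r) + 1).
  assert (HK1 : 0 <= B / (1 - r)) by (apply Rdiv_le_0_compat; lra).
  assert (HK2 : 0 <= D / (1 - r)) by (apply Rdiv_le_0_compat; lra).
  assert (H0 : Cmod (cmean (fun t => (psum g (cis r t) * Cconj (psum (cconj h) (cis r t)))%C) - beta g h r) = 0).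
  { apply Rle_antisym; [|apply Cmod_ge_0]. apply le_epsilon. intros e He. rewrite Rplus_0_l.
    assert (HK : 0 < K) by (unfold K; lra).
    destruct (small_scale e K He HK) as (d & [Hd Hd1] & Hd2).
    destruct (bdd_unif g B r d Hg Hr Hd) as [N1 HN1].
    destruct (bdd_unif (cconj h) D r d Hhc Hr Hd) as [N2 HN2].
    destruct (bdd_unif (cmul g h) (B * D) (r ^ 2) d Hgh Hr2 Hd) as [N3 HN3].
    set (N := Nat.max N1 (Nat.max N2 N3)).
    specialize (HN1 N ltac:(lia)). specialize (HN2 N ltac:(lia)). specialize (HN3 N ltac:(lia)).
    assert (E : cmean (fun t => (psum_upto g N (cis r t) * Cconj (psum_upto (cconj h) N (cis r t)))%C)
       = psum_upto (cmul g h) N (RtoC (r ^ 2))).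
    { rewrite cmean_psum_upto_conj_psum_upto. apply csum_ext. intros k _. rewrite pow_n_RtoC.
      unfold cconj, cmul. now rewrite Cconj_conj. }
    replace (cmean _ - beta g h r)%C with
      ((cmean (fun t => (psum g (cis r t) * Cconj (psum (cconj h) (cis r t)))%C)
        - cmean (fun t => (psum_upto g N (cis r t) * Cconj (psum_upto (cconj h) N (cis r t)))%C))
       + (psum_upto (cmul g h) N (RtoC (r ^ 2)) - beta g h r))%C by (rewrite E; ring).
    eapply Rle_trans; [apply Cmod_triangle|].
    assert (A1 : Cmod (psum_upto (cmul g h) N (RtoC (r ^ 2)) - beta g h r) <= d).
    { apply HN3. rewrite Cmod_R, Rabs_pos_eq; lra. }
    assert (A2 : Cmod (cmean (fun t => (psum g (cis r t) * Cconj (psum (cconj h) (cis r t)))%C)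
        - cmean (fun t => (psum_upto g N (cis r t) * Cconj (psum_upto (cconj h) N (cis r t)))%C)) <= d * (K - 1)).
    { apply cmean_close.
      - apply ccont_mult; [|apply ccont_conj]; eapply ccont_psum_bdd; eauto.
      - apply ccont_mult; [|apply ccont_conj]; apply ccont_psum_upto.
      - intros t.
        assert (Hzr : Cmod (cis r t) <= r) by (rewrite Cmod_cis, Rabs_pos_eq; lra).
        pose proof (HN1 (cis r t) Hzr) as C1. pose proof (HN2 (cis r t) Hzr) as C2.
        assert (C3 : Cmod (psum g (cis r t)) <= B / (1 - r)).
        { pose proof (bdd_psum_le g B (cis r t) Hg (Hz t)) as Hp.
          rewrite Cmod_cis, Rabs_pos_eq in Hp by lra. exact Hp. }
        assert (C4 : Cmod (psum (cconj h) (cis r t)) <= D / (1 - r)).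
        { pose proof (bdd_psum_le (cconj h) D (cis r t) Hhc (Hz t)) as Hp.
          rewrite Cmod_cis, Rabs_pos_eq in Hp by lra. exact Hp. }
        set (a := psum g (cis r t)) in *. set (b := psum (cconj h) (cis r t)) in *.
        set (a' := psum_upto g N (cis r t)) in *. set (b' := psum_upto (cconj h) N (cis r t)) in *.
        replace (a * Cconj b - a' * Cconj b')%C with
          (- ((a' - a) * Cconj b) - (a * Cconj (b' - b) + (a' - a) * Cconj (b' - b)))%C
          by (rewrite Cminus_conj; ring).
        unfold Cminus at 1. eapply Rle_trans; [apply Cmod_triangle|].
        rewrite !Cmod_opp.
        pose proof (Cmod_triangle (a * Cconj (b' - b))%C ((a' - a) * Cconj (b' - b))%C) as C5.
        rewrite !Cmod_mult, !Cmod_conj in *.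
        pose proof (Cmod_ge_0 a). pose proof (Cmod_ge_0 b).
        pose proof (Cmod_ge_0 (a' - a)%C). pose proof (Cmod_ge_0 (b' - b)%C).
        assert (Cmod (a' - a) * Cmod b <= d * (D / (1 - r))) by (apply Rmult_le_compat; auto).
        assert (Cmod a * Cmod (b' - b) <= B / (1 - r) * d) by (apply Rmult_le_compat; auto).
        assert (Cmod (a' - a) * Cmod (b' - b) <= d * 1) by (apply Rmult_le_compat; lra).
        unfold K. lra. }
    lra. }
  apply Cmod_eq_0 in H0.
  replace (cmean _) with ((cmean (fun t => (psum g (cis r t) * Cconj (psum (cconj h) (cis r t)))%C)
    - beta g h r) + beta g h r)%C by ring.
  rewrite H0. ring.
Qed.

Lemma pairing_lim (g h : nat -> C) (B D : R) (L : C) :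
  bdd g B -> bdd h D -> filterlim (beta g h) (at_left 1) (locally L) -> pairing g h = L.
Proof.
  intros Hg Hh HL. unfold pairing. apply (@C_lim_eq R (at_left 1) (at_left_proper_filter 1)).
  apply filterlim_ext_loc with (beta g h); auto.
  apply (at_left_1 0); [lra|]. intros r Hr.
  rewrite cmean_RInt; [symmetry; apply (circle_pairing g h B D); auto; lra|].
  apply ccont_mult; [eapply ccont_psum_bdd; eauto; lra|].
  assert (Hc : ccont (fun t => psum (cconj h) (cis r t))) by (eapply ccont_psum_bdd; eauto using bdd_conj; lra).
  apply ccont_conj in Hc.
  assert (E : forall t, Cconj (psum (cconj h) (cis r t)) = psum h (cis r (- t))).
  { intros t. rewrite cis_opp, (psum_conj h D), Cconj_conj; auto.
    rewrite Cmod_cis, Rabs_pos_eq; lra. }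
  destruct Hc as [H1 H2]. split.
  - eapply cont_ext; [|exact H1]. intros t. cbv beta. now rewrite E.
  - eapply cont_ext; [|exact H2]. intros t. cbv beta. now rewrite E.
Qed.

Lemma Abel_limit (c : nat -> C) (u : nat -> R) :
  majorized c (RtoC 1) u -> filterlim (fun r => psum c (RtoC (r ^ 2))) (at_left 1) (locally (psum c (RtoC 1))).
Proof.
  intros Hu. apply (C_filterlim (at_left 1)). intros eps He.
  destruct (tail_lim u (eps / 3) (proj1 Hu) ltac:(lra)) as [N HN].
  specialize (HN N ltac:(lia)). apply Rabs_lt_between in HN.
  assert (Hmaj : forall x, 0 <= x <= 1 -> majorized c (RtoC x) u).
  { intros x Hx. destruct Hu as [H1 H2]. split; auto. intros k. specialize (H2 k).
    rewrite Cmod_R, Rabs_pos_eq in * by lra. rewrite pow1 in H2.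
    eapply Rle_trans; [|exact H2]. apply Rmult_le_compat_l; [apply Cmod_ge_0|].
    rewrite <- (pow1 k). apply pow_incr; lra. }
  assert (Hc : continuity_pt (fun r => rsum (fun k => Cmod (c k) * (1 - (r ^ 2) ^ k)) N) 1).
  { apply continuity_pt_filterlim.
    apply (ex_derive_continuous (V := R_NormedModule) (fun r => rsum (fun k => Cmod (c k) * (1 - (r ^ 2) ^ k)) N)).
    clear. induction N as [|N IH]; cbn [rsum].
    - apply ex_derive_const.
    - apply (ex_derive_plus (K := R_AbsRing) (V := R_NormedModule)); auto. auto_derive; auto. }
  destruct (Hc (eps / 3) ltac:(lra)) as [d [Hd HH]].
  apply (at_left_1 (Rmax 0 (1 - d))); [apply Rmax_lub_lt; lra|]. intros r Hr.
  pose proof (Rmax_l 0 (1 - d)). pose proof (Rmax_r 0 (1 - d)).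
  assert (Hr2 : 0 <= r ^ 2 <= 1) by (simpl; nra).
  assert (E1 : rsum (fun k => Cmod (c k) * (1 - (1 ^ 2) ^ k)) N = 0).
  { rewrite (rsum_ext _ (fun _ => 0 * 0)); [rewrite rsum_scal; ring|].
    intros k _. rewrite !pow1. ring. }
  specialize (HH r). simpl in HH. unfold R_dist in HH.
  assert (H1 : Rabs (rsum (fun k => Cmod (c k) * (1 - (r ^ 2) ^ k)) N
     - rsum (fun k => Cmod (c k) * (1 - (1 ^ 2) ^ k)) N) < eps / 3).
  { apply HH. split; [split; [exact I|lra]|]. apply Rabs_lt_between. lra. }
  rewrite E1, Rminus_0_r in H1. apply Rabs_lt_between in H1.
  assert (H2 : Cmod (psum_upto c N (RtoC (r ^ 2)) - psum_upto c N (RtoC 1)) < eps / 3).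
  { unfold psum_upto. rewrite <- csum_minus.
    eapply Rle_lt_trans; [apply (Cmod_csum _ (fun k => Cmod (c k) * (1 - (r ^ 2) ^ k)))|lra].
    intros k _. rewrite !pow_n_RtoC, pow1.
    replace (c k * RtoC ((r ^ 2) ^ k) - c k * 1)%C with (- (c k * RtoC (1 - (r ^ 2) ^ k)))%C
      by (rewrite RtoC_minus; ring).
    rewrite Cmod_opp, Cmod_mult, Cmod_R, Rabs_pos_eq; [lra|].
    assert ((r ^ 2) ^ k <= 1) by (rewrite <- (pow1 k); apply pow_incr; lra). lra. }
  pose proof (psum_approx c (RtoC (r ^ 2)) u N (Hmaj _ Hr2)) as H3.
  pose proof (psum_approx c (RtoC 1) u N Hu) as H4.
  replace (psum c (RtoC (r ^ 2)) - psum c (RtoC 1))%C with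
    (- (psum_upto c N (RtoC (r ^ 2)) - psum c (RtoC (r ^ 2))) + ((psum_upto c N (RtoC (r ^ 2)) - psum_upto c N (RtoC 1))
      + (psum_upto c N (RtoC 1) - psum c (RtoC 1))))%C by ring.
  eapply Rle_lt_trans; [apply Cmod_triangle|].
  pose proof (Cmod_triangle (psum_upto c N (RtoC (r ^ 2)) - psum_upto c N (RtoC 1))%C (psum_upto c N (RtoC 1) - psum c (RtoC 1))%C).
  rewrite Cmod_opp. lra.
Qed.

Lemma majorized_1 (c : nat -> C) : ex_series (fun k => Cmod (c k)) -> majorized c (RtoC 1) (fun k => Cmod (c k)).
Proof. intros H. split; auto. intros k. rewrite Cmod_1, pow1. lra. Qed.

(** Absolute summability removes the radial limit. Pairings that involve some T_n f are all of this
    kind. *)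
Lemma pairing_summable (g h : nat -> C) (B D : R) :
  bdd g B -> bdd h D -> ex_series (fun k => Cmod (cmul g h k)) ->
  pairing g h = psum (cmul g h) (RtoC 1).
Proof.
  intros Hg Hh Hs. apply (pairing_lim g h B D); auto.
  apply (Abel_limit (cmul g h) (fun k => Cmod (cmul g h k))). apply majorized_1; auto.
Qed.

(** * Functionals on the Hardy space *)

(* [h] induces a functional of norm at most [M] on the analytic polynomials of [H^1]. *)
Definition H1_dual_le (h : nat -> C) (M : R) : Prop :=
  forall n q A, (forall r, 0 <= r < 1 -> mean1 (trunc n q) r <= A) ->
    Cmod (csum (cmul q h) n) <= M * A.

Lemma mean1_trunc (q : nat -> C) (n : nat) (r : R) :
  mean1 (trunc n q) r = mean (fun t => Cmod (psum_upto q n (cis r t))).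
Proof. apply mean_ext. intros t. now rewrite psum_trunc. Qed.

(* [p] is the Riesz projection of a smoothed conjugate sign of [G] on the circle of radius [r]. *)
Lemma dual_witness (G : nat -> C) (B r eps : R) :
  bdd G B -> 0 <= r < 1 -> 0 < eps ->
  exists p, (forall k, Cmod (p k) <= r ^ k) /\ H1_dual_le p 1 /\
    mean1 G r - eps <= Cmod (psum (cmul G p) (RtoC 1)).
Proof.
  intros HG Hr He.
  set (w := fun t => psum G (cis r t)).
  assert (Hw : ccont w) by exact (ccont_psum_bdd G B r HG Hr).
  (* The conjugate sign of [w] is discontinuous at its zeros. Dividing by this nonvanishing
     denominator repairs it and lowers the mean of [u * w] by at most [eps]. *)
  set (den := fun t => sqrt (Cmod (w t) ^ 2 + eps ^ 2)).
  assert (Hden0 : forall t, 0 < Cmod (w t) ^ 2 + eps ^ 2).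
  { intros t. pose proof (pow2_ge_0 (Cmod (w t))). pose proof (pow_lt eps 2 He). lra. }
  assert (Hden : forall t, 0 < den t) by (intros t; apply sqrt_lt_R0; auto).
  assert (Hdenc : cont den).
  { apply cont_sqrt, cont_plus; [apply cont_pow, cont_Cmod; auto | apply cont_const]. }
  set (u := fun t => (Cconj (w t) * RtoC (/ den t))%C).
  assert (Hu : ccont u).
  { apply ccont_mult; [apply ccont_conj; auto|]. apply ccont_RtoC, cont_inv; auto.
    intros t. specialize (Hden t). lra. }
  assert (Hden2 : forall t, den t ^ 2 = Cmod (w t) ^ 2 + eps ^ 2).
  { intros t. unfold den. rewrite pow2_sqrt; auto. left; auto. }
  assert (Hdenw : forall t, Cmod (w t) <= den t).
  { intros t. apply Rsqr_incr_0_var; [|left; auto]. unfold Rsqr.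
    pose proof (Hden2 t). pose proof (pow2_ge_0 eps). simpl in *. lra. }
  assert (Hu1 : forall t, Cmod (u t) <= 1).
  { intros t. unfold u. rewrite Cmod_mult, Cmod_conj, Cmod_R, Rabs_pos_eq
      by (left; apply Rinv_0_lt_compat; auto).
    apply Rmult_le_reg_r with (den t); auto. rewrite Rmult_assoc, Rinv_l by (specialize (Hden t); lra).
    rewrite Rmult_1_l, Rmult_1_r. auto. }
  set (p := fun k => cmean (fun t => (u t * pow_n (cis r t) k)%C)).
  assert (Hcp : forall k, ccont (fun t => (u t * pow_n (cis r t) k)%C)).
  { intros k. apply ccont_mult; auto. apply ccont_pow_n_cis. }
  (* The geometric decay makes [p] summable, so that it lies in VMOA; the duality argument for T_n
     relies on this. *)
  assert (Hp : forall k, Cmod (p k) <= r ^ k).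
  { intros k. unfold p. eapply Rle_trans; [apply Cmod_cmean; auto|].
    rewrite <- (mean_const (r ^ k)). apply mean_le; auto using cont_const.
    - apply cont_Cmod; auto.
    - intros t. rewrite Cmod_mult, Cmod_pow_n, Cmod_cis, Rabs_pos_eq by lra.
      rewrite <- (Rmult_1_l (r ^ k)) at 2. apply Rmult_le_compat_r; auto. apply pow_le; lra. }
  assert (Hsum : forall q n, csum (cmul q p) n = cmean (fun t => (u t * psum_upto q n (cis r t))%C)).
  { intros q n.
    rewrite (cmean_ext _ (fun t => csum (fun k => (q k * (u t * pow_n (cis r t) k))%C) n)).
    - rewrite cmean_csum by (intros k; apply ccont_mult; auto using ccont_const).
      apply csum_ext. intros k _. now rewrite cmean_scal by auto.
    - intros t. unfold psum_upto. rewrite <- csum_scal. apply csum_ext. intros; ring. }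
  exists p. split; [auto|split].
  - intros n q A HA. rewrite Hsum, Rmult_1_l.
    eapply Rle_trans; [apply Cmod_cmean, ccont_mult; auto; apply ccont_psum_upto|].
    eapply Rle_trans; [|apply (HA r Hr)]. rewrite mean1_trunc. apply mean_le.
    + apply cont_Cmod, ccont_mult; auto. apply ccont_psum_upto.
    + apply cont_Cmod, ccont_psum_upto.
    + intros t. rewrite Cmod_mult. rewrite <- (Rmult_1_l (Cmod (psum_upto q n (cis r t)))) at 2.
      apply Rmult_le_compat_r; auto. apply Cmod_ge_0.
  - assert (Hmaj : majorized (cmul G p) (RtoC 1) (fun k => B * r ^ k)).
    { split.
      - apply (ex_series_scal_l B (fun k => r ^ k)), ex_series_geom. rewrite Rabs_pos_eq; lra.
      - intros k. rewrite Cmod_1, pow1, Rmult_1_r. unfold cmul. rewrite Cmod_mult.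
        apply Rmult_le_compat; auto using Cmod_ge_0. }
    assert (Elim : psum (cmul G p) (RtoC 1) = cmean (fun t => (u t * w t)%C)).
    { apply psum_unique. intros e Hee.
      destruct (bdd_unif G B r (e / 2) HG Hr ltac:(lra)) as [N HN].
      exists N. intros n Hn. specialize (HN n Hn).
      replace (psum_upto (cmul G p) n (RtoC 1)) with (csum (cmul G p) n).
      2:{ apply csum_ext. intros k _. rewrite pow_n_RtoC, pow1. ring. }
      rewrite Hsum. apply Rle_lt_trans with (e / 2); [|lra]. apply cmean_close.
      - apply ccont_mult; auto. apply ccont_psum_upto.
      - apply ccont_mult; auto.
      - intros t. replace (u t * psum_upto G n (cis r t) - u t * w t)%C
          with (u t * (psum_upto G n (cis r t) - psum G (cis r t)))%C by (unfold w; ring).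
        rewrite Cmod_mult. specialize (HN (cis r t)). rewrite Cmod_cis, Rabs_pos_eq in HN by lra.
        specialize (HN ltac:(lra)). specialize (Hu1 t).
        pose proof (Cmod_ge_0 (u t)). pose proof (Cmod_ge_0 (psum_upto G n (cis r t) - psum G (cis r t))). nra. }
    rewrite Elim. eapply Rle_trans; [|eapply Rle_trans; [apply Rle_abs | apply re_le_Cmod]].
    rewrite cmean_Re. unfold mean1. rewrite <- (mean_const eps).
    rewrite <- mean_minus by (auto using cont_const, cont_Cmod).
    apply mean_le.
    + apply cont_minus; auto using cont_const. apply (cont_Cmod w); auto.
    + apply (ccont_mult u w); auto.
    + intros t. fold (w t). unfold u.
      replace (Cconj (w t) * RtoC (/ den t) * w t)%C with ((w t * Cconj (w t)) * RtoC (/ den t))%C by ring.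
      rewrite z_conj, <- RtoC_mult. simpl Re.
      specialize (Hden t). specialize (Hden2 t). specialize (Hdenw t).
      pose proof (Cmod_ge_0 (w t)). set (x := Cmod (w t)) in *. set (d := den t) in *.
      apply Rmult_le_reg_r with d; auto.
      replace (x * (x * 1) * / d * d) with (x ^ 2) by (field; lra). nra.
Qed.

Lemma csum_window (f : nat -> C) (x : nat -> C) (m J n : nat) :
  (m + J <= n)%nat ->
  csum (fun k => if le_dec m k then (if lt_dec k (m + J) then (x (k - m)%nat * f k)%C else RtoC 0) else RtoC 0) n
  = csum (fun j => (x j * f (m + j)%nat)%C) J.
Proof.
  intros H. replace n with (m + (J + (n - m - J)))%nat by lia.
  rewrite csum_split, csum_split, csum_zero.
  - rewrite (csum_zero (fun k => if le_dec m (m + (J + k)) then _ else _)).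
    + rewrite (csum_ext _ (fun j => (x j * f (m + j)%nat)%C)); [ring|].
      intros k Hk. destruct (le_dec m (m + k)); [|lia]. destruct (lt_dec (m + k) (m + J)); [|lia].
      now replace (m + k - m)%nat with k by lia.
    + intros k _. destruct (le_dec m (m + (J + k))); auto.
      destruct (lt_dec (m + (J + k)) (m + J)); auto. lia.
  - intros k Hk. destruct (le_dec m k); auto. lia.
Qed.

Lemma mean_Cauchy_Schwarz (f g : R -> R) (X : R) :
  cont f -> cont g -> (forall t, 0 <= f t) -> (forall t, 0 <= g t) -> 0 < X ->
  mean (fun t => f t ^ 2) <= X ^ 2 -> mean (fun t => g t ^ 2) <= 1 ->
  mean (fun t => f t * g t) <= X.
Proof.
  intros Hf Hg Hf0 Hg0 HX H1 H2.
  apply Rle_trans with (mean (fun t => / (2 * X) * f t ^ 2 + X / 2 * g t ^ 2)).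
  - apply mean_le.
    + apply cont_mult; auto.
    + apply cont_plus; apply cont_mult; auto using cont_const; apply cont_pow; auto.
    + intros t. assert (E : / (2 * X) * f t ^ 2 + X / 2 * g t ^ 2 - f t * g t
        = / (2 * X) * (f t - X * g t) ^ 2) by (field; lra).
      assert (0 <= / (2 * X) * (f t - X * g t) ^ 2).
      { apply Rmult_le_pos; [left; apply Rinv_0_lt_compat; lra | apply pow2_ge_0]. }
      lra.
  - rewrite mean_plus, !mean_scal; auto using cont_pow;
      try (apply cont_mult; auto using cont_const; apply cont_pow; auto).
    assert (/ (2 * X) * mean (fun t => f t ^ 2) <= / (2 * X) * X ^ 2).
    { apply Rmult_le_compat_l; auto. left; apply Rinv_0_lt_compat; lra. }
    assert (X / 2 * mean (fun t => g t ^ 2) <= X / 2 * 1) by (apply Rmult_le_compat_l; lra).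
    assert (/ (2 * X) * X ^ 2 = X / 2) by (field; lra). lra.
Qed.

(* The test functions [w * x(w) / (1 - z w)], with [x] a polynomial of degree [N], recover the
   Garsia seminorm at [z]; the geometric series is truncated at [J]. *)
Definition garsia_test (N J : nat) (x : nat -> C) (z : C) (k : nat) : C :=
  csum (fun m => (x m * (if le_dec (S m) k then
     (if lt_dec k (S m + J) then (RtoC (sqrt (1 - Cmod z ^ 2)) * pow_n z (k - S m))%C else RtoC 0)
     else RtoC 0))%C) N.

Lemma csum_garsia_test (N J : nat) (x : nat -> C) (z : C) (f : nat -> C) :
  csum (fun k => (garsia_test N J x z k * f k)%C) (N + J)
  = csum (fun m => (x m * (RtoC (sqrt (1 - Cmod z ^ 2)) * csum (fun j => (pow_n z j * f (S m + j)%nat)%C) J))%C) N.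
Proof.
  unfold garsia_test.
  rewrite (csum_ext _ (fun k => csum (fun m => (x m * (if le_dec (S m) k then
     (if lt_dec k (S m + J) then ((RtoC (sqrt (1 - Cmod z ^ 2)) * pow_n z (k - S m)) * f k)%C else RtoC 0)
     else RtoC 0))%C) N)).
  - rewrite csum_switch. apply csum_ext. intros m Hm. rewrite csum_scal. f_equal.
    rewrite (csum_window f (fun j => (RtoC (sqrt (1 - Cmod z ^ 2)) * pow_n z j)%C) (S m) J (N + J)) by lia.
    rewrite <- csum_scal. apply csum_ext. intros; ring.
  - intros k _. rewrite Cmult_comm, <- csum_scal. apply csum_ext. intros m _.
    destruct (le_dec (S m) k); [destruct (lt_dec k (S m + J))|]; ring.
Qed.

(** The test polynomial factors as [w * x(w) * y(w)], where [y] is the truncated kernel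
    [sqrt (1 - |z|^2) / (1 - z w)], of l^2 norm at most 1. Cauchy-Schwarz and Parseval on the circle
    conclude. *)
Lemma mean1_garsia_test (N J : nat) (x : nat -> C) (z : C) (X r : R) :
  Cmod z < 1 -> 0 < X -> rsum (fun m => Cmod (x m) ^ 2) N <= X ^ 2 -> 0 <= r < 1 ->
  mean1 (trunc (N + J) (garsia_test N J x z)) r <= X.
Proof.
  intros Hz HX Hx Hr. rewrite mean1_trunc. pose proof (Cmod_ge_0 z) as Hz0.
  set (sg := sqrt (1 - Cmod z ^ 2)).
  assert (Hsg : sg ^ 2 = 1 - Cmod z ^ 2) by (apply pow2_sqrt; nra).
  assert (Hsg0 : 0 <= sg) by apply sqrt_pos.
  set (y := fun j => (RtoC sg * pow_n z j)%C).
  assert (E : forall w, psum_upto (garsia_test N J x z) (N + J) w = (w * (psum_upto x N w * psum_upto y J w))%C).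
  { intros w. unfold psum_upto at 1. rewrite csum_garsia_test. fold sg. unfold psum_upto.
    replace (w * (csum (fun k => (x k * pow_n w k)%C) N * csum (fun k => (y k * pow_n w k)%C) J))%C
      with ((w * csum (fun k => (y k * pow_n w k)%C) J) * csum (fun k => (x k * pow_n w k)%C) N)%C by ring.
    rewrite <- csum_scal. apply csum_ext. intros m _.
    replace (w * csum (fun k => (y k * pow_n w k)%C) J * (x m * pow_n w m))%C
      with (x m * ((w * pow_n w m) * csum (fun k => (y k * pow_n w k)%C) J))%C by ring.
    f_equal. rewrite <- !csum_scal. apply csum_ext. intros j _. unfold y.
    rewrite pow_n_add, pow_n_S. ring. }
  apply Rle_trans with (mean (fun t => Cmod (psum_upto x N (cis r t)) * Cmod (psum_upto y J (cis r t)))).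
  - apply mean_le.
    + apply cont_Cmod, ccont_psum_upto.
    + apply cont_mult; apply cont_Cmod, ccont_psum_upto.
    + intros t. rewrite E, !Cmod_mult, Cmod_cis, Rabs_pos_eq by lra.
      assert (0 <= Cmod (psum_upto x N (cis r t)) * Cmod (psum_upto y J (cis r t)))
        by (apply Rmult_le_pos; apply Cmod_ge_0).
      nra.
  - assert (Hpow : forall k, 0 <= (r ^ 2) ^ k <= 1).
    { intros k. split; [apply pow_le, pow2_ge_0|]. rewrite <- (pow1 k). apply pow_incr. simpl; nra. }
    apply mean_Cauchy_Schwarz; auto; try (apply cont_Cmod, ccont_psum_upto); try (intros; apply Cmod_ge_0).
    + rewrite Parseval_psum_upto. eapply Rle_trans; [|exact Hx]. apply rsum_le. intros k _.
      specialize (Hpow k). pose proof (pow2_ge_0 (Cmod (x k))). nra.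
    + rewrite Parseval_psum_upto.
      apply Rle_trans with (rsum (fun k => sg ^ 2 * (Cmod z ^ 2) ^ k) J).
      * apply rsum_le. intros k _. unfold y.
        rewrite Cmod_mult, Cmod_R, Cmod_pow_n, Rabs_pos_eq by auto.
        rewrite Rpow_mult_distr, <- !pow_mult, (Nat.mul_comm k 2), !pow_mult.
        specialize (Hpow k). pose proof (pow2_ge_0 sg).
        assert (0 <= (Cmod z ^ 2) ^ k) by (apply pow_le, pow2_ge_0).
        assert (0 <= sg ^ 2 * (Cmod z ^ 2) ^ k) by (apply Rmult_le_pos; auto). nra.
      * rewrite rsum_scal, Hsg, rsum_geom.
        assert (0 <= (Cmod z ^ 2) ^ J) by (apply pow_le, pow2_ge_0). lra.
Qed.

(** Testing with the conjugates of the first [N] Garsia coefficients gives, as [J] grows,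
    [T <= M * sqrt T] for the sum [T] of their squared moduli. *)
Lemma H1_dual_le_garsia_le (h : nat -> C) (B M : R) (z : C) :
  bdd h B -> 0 <= M -> H1_dual_le h M -> Cmod z < 1 -> garsia_le h z M.
Proof.
  intros Hh HM HA Hz. split; auto. intros N.
  set (x := fun m => Cconj (garsia_coef h z m)).
  set (T := rsum (fun k => Cmod (garsia_coef h z k) ^ 2) N).
  assert (HT : 0 <= T) by (apply rsum_nonneg; intros; apply pow2_ge_0).
  destruct (Rle_lt_or_eq_dec _ _ HT) as [HT'|<-]; [|apply pow2_ge_0].
  set (X := sqrt T). assert (HX : 0 < X) by (apply sqrt_lt_R0; auto).
  assert (HX2 : X ^ 2 = T) by (apply pow2_sqrt; auto).
  assert (Hx : rsum (fun m => Cmod (x m) ^ 2) N <= X ^ 2).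
  { rewrite HX2. right. apply rsum_ext. intros k _. unfold x. now rewrite Cmod_conj. }
  assert (HJ : forall J, Cmod (csum (fun m => (x m * (RtoC (sqrt (1 - Cmod z ^ 2)) * psum_upto (shift (S m) h) J z))%C) N) <= M * X).
  { intros J. replace (csum _ N) with (csum (cmul (garsia_test N J x z) h) (N + J)).
    - apply HA. intros r Hr. apply mean1_garsia_test; auto.
    - unfold cmul. rewrite csum_garsia_test. apply csum_ext. intros m _. unfold psum_upto, shift.
      repeat f_equal. apply functional_extensionality. intros j. ring. }
  assert (Hlim : T <= M * X).
  { apply le_epsilon. intros eps He.
    assert (Hc : exists J, Cmod (csum (fun m => (x m * (RtoC (sqrt (1 - Cmod z ^ 2)) * psum_upto (shift (S m) h) J z))%C) N
        - RtoC T) <= eps).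
    { set (K := rsum (fun m => Cmod (x m)) N + 1).
      assert (HK : 0 < K) by (pose proof (rsum_nonneg (fun m => Cmod (x m)) N (fun k _ => Cmod_ge_0 _)); unfold K; lra).
      assert (HeK : 0 < eps / K) by (apply Rdiv_lt_0_compat; auto).
      assert (HN : forall n, exists J, forall m, (m < n)%nat ->
         forall j, (J <= j)%nat -> Cmod (psum_upto (shift (S m) h) j z - psum (shift (S m) h) z) <= eps / K).
      { induction n as [|n [J1 HJ1]]; [exists 0%nat; intros; lia|].
        destruct (psum_lim (shift (S n) h) z (bdd_ex _ B z (bdd_shift h B (S n) Hh) Hz) _ HeK) as [J2 HJ2].
        exists (Nat.max J1 J2). intros m Hm j Hj. destruct (Nat.eq_dec m n) as [->|Hne].
        - left. apply HJ2. lia.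
        - apply HJ1; lia. }
      destruct (HN N) as [J HJ']. exists J.
      unfold T. rewrite RtoC_rsum, <- csum_minus.
      eapply Rle_trans; [apply (Cmod_csum _ (fun m => eps / K * Cmod (x m)))|].
      - intros m Hm. specialize (HJ' m Hm J ltac:(lia)).
        assert (E : RtoC (Cmod (garsia_coef h z m) ^ 2) = (x m * garsia_coef h z m)%C)
          by (unfold x; rewrite Cmult_comm; symmetry; apply z_conj).
        rewrite E. unfold garsia_coef at 1.
        replace (x m * (RtoC (sqrt (1 - Cmod z ^ 2)) * psum_upto (shift (S m) h) J z) -
          x m * (RtoC (sqrt (1 - Cmod z ^ 2)) * psum (shift (S m) h) z))%C with
          (x m * (RtoC (sqrt (1 - Cmod z ^ 2)) * (psum_upto (shift (S m) h) J z - psum (shift (S m) h) z)))%C by ring.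
        rewrite !Cmod_mult, Cmod_R, Rabs_pos_eq by apply sqrt_pos.
        assert (Hs1 : sqrt (1 - Cmod z ^ 2) <= 1).
        { rewrite <- sqrt_1 at 2. apply sqrt_le_1_alt. pose proof (pow2_ge_0 (Cmod z)). lra. }
        pose proof (sqrt_pos (1 - Cmod z ^ 2)). pose proof (Cmod_ge_0 (x m)).
        pose proof (Cmod_ge_0 (psum_upto (shift (S m) h) J z - psum (shift (S m) h) z)).
        rewrite (Rmult_comm (eps / K)). apply Rmult_le_compat_l; auto.
        rewrite <- (Rmult_1_l (eps / K)). apply Rmult_le_compat; auto.
      - rewrite rsum_scal. apply Rle_trans with (eps / K * K); [|right; field; lra].
        apply Rmult_le_compat_l; [left; auto | unfold K; lra]. }
    destruct Hc as [J Hc]. specialize (HJ J). set (S := csum _ N) in *.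
    replace T with (Cmod (RtoC T)) by (rewrite Cmod_R; apply Rabs_pos_eq; auto).
    replace (RtoC T) with (S - (S - RtoC T))%C by ring. unfold Cminus at 1.
    eapply Rle_trans; [apply Cmod_triangle|]. rewrite Cmod_opp. lra. }
  fold T. rewrite <- HX2 in Hlim.
  assert (HXM : X <= M) by (apply Rmult_le_reg_r with X; auto; simpl in Hlim; lra).
  rewrite <- HX2. apply pow_incr. lra.
Qed.

Lemma H1_dual_le_coef (h : nat -> C) (M : R) (k : nat) : H1_dual_le h M -> Cmod (h k) <= M.
Proof.
  intros HA.
  set (q := fun j => if Nat.eq_dec j k then RtoC 1 else RtoC 0).
  specialize (HA (S k) q 1).
  assert (E : csum (cmul q h) (S k) = h k).
  { unfold cmul, q. rewrite (csum_ext _ (fun j => if Nat.eq_dec j k then h j else RtoC 0)).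
    - rewrite (csum_delta h k (S k)). destruct (lt_dec k (S k)); [auto|lia].
    - intros j _. destruct (Nat.eq_dec j k); ring. }
  rewrite E, Rmult_1_r in HA. apply HA. intros r Hr. rewrite mean1_trunc.
  rewrite <- (mean_const 1). apply mean_le; [apply cont_Cmod, ccont_psum_upto | apply cont_const|].
  intros t. unfold psum_upto. rewrite (csum_ext _ (fun j => if Nat.eq_dec j k then pow_n (cis r t) j else RtoC 0)).
  - rewrite (csum_delta (fun j => pow_n (cis r t) j) k (S k)). destruct (lt_dec k (S k)); [|lia].
    rewrite Cmod_pow_n, Cmod_cis, Rabs_pos_eq by lra.
    rewrite <- (pow1 k). apply pow_incr; lra.
  - intros j _. unfold q. destruct (Nat.eq_dec j k); ring.
Qed.

Lemma garsia_coef_0 (h : nat -> C) (m : nat) : garsia_coef h (RtoC 0) m = h (S m).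
Proof.
  unfold garsia_coef. rewrite psum_0, Cmod_0. unfold shift. rewrite Nat.add_0_r.
  replace (1 - 0 ^ 2) with 1 by ring. rewrite sqrt_1. ring.
Qed.

Lemma garsia_le_0_l2_le (h : nat -> C) (M : R) : garsia_le h (RtoC 0) M -> Cmod (h 0%nat) <= M -> l2_le h (2 * M).
Proof.
  intros [HM H] H0. split; [lra|]. intros n. destruct n as [|n]; [simpl; nra|].
  rewrite rsum_shift. specialize (H n).
  rewrite (rsum_ext _ (fun k => Cmod (h (S k)) ^ 2)) in H by (intros; now rewrite garsia_coef_0).
  pose proof (pow_incr (Cmod (h 0%nat)) M 2 (conj (Cmod_ge_0 _) H0)). nra.
Qed.

Lemma H1_dual_le_l2_le (h : nat -> C) (M : R) : H1_dual_le h M -> l2_le h (2 * M).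
Proof.
  intros HA. assert (Hb : bdd h M) by (intros k; apply H1_dual_le_coef; auto).
  apply garsia_le_0_l2_le; auto.
  apply (H1_dual_le_garsia_le h M); auto; [eapply bdd_nonneg; eauto | rewrite Cmod_0; lra].
Qed.

(** * Density of the dilations *)

Definition dil (r : R) (g : nat -> C) (k : nat) : C := (g k * RtoC (r ^ k))%C.

Lemma bdd_dil (g : nat -> C) (B r : R) : bdd g B -> 0 <= r <= 1 -> bdd (dil r g) B.
Proof.
  intros Hg Hr k. unfold dil. rewrite Cmod_mult, Cmod_R, Rabs_pos_eq by (apply pow_le; lra).
  rewrite <- (Rmult_1_r B). apply Rmult_le_compat; auto using Cmod_ge_0.
  - apply pow_le; lra.
  - rewrite <- (pow1 k). apply pow_incr; lra.
Qed.

Lemma psum_dil (c : nat -> C) (r : R) (z : C) : psum (dil r c) z = psum c (RtoC r * z)%C.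
Proof.
  unfold psum. f_equal. f_equal. f_equal. apply functional_extensionality. intros k.
  unfold dil. rewrite <- pow_n_RtoC. rewrite <- Cmult_assoc. f_equal.
  induction k as [|k IH]; [unfold pow_n, one; simpl; ring|].
  rewrite !pow_n_S, <- IH. ring.
Qed.

(** Against the witness [p] of [dual_witness], the difference of two dilations pairs to an increment
    of [beta g p], and [beta_Cauchy] is uniform in [p]. The dilation factors are squares because
    [beta] at radius [r] carries [r ^ (2 k)]. *)
Lemma dil_increment (g : nat -> C) (eps : R) :
  inH1 g -> 0 < eps -> exists s0, 0 < s0 < 1 /\ forall s r x, s0 <= s <= r -> r < 1 -> 0 <= x < 1 ->
    mean1 (csub (dil (r ^ 2) g) (dil (s ^ 2) g)) x <= eps.
Proof.
  intros Hg He. destruct (inH1_spec g Hg) as [Bg Mg]. pose proof (h1_nonneg g Hg) as Hn.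
  destruct (beta_Cauchy g eps Hg He) as (r0 & Hr0 & HC).
  exists r0. split; auto. intros s r x Hs Hr Hx.
  assert (Hr2 : 0 <= r ^ 2 <= 1) by (simpl; nra). assert (Hs2 : 0 <= s ^ 2 <= 1) by (simpl; nra).
  set (G := csub (dil (r ^ 2) g) (dil (s ^ 2) g)).
  assert (HG : bdd G (h1 g + h1 g)) by (apply bdd_sub; apply bdd_dil; auto).
  apply le_epsilon. intros d Hd.
  destruct (dual_witness G _ x d HG Hx Hd) as (p & Hp1 & Hp2 & Hp3).
  enough (Hle : Cmod (psum (cmul G p) (RtoC 1)) <= eps) by lra.
  assert (Hpb : bdd p 1) by (intros k; apply H1_dual_le_coef; auto).
  assert (E : psum (cmul G p) (RtoC 1) = (beta g p r - beta g p s)%C).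
  { unfold beta. rewrite <- (Cmult_1_r (RtoC (r ^ 2))), <- (Cmult_1_r (RtoC (s ^ 2))), <- !psum_dil.
    assert (Hex : forall y, 0 <= y <= 1 -> ex_series (fun k => (dil y (cmul g p) k * pow_n (RtoC 1) k)%C)).
    { intros y Hy. apply (ex_series_majorized _ _ (fun k => h1 g * x ^ k)). split.
      - apply (ex_series_scal_l (h1 g) (fun k => x ^ k)), ex_series_geom. rewrite Rabs_pos_eq; lra.
      - intros k. rewrite Cmod_1, pow1, Rmult_1_r.
        unfold dil, cmul. rewrite !Cmod_mult, Cmod_R, Rabs_pos_eq by (apply pow_le; lra).
        assert (y ^ k <= 1) by (rewrite <- (pow1 k); apply pow_incr; lra).
        assert (0 <= y ^ k) by (apply pow_le; lra).
        assert (Cmod (g k) * Cmod (p k) <= h1 g * x ^ k) by (apply Rmult_le_compat; auto using Cmod_ge_0).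
        assert (0 <= Cmod (g k) * Cmod (p k)) by (apply Rmult_le_pos; apply Cmod_ge_0). nra. }
    replace (cmul G p) with (cadd (dil (r ^ 2) (cmul g p)) (cscal (RtoC (-1)) (dil (s ^ 2) (cmul g p)))).
    - rewrite psum_plus, psum_scal; auto.
      + ring.
      + assert (Hsc : ex_series (fun k => scal (RtoC (-1)) (dil (s ^ 2) (cmul g p) k * pow_n (RtoC 1) k)%C))
          by (apply (ex_series_scal_l (K := C_AbsRing) (V := C_NormedModule) (RtoC (-1))); auto).
        eapply ex_series_ext; [|exact Hsc]. intros k. unfold cscal, scal; simpl. unfold mult; simpl. ring.
    - apply functional_extensionality. intros k. unfold G, cmul, csub, cadd, cscal, dil. ring. }
  rewrite E.
  assert (Hgb : forall z, Cmod z < 1 -> garsia_le p z 1) by (intros z Hz; apply (H1_dual_le_garsia_le p 1); auto; lra).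
  rewrite <- (Rmult_1_l eps). apply (HC p (2 * 1) 1); auto; [apply H1_dual_le_l2_le; auto | lra].
Qed.

Lemma pow_close_1 (k : nat) (eps : R) :
  0 < eps -> exists d, 0 < d /\ forall r, 1 - d < r <= 1 -> 1 - eps < r ^ k.
Proof.
  intros He.
  assert (Hc : continuity_pt (fun r => r ^ k) 1).
  { apply continuity_pt_filterlim.
    apply (ex_derive_continuous (V := R_NormedModule) (fun r => r ^ k)). auto_derive; auto. }
  destruct (Hc eps He) as [d [Hd HH]]. exists d. split; auto. intros r Hr.
  destruct (Req_dec r 1) as [->|Hne]; [rewrite pow1; lra|].
  specialize (HH r). simpl in HH. unfold R_dist in HH.
  assert (H : Rabs (r ^ k - 1 ^ k) < eps).
  { apply HH. split; [split; [exact I|lra]|]. apply Rabs_lt_between; lra. }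
  rewrite pow1 in H. apply Rabs_lt_between in H. lra.
Qed.

(** The outer radius in [dil_increment] tends to 1; [mean1_lsc] passes the bound on to the limit [g]
    itself. *)
Lemma dil_close (g : nat -> C) (eps : R) :
  inH1 g -> 0 < eps -> exists r, 0 < r < 1 /\ h1 (csub g (dil r g)) <= eps.
Proof.
  intros Hg He. destruct (dil_increment g eps Hg He) as (s & Hs & H).
  destruct (inH1_spec g Hg) as [Bg Mg].
  exists (s ^ 2). assert (Hs2 : 0 < s ^ 2 < 1) by (simpl; nra). split; auto.
  (* Any sequence in [[s, 1)] with limit 1 would do. *)
  set (rr := fun i => 1 - (1 - s) / (INR i + 1)).
  assert (Hrr : forall i, s <= rr i < 1).
  { intros i. unfold rr. pose proof (pos_INR i).
    assert (0 < (1 - s) / (INR i + 1)) by (apply Rdiv_lt_0_compat; lra).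
    assert ((1 - s) / (INR i + 1) <= 1 - s).
    { apply Rmult_le_reg_r with (INR i + 1); [lra|]. unfold Rdiv. rewrite Rmult_assoc, Rinv_l by lra. nra. }
    lra. }
  assert (Hlim : forall k e, 0 < e -> exists I, forall i, (I <= i)%nat ->
     Cmod (csub (dil (rr i ^ 2) g) (dil (s ^ 2) g) k - csub g (dil (s ^ 2) g) k) < e).
  { intros k e Hee. pose proof (bdd_nonneg g _ Bg) as HB.
    destruct (pow_close_1 (2 * k) (e / (h1 g + 1)) ltac:(apply Rdiv_lt_0_compat; lra)) as (d & Hd & HH).
    destruct (nfloor_ex (/ d) ltac:(left; now apply Rinv_0_lt_compat)) as [I HI].
    exists I. intros i Hi.
    assert (Hri : 1 - d < rr i).
    { unfold rr. apply le_INR in Hi. pose proof (Rinv_0_lt_compat d Hd).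
      assert ((1 - s) / (INR i + 1) < d); [|lra].
      apply Rmult_lt_reg_r with (INR i + 1); [lra|]. unfold Rdiv. rewrite Rmult_assoc, Rinv_l by lra.
      assert (d * / d < d * (INR i + 1)) by (apply Rmult_lt_compat_l; lra).
      rewrite Rinv_r in * by lra. lra. }
    specialize (HH (rr i) ltac:(specialize (Hrr i); lra)).
    unfold csub, dil.
    replace (g k * RtoC ((rr i ^ 2) ^ k) - g k * RtoC ((s ^ 2) ^ k) - (g k - g k * RtoC ((s ^ 2) ^ k)))%C
      with (- (g k * RtoC (1 - (rr i ^ 2) ^ k)))%C by (rewrite RtoC_minus; ring).
    rewrite <- pow_mult. rewrite Cmod_opp, Cmod_mult, Cmod_R.
    assert (Hle1 : rr i ^ (2 * k) <= 1).
    { rewrite <- (pow1 (2 * k)). apply pow_incr. specialize (Hrr i). lra. }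
    rewrite Rabs_pos_eq by lra.
    apply Rle_lt_trans with ((h1 g) * (1 - rr i ^ (2 * k))).
    - apply Rmult_le_compat_r; [lra | apply Bg].
    - apply Rlt_le_trans with ((h1 g + 1) * (e / (h1 g + 1))); [|right; field; lra].
      apply Rle_lt_trans with ((h1 g + 1) * (1 - rr i ^ (2 * k))); [nra|].
      apply Rmult_lt_compat_l; lra. }
  assert (Hb : forall i, bdd (csub (dil (rr i ^ 2) g) (dil (s ^ 2) g)) (h1 g + h1 g)).
  { intros i. apply bdd_sub; apply bdd_dil; auto; try lra. specialize (Hrr i). simpl; nra. }
  assert (Hx : forall x, 0 <= x < 1 -> bdd (csub g (dil (s ^ 2) g)) (h1 g + h1 g) /\
     mean1 (csub g (dil (s ^ 2) g)) x <= eps).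
  { intros x Hx. apply (mean1_lsc (fun i => csub (dil (rr i ^ 2) g) (dil (s ^ 2) g))); auto.
    intros i. apply H; auto; specialize (Hrr i); lra. }
  apply inH1_intro.
  - eapply bdd_holo. apply (Hx 0). lra.
  - intros x Hx'. apply Hx; auto.
Qed.

Lemma summable_bdd (c : nat -> C) : ex_series (fun k => Cmod (c k)) -> bdd c (Series (fun k => Cmod (c k))).
Proof.
  intros Hs k. assert (Hp : forall k, 0 <= Cmod (c k)) by (intros; apply Cmod_ge_0).
  eapply Rle_trans; [|apply (rsum_le_Series _ (S k) Hp Hs)]. cbn [rsum].
  pose proof (rsum_nonneg _ k (fun j _ => Hp j)). lra.
Qed.

Lemma inH1_summable (c : nat -> C) :
  ex_series (fun k => Cmod (c k)) -> inH1 c /\ is_finite (H1norm c) /\ h1 c <= Series (fun k => Cmod (c k)).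
Proof.
  intros Hs. assert (Hp : forall k, 0 <= Cmod (c k)) by (intros; apply Cmod_ge_0).
  pose proof (summable_bdd c Hs) as Hb.
  apply inH1_intro; [eapply bdd_holo; eauto|]. intros r Hr.
  assert (Hc : ccont (fun t => psum c (cis r t))) by (eapply ccont_psum_bdd; eauto).
  rewrite <- (mean_const (Series (fun k => Cmod (c k)))). apply mean_le; auto using cont_const, cont_Cmod.
  intros t.
  assert (Hz : Cmod (cis r t) < 1) by (rewrite Cmod_cis, Rabs_pos_eq; lra).
  apply le_epsilon. intros e He.
  destruct (psum_lim c (cis r t) (bdd_ex c _ _ Hb Hz) e He) as [N HN]. specialize (HN N ltac:(lia)).
  pose proof (Cmod_psum_upto_le c N (cis r t) ltac:(lra)).
  pose proof (rsum_le_Series _ N Hp Hs).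
  replace (psum c (cis r t)) with (psum_upto c N (cis r t) - (psum_upto c N (cis r t) - psum c (cis r t)))%C by ring.
  unfold Cminus at 1. eapply Rle_trans; [apply Cmod_triangle|]. rewrite Cmod_opp. lra.
Qed.

(** * The Poisson integral of the squared modulus *)

Lemma cis_neq (z : C) (t : R) : Cmod z < 1 -> 0 < Cmod (cis 1 t - z).
Proof.
  intros Hz. pose proof (Cmod_triangle (cis 1 t - z) z) as H.
  replace (cis 1 t - z + z)%C with (cis 1 t) in H by ring.
  rewrite Cmod_cis, Rabs_R1 in H. lra.
Qed.

Lemma poisson_mult (z : C) (t : R) :
  Cmod z < 1 -> poisson z t * Cmod (cis 1 t - z) ^ 2 = 1 - Cmod z ^ 2.
Proof. intros Hz. pose proof (cis_neq z t Hz). unfold poisson. field. lra. Qed.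

Lemma ccont_cis1 (r : R) : ccont (cis r).
Proof. split; simpl; apply cont_of_ex_derive; intros t; auto_derive; auto. Qed.

Lemma cont_poisson (z : C) : Cmod z < 1 -> cont (poisson z).
Proof.
  intros Hz. unfold poisson, Rdiv. apply cont_mult; [apply cont_const|].
  apply cont_inv.
  - apply cont_pow, cont_Cmod, ccont_minus; [apply ccont_cis1 | apply ccont_const].
  - intros t. apply pow_nonzero. pose proof (cis_neq z t Hz). lra.
Qed.

Lemma poisson_nonneg (z : C) (t : R) : Cmod z < 1 -> 0 <= poisson z t.
Proof.
  intros Hz. pose proof (cis_neq z t Hz). pose proof (Cmod_ge_0 z).
  unfold poisson. apply Rdiv_le_0_compat; [simpl; nra | apply pow_lt; auto].
Qed.

(** On the circle this is [(1 - |z|^2) w / (1 - conj z w)], by [poisson_diff_eq]: an analytic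
    function vanishing at the origin. Its means against nonnegative powers of [w] are therefore
    zero. *)
Definition poisson_diff (z : C) (t : R) : C := (RtoC (poisson z t) * (cis 1 t - z))%C.

Lemma ccont_poisson_diff (z : C) : Cmod z < 1 -> ccont (poisson_diff z).
Proof.
  intros Hz. apply ccont_mult.
  - apply ccont_RtoC, cont_poisson; auto.
  - apply ccont_minus; [apply ccont_cis1 | apply ccont_const].
Qed.

Lemma cis1_conj (t : R) : (cis 1 t * Cconj (cis 1 t))%C = RtoC 1.
Proof. rewrite z_conj, Cmod_cis, Rabs_R1. f_equal. ring. Qed.

Lemma poisson_diff_eq (z : C) (t : R) :
  Cmod z < 1 -> (poisson_diff z t * (1 - Cconj z * cis 1 t))%C = (RtoC (1 - Cmod z ^ 2) * cis 1 t)%C.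
Proof.
  intros Hz. unfold poisson_diff.
  replace (1 - Cconj z * cis 1 t)%C with (cis 1 t * Cconj (cis 1 t - z))%C.
  - rewrite <- (poisson_mult z t Hz), RtoC_mult, <- z_conj. ring.
  - rewrite Cminus_conj. rewrite <- (cis1_conj t). ring.
Qed.

Lemma poisson_diff_bound (z : C) (t : R) : Cmod z < 1 -> Cmod (poisson_diff z t) <= 2.
Proof.
  intros Hz. pose proof (cis_neq z t Hz) as H. pose proof (Cmod_ge_0 z).
  unfold poisson_diff. rewrite Cmod_mult, Cmod_R, Rabs_pos_eq by (apply poisson_nonneg; auto).
  unfold poisson. set (d := Cmod (cis 1 t - z)) in *.
  replace ((1 - Cmod z ^ 2) / d ^ 2 * d) with ((1 - Cmod z ^ 2) / d) by (field; lra).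
  assert (Hd : 1 - Cmod z <= d).
  { pose proof (Cmod_triangle (cis 1 t - z) z) as H1.
    replace (cis 1 t - z + z)%C with (cis 1 t) in H1 by ring.
    rewrite Cmod_cis, Rabs_R1 in H1. unfold d. lra. }
  apply Rmult_le_reg_r with d; auto. unfold Rdiv. rewrite Rmult_assoc, Rinv_l by lra. nra.
Qed.

(* The means [J m] on the left are bounded and satisfy [J m = conj z * J (m + 1)]. *)
Lemma cmean_poisson_diff (z : C) (m : nat) :
  Cmod z < 1 -> cmean (fun t => (poisson_diff z t * pow_n (cis 1 t) m)%C) = RtoC 0.
Proof.
  intros Hz.
  set (J := fun m => cmean (fun t => (poisson_diff z t * pow_n (cis 1 t) m)%C)).
  assert (Hcm : forall m, ccont (fun t => (poisson_diff z t * pow_n (cis 1 t) m)%C))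
    by (intros; apply ccont_mult; [apply ccont_poisson_diff; auto | apply ccont_pow_n_cis]).
  assert (Hrec : forall m, J m = (Cconj z * J (S m))%C).
  { intros k. unfold J. rewrite <- cmean_scal by auto.
    assert (E : cmean (fun t => (poisson_diff z t * pow_n (cis 1 t) k)%C)
      = cmean (fun t => (Cconj z * (poisson_diff z t * pow_n (cis 1 t) (S k))
          + RtoC (1 - Cmod z ^ 2) * pow_n (cis 1 t) (S k))%C)).
    { apply cmean_ext. intros t. rewrite pow_n_S.
      replace (RtoC (1 - Cmod z ^ 2) * (cis 1 t * pow_n (cis 1 t) k))%C
        with ((RtoC (1 - Cmod z ^ 2) * cis 1 t) * pow_n (cis 1 t) k)%C by ring.
      rewrite <- poisson_diff_eq by auto. ring. }
    rewrite E, cmean_plus.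
    - rewrite (cmean_scal (RtoC (1 - Cmod z ^ 2))) by apply ccont_pow_n_cis.
      rewrite cmean_pow_n. destruct (Nat.eq_dec (S k) 0); [lia|]. ring.
    - apply ccont_mult; auto using ccont_const.
    - apply ccont_mult; auto using ccont_const, ccont_pow_n_cis. }
  assert (Hb : forall m, Cmod (J m) <= 2).
  { intros k. unfold J. eapply Rle_trans; [apply Cmod_cmean; auto|].
    rewrite <- (mean_const 2). apply mean_le; auto using cont_const.
    - apply cont_Cmod; auto.
    - intros t. rewrite Cmod_mult, Cmod_pow_n, Cmod_cis, Rabs_R1, pow1, Rmult_1_r.
      apply poisson_diff_bound; auto. }
  assert (Hit : forall n, Cmod (J m) <= 2 * Cmod z ^ n).
  { assert (Hit : forall n k, Cmod (J k) <= 2 * Cmod z ^ n).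
    { induction n as [|n IH]; intros k; [simpl; rewrite Rmult_1_r; auto|].
      rewrite Hrec, Cmod_mult, Cmod_conj. simpl. specialize (IH (S k)). pose proof (Cmod_ge_0 z). nra. }
    auto. }
  apply Cmod_eq_0. apply Rle_antisym; [|apply Cmod_ge_0].
  apply le_epsilon. intros e He. rewrite Rplus_0_l.
  destruct (pow_lt_1_zero (Cmod z) ltac:(rewrite Rabs_pos_eq; auto using Cmod_ge_0) (e / 2) ltac:(lra)) as [N HN].
  specialize (HN N ltac:(lia)). rewrite Rabs_pos_eq in HN by (apply pow_le, Cmod_ge_0).
  specialize (Hit N). unfold J in Hit. lra.
Qed.

(** The mean [I] of the kernel and its first moment [A] satisfy [A = z * I] and
    [I - z * conj A = 1 - |z|^2]. Eliminating [A] leaves [(1 - |z|^2) * I = 1 - |z|^2]. *)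
Lemma mean_poisson (z : C) : Cmod z < 1 -> mean (poisson z) = 1.
Proof.
  intros Hz. pose proof (cont_poisson z Hz) as Hc.
  set (I := mean (poisson z)). set (A := cmean (fun t => (RtoC (poisson z t) * cis 1 t)%C)).
  assert (HcA : ccont (fun t => (RtoC (poisson z t) * cis 1 t)%C))
    by (apply ccont_mult; [apply ccont_RtoC; auto | apply ccont_cis1]).
  assert (HI : cmean (fun t => RtoC (poisson z t)) = RtoC I).
  { unfold cmean. simpl. rewrite mean_const. reflexivity. }
  assert (H0 : A = (z * I)%C).
  { pose proof (cmean_poisson_diff z 0 Hz) as H.
    rewrite (cmean_ext _ (fun t => (RtoC (poisson z t) * cis 1 t + (- z) * RtoC (poisson z t))%C)) in H.
    - rewrite cmean_plus, cmean_scal, HI in H; auto using ccont_RtoC.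
      + fold A in H. replace A with ((A + - z * I) + z * I)%C by ring. rewrite H. ring.
      + apply ccont_mult; auto using ccont_const, ccont_RtoC.
    - intros t. unfold poisson_diff. rewrite pow_n_0. ring. }
  assert (H1 : (I - z * Cconj A)%C = RtoC (1 - Cmod z ^ 2)).
  { assert (E : cmean (fun t => (Cconj (cis 1 t) * poisson_diff z t)%C) = RtoC (1 - Cmod z ^ 2)).
    { rewrite (cmean_ext _ (fun t => (RtoC (1 - Cmod z ^ 2) + Cconj z * (poisson_diff z t * pow_n (cis 1 t) 0))%C)).
      - rewrite cmean_plus, cmean_const, cmean_scal, cmean_poisson_diff; auto; [ring|..].
        + apply ccont_mult; [apply ccont_poisson_diff; auto | apply ccont_pow_n_cis].
        + apply ccont_const.
        + apply ccont_mult; [apply ccont_const|].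
          apply ccont_mult; [apply ccont_poisson_diff; auto | apply ccont_pow_n_cis].
      - intros t. rewrite pow_n_0.
        replace (RtoC (1 - Cmod z ^ 2)) with (RtoC (1 - Cmod z ^ 2) * (cis 1 t * Cconj (cis 1 t)))%C
          by (rewrite cis1_conj; ring).
        replace (RtoC (1 - Cmod z ^ 2) * (cis 1 t * Cconj (cis 1 t)))%C
          with ((RtoC (1 - Cmod z ^ 2) * cis 1 t) * Cconj (cis 1 t))%C by ring.
        rewrite <- poisson_diff_eq by auto.
        replace (poisson_diff z t * (1 - Cconj z * cis 1 t) * Cconj (cis 1 t))%C
          with (poisson_diff z t * Cconj (cis 1 t) - Cconj z * poisson_diff z t * (cis 1 t * Cconj (cis 1 t)))%C by ring.
        rewrite cis1_conj. ring. }
    rewrite <- E, <- HI. unfold A. rewrite <- cmean_conj by auto.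
    rewrite (cmean_ext (fun t => (Cconj (cis 1 t) * poisson_diff z t)%C)
      (fun t => (RtoC (poisson z t) + (- z) * Cconj (RtoC (poisson z t) * cis 1 t))%C)).
    - rewrite cmean_plus, cmean_scal; auto using ccont_RtoC, ccont_conj; [ring|].
      apply ccont_mult; auto using ccont_const, ccont_conj.
    - intros t. unfold poisson_diff. rewrite Cmult_conj.
      replace (Cconj (RtoC (poisson z t))) with (RtoC (poisson z t))
        by (unfold Cconj, RtoC; simpl; f_equal; ring).
      replace (Cconj (cis 1 t) * (RtoC (poisson z t) * (cis 1 t - z)))%C
        with (RtoC (poisson z t) * (cis 1 t * Cconj (cis 1 t)) - z * (RtoC (poisson z t) * Cconj (cis 1 t)))%C by ring.
      rewrite cis1_conj. ring. }
  rewrite H0, Cmult_conj in H1.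
  replace (Cconj (RtoC I)) with (RtoC I) in H1 by (unfold Cconj, RtoC; simpl; f_equal; ring).
  replace (I - z * (Cconj z * I))%C with (RtoC ((1 - Cmod z ^ 2) * I)) in H1.
  - apply RtoC_inj in H1. pose proof (Cmod_ge_0 z).
    apply Rmult_eq_reg_l with (1 - Cmod z ^ 2); [lra | simpl; nra].
  - rewrite RtoC_mult, RtoC_minus, <- z_conj. ring.
Qed.

Lemma psum_upto_difference_quotient (f : nat -> C) (B : R) (n : nat) (z w : C) :
  bdd f B -> (forall k, (n <= k)%nat -> f k = RtoC 0) -> Cmod z < 1 ->
  psum_upto f n w = (psum f z + (w - z) * psum_upto (fun m => psum (shift (S m) f) z) n w)%C.
Proof.
  intros Hf Hn Hz. set (b := fun m => psum (shift m f) z).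
  assert (Hb : forall m, b m = (f m + z * b (S m))%C) by (intros m; exact (psum_shift f B z m Hf Hz)).
  change (psum f z) with (b 0%nat).
  assert (E : forall k, (b 0%nat + (w - z) * psum_upto (fun m => b (S m)) k w)%C = (psum_upto f k w + b k * pow_n w k)%C).
  { induction k as [|k IH].
    - unfold psum_upto. simpl csum. rewrite pow_n_0. ring.
    - assert (E1 : psum_upto (fun m => b (S m)) (S k) w = (psum_upto (fun m => b (S m)) k w + b (S k) * pow_n w k)%C) by reflexivity.
      assert (E2 : psum_upto f (S k) w = (psum_upto f k w + f k * pow_n w k)%C) by reflexivity.
      rewrite E1, E2, pow_n_S.
      replace (b 0%nat + (w - z) * (psum_upto (fun m => b (S m)) k w + b (S k) * pow_n w k))%C
        with ((b 0%nat + (w - z) * psum_upto (fun m => b (S m)) k w) + (w - z) * (b (S k) * pow_n w k))%C by ring.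
      rewrite IH, (Hb k). ring. }
  change (fun m => psum (shift (S m) f) z) with (fun m => b (S m)).
  rewrite E. replace (b n) with (RtoC 0); [ring|].
  unfold b. rewrite (psum_finite _ _ 0); [reflexivity|]. intros k _. apply Hn. lia.
Qed.

(* The kernel times [|w - z|^2] is constant, so the expansion [f w = f z + (w - z) q w] leaves
   [|f z|^2] and the norm of [q]; the cross term vanishes by [cmean_poisson_diff]. *)
Lemma poisson_psum_upto (f : nat -> C) (B : R) (n : nat) (z : C) :
  bdd f B -> (forall k, (n <= k)%nat -> f k = RtoC 0) -> Cmod z < 1 ->
  mean (fun t => poisson z t * Cmod (psum_upto f n (cis 1 t)) ^ 2)
  = Cmod (psum f z) ^ 2 + rsum (fun m => Cmod (garsia_coef f z m) ^ 2) n.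
Proof.
  intros Hf Hn Hz. pose proof (cont_poisson z Hz) as Hc. pose proof (Cmod_ge_0 z).
  set (b := fun m => psum (shift (S m) f) z). set (a := psum f z).
  rewrite (mean_ext _ (fun t => (Cmod a ^ 2 * poisson z t
     + Re (RtoC 2 * Cconj a * (poisson_diff z t * psum_upto b n (cis 1 t)))%C)
     + (1 - Cmod z ^ 2) * Cmod (psum_upto b n (cis 1 t)) ^ 2)).
  - assert (Hcc : ccont (fun t => (poisson_diff z t * psum_upto b n (cis 1 t))%C))
      by (apply ccont_mult; [apply ccont_poisson_diff; auto | apply ccont_psum_upto]).
    assert (Hcr : ccont (fun t => (RtoC 2 * Cconj a * (poisson_diff z t * psum_upto b n (cis 1 t)))%C))
      by (apply ccont_mult; auto using ccont_const).
    assert (Hcq : cont (fun t => Cmod (psum_upto b n (cis 1 t)) ^ 2)) by (apply cont_pow, cont_Cmod, ccont_psum_upto).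
    rewrite mean_plus, mean_plus, !mean_scal, mean_poisson by
      (auto; try (apply cont_plus; [apply cont_mult; auto using cont_const | apply Hcr]);
       try apply Hcr; apply cont_mult; auto using cont_const).
    rewrite <- cmean_Re, cmean_scal by auto.
    assert (E : cmean (fun t => (poisson_diff z t * psum_upto b n (cis 1 t))%C) = RtoC 0).
    { rewrite (cmean_ext _ (fun t => csum (fun k => (b k * (poisson_diff z t * pow_n (cis 1 t) k))%C) n)).
      - rewrite cmean_csum.
        + apply csum_zero. intros k _. rewrite cmean_scal, cmean_poisson_diff by
            solve [auto | apply ccont_mult; [apply ccont_poisson_diff; auto | apply ccont_pow_n_cis]]. ring.
        + intros k. apply ccont_mult; [apply ccont_const|].
          apply ccont_mult; [apply ccont_poisson_diff; auto | apply ccont_pow_n_cis].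
      - intros t. unfold psum_upto. rewrite <- csum_scal. apply csum_ext. intros; ring. }
    rewrite E, Parseval_psum_upto.
    replace (Re (RtoC 2 * Cconj a * 0)%C) with 0 by (rewrite Cmult_0_r; reflexivity).
    rewrite <- rsum_scal.
    rewrite (rsum_ext (fun k => (1 - Cmod z ^ 2) * (Cmod (b k) ^ 2 * (1 ^ 2) ^ k)) (fun m => Cmod (garsia_coef f z m) ^ 2)).
    + ring.
    + intros m _. unfold garsia_coef. fold (b m).
      rewrite Cmod_mult, Cmod_R, Rabs_pos_eq by apply sqrt_pos.
      rewrite Rpow_mult_distr, pow2_sqrt by (simpl; nra). rewrite !pow1. ring.
  - intros t. rewrite (psum_upto_difference_quotient f B n z (cis 1 t) Hf Hn Hz). fold b. fold a.
    set (q := psum_upto b n (cis 1 t)). rewrite <- (poisson_mult z t Hz).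
    replace (RtoC 2 * Cconj a * (poisson_diff z t * q))%C
      with (RtoC (poisson z t) * (RtoC 2 * Cconj a * ((cis 1 t - z) * q)))%C by (unfold poisson_diff; ring).
    set (x := ((cis 1 t - z) * q)%C).
    assert (Ex : Cmod (cis 1 t - z) ^ 2 * Cmod q ^ 2 = Cmod x ^ 2)
      by (unfold x; rewrite Cmod_mult; ring).
    replace (poisson z t * Cmod (cis 1 t - z) ^ 2 * Cmod q ^ 2)
      with (poisson z t * Cmod x ^ 2) by (rewrite <- Ex; ring).
    rewrite !Cmod2_alt. destruct a, x. unfold Cconj, Cmult, Cplus, Re, Im, RtoC; simpl. ring.
Qed.

(** * The Garsia function of a square summable sequence *)

Lemma garsia_le_self (h : nat -> C) (M : R) (z : C) : garsia_le h z M -> garsia_le h z (garsia h z) /\ garsia h z <= M.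
Proof.
  intros H. split; [|apply l2norm_le; auto]. apply l2_le_l2norm. eapply l2_le_ex_series; eauto.
Qed.

Lemma garsia_nonneg (h : nat -> C) (z : C) : 0 <= garsia h z.
Proof. apply l2norm_nonneg. Qed.

Lemma cadd_csub (f g : nat -> C) : cadd g (csub f g) = f.
Proof. apply functional_extensionality. intros k. unfold cadd, csub. ring. Qed.

Lemma csub_csub (f g : nat -> C) : csub f (csub f g) = g.
Proof. apply functional_extensionality. intros k. unfold csub. ring. Qed.

Lemma garsia_close (x y : nat -> C) (D e : R) (z : C) :
  l2_le x D -> l2_le y D -> l2_le (csub x y) e -> Cmod z < 1 ->
  Rabs (garsia x z - garsia y z) <= garsia_const (Cmod z) * e.
Proof.
  intros Hx Hy Hxy Hz.
  pose proof (garsia_le_l2_le _ _ z Hx Hz) as Gx. pose proof (garsia_le_l2_le _ _ z Hy Hz) as Gy.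
  pose proof (garsia_le_l2_le _ _ z Hxy Hz) as Gxy.
  destruct (garsia_le_self _ _ _ Gx) as [Gx' _]. destruct (garsia_le_self _ _ _ Gy) as [Gy' _].
  pose proof (l2_le_bdd _ _ Hx) as Bx. pose proof (l2_le_bdd _ _ Hy) as By.
  pose proof (l2_le_bdd _ _ Hxy) as Bxy.
  assert (H1 : garsia_le x z (garsia y z + garsia_const (Cmod z) * e)).
  { rewrite <- (cadd_csub x y). eapply garsia_le_plus; eauto. }
  assert (H2 : garsia_le y z (garsia x z + garsia_const (Cmod z) * e)).
  { rewrite <- (csub_csub x y). eapply garsia_le_sub; eauto. }
  destruct (garsia_le_self _ _ _ H1) as [_ H1']. destruct (garsia_le_self _ _ _ H2) as [_ H2'].
  apply Rabs_le. lra.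
Qed.

Lemma psum_close (x y : nat -> C) (D e : R) (z : C) :
  l2_le x D -> l2_le y D -> l2_le (csub x y) e -> Cmod z < 1 ->
  Rabs (Cmod (psum x z) - Cmod (psum y z)) <= e / (1 - Cmod z).
Proof.
  intros Hx Hy Hxy Hz.
  pose proof (l2_le_bdd _ _ Hx) as Bx. pose proof (l2_le_bdd _ _ Hy) as By.
  pose proof (l2_le_bdd _ _ Hxy) as Bxy.
  pose proof (bdd_psum_le _ _ z Bxy Hz) as H.
  assert (E : psum x z = (psum y z + psum (csub x y) z)%C).
  { rewrite <- (cadd_csub x y) at 1. apply psum_plus; eapply bdd_ex; eauto. }
  eapply Rle_trans; [apply Cmod_diff|].
  replace (psum x z - psum y z)%C with (psum (csub x y) z) by (rewrite E; ring). exact H.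
Qed.

(** The value that the Poisson integral of [|h|^2] should have at [z]; [garsia_sq_eq] shows that the
    radial limit in [poisson_abs2] equals it. *)
Definition poisson_sq (h : nat -> C) (z : C) : R := Cmod (psum h z) ^ 2 + garsia h z ^ 2.

(** A Lipschitz constant of [poisson_sq] at [z] on the l^2 ball of radius [D]: each of its two
    squares contributes twice a bound for its size times its own Lipschitz constant. *)
Definition poisson_sq_const (D : R) (z : C) : R :=
  2 * (D / (1 - Cmod z)) * / (1 - Cmod z) + 2 * (garsia_const (Cmod z) * D) * garsia_const (Cmod z).

Lemma poisson_sq_close (x y : nat -> C) (D e : R) (z : C) :
  l2_le x D -> l2_le y D -> l2_le (csub x y) e -> Cmod z < 1 ->
  Rabs (poisson_sq x z - poisson_sq y z) <= poisson_sq_const D z * e.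
Proof.
  intros Hx Hy Hxy Hz.
  pose proof (garsia_close x y D e z Hx Hy Hxy Hz) as H1.
  pose proof (psum_close x y D e z Hx Hy Hxy Hz) as H2.
  pose proof (bdd_psum_le x D z (l2_le_bdd _ _ Hx) Hz) as H3.
  pose proof (bdd_psum_le y D z (l2_le_bdd _ _ Hy) Hz) as H4.
  destruct (garsia_le_self _ _ _ (garsia_le_l2_le _ _ z Hx Hz)) as [_ H5].
  destruct (garsia_le_self _ _ _ (garsia_le_l2_le _ _ z Hy Hz)) as [_ H6].
  pose proof (sq_close _ _ _ _ H2 (conj (Cmod_ge_0 _) H3) (conj (Cmod_ge_0 _) H4)) as H7.
  pose proof (sq_close _ _ _ _ H1 (conj (garsia_nonneg _ _) H5) (conj (garsia_nonneg _ _) H6)) as H8.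
  unfold poisson_sq, poisson_sq_const.
  replace (Cmod (psum x z) ^ 2 + garsia x z ^ 2 - (Cmod (psum y z) ^ 2 + garsia y z ^ 2))
    with ((Cmod (psum x z) ^ 2 - Cmod (psum y z) ^ 2) + (garsia x z ^ 2 - garsia y z ^ 2)) by ring.
  eapply Rle_trans; [apply Rabs_triang|]. unfold Rdiv in *. lra.
Qed.

Lemma poisson_sq_const_pos (D : R) (z : C) : 0 <= D -> Cmod z < 1 -> 0 <= poisson_sq_const D z.
Proof.
  intros HD Hz. destruct (garsia_const_mono (Cmod z) (Cmod z)) as [HG _]; [lra|].
  assert (0 < / (1 - Cmod z)) by (apply Rinv_0_lt_compat; lra). unfold poisson_sq_const, Rdiv.
  set (G := garsia_const (Cmod z)) in *. clearbody G.
  apply Rplus_le_le_0_compat; repeat apply Rmult_le_pos; lra.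
Qed.

Lemma l2_le_trunc (x : nat -> C) (M : R) (n : nat) : l2_le x M -> l2_le (trunc n x) M.
Proof.
  intros [HM H]. split; auto. intros k. eapply Rle_trans; [|apply (H k)].
  apply rsum_le. intros j _. unfold trunc. destruct (lt_dec j n); [lra|].
  rewrite Cmod_0. replace (0 ^ 2) with 0 by ring. apply pow2_ge_0.
Qed.

Lemma garsia_finite (f : nat -> C) (n : nat) (z : C) :
  (forall k, (n <= k)%nat -> f k = RtoC 0) -> garsia f z ^ 2 = rsum (fun m => Cmod (garsia_coef f z m) ^ 2) n.
Proof.
  intros Hn.
  assert (H0 : forall m, (n <= m)%nat -> Cmod (garsia_coef f z m) ^ 2 = 0).
  { intros m Hm. unfold garsia_coef. rewrite (psum_finite _ _ 0).
    - unfold psum_upto; simpl. rewrite Cmult_0_r, Cmod_0. ring.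
    - intros k _. apply Hn. lia. }
  unfold garsia, l2norm.
  assert (E : Series (fun k => Cmod (garsia_coef f z k) ^ 2) = rsum (fun m => Cmod (garsia_coef f z m) ^ 2) n).
  { apply is_series_unique. apply is_series_rsum. intros eps He. exists n. intros m Hm.
    rewrite (rsum_support _ n m) by auto. rewrite Rminus_diag, Rabs_R0. auto. }
  rewrite E, pow2_sqrt; auto. apply rsum_nonneg. intros; apply pow2_ge_0.
Qed.

Lemma l2_le_dil (c : nat -> C) (M r : R) : l2_le c M -> 0 <= r <= 1 -> l2_le (dil r c) M.
Proof.
  intros [HM H] Hr. split; auto. intros n. eapply Rle_trans; [|apply (H n)].
  apply rsum_le. intros k _. unfold dil.
  rewrite Cmod_mult, Cmod_R, Rabs_pos_eq by (apply pow_le; lra).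
  apply pow_incr. split; [apply Rmult_le_pos; [apply Cmod_ge_0 | apply pow_le; lra]|].
  rewrite <- (Rmult_1_r (Cmod (c k))) at 2. apply Rmult_le_compat_l; [apply Cmod_ge_0|].
  rewrite <- (pow1 k). apply pow_incr; lra.
Qed.

(** The function on the circle of radius [r] is its dilation on the unit circle. The identity is
    known for truncations from [poisson_psum_upto], and both sides depend continuously on the
    truncation. *)
Lemma poisson_dil (c : nat -> C) (M r : R) (z : C) :
  l2_le c M -> 0 <= r < 1 -> Cmod z < 1 ->
  mean (fun t => poisson z t * Cmod (psum c (cis r t)) ^ 2) = poisson_sq (dil r c) z.
Proof.
  intros Hc Hr Hz. pose proof (l2_le_bdd c M Hc) as Hb. pose proof (proj1 Hc) as HM.
  pose proof (l2_le_dil c M r Hc ltac:(lra)) as Hd.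
  pose proof (cont_poisson z Hz) as Hcp.
  assert (Hps : ccont (fun t => psum c (cis r t))) by exact (ccont_psum_bdd c M r Hb Hr).
  set (K := M / (1 - r)). assert (HK : 0 <= K) by (apply Rdiv_le_0_compat; lra).
  assert (HKb : forall t, Cmod (psum c (cis r t)) <= K).
  { intros t. pose proof (bdd_psum_le c M (cis r t) Hb) as H.
    rewrite Cmod_cis, Rabs_pos_eq in H by lra. apply H. lra. }
  assert (H0 : Rabs (mean (fun t => poisson z t * Cmod (psum c (cis r t)) ^ 2) - poisson_sq (dil r c) z) <= 0).
  { apply le_epsilon. intros e He. rewrite Rplus_0_l.
    (* The first term is for the truncation under the integral, the second for the truncation inside
       [poisson_sq]. *)
    set (L := 2 * (K + 1) + poisson_sq_const M z).
    pose proof (poisson_sq_const_pos M z HM Hz).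
    assert (HL : 0 < L) by (unfold L; lra).
    destruct (small_scale e L He HL) as (d & [Hd0 Hd1] & HdL).
    destruct (bdd_unif c M r d Hb Hr Hd0) as [N1 HN1].
    destruct (l2_le_tail (dil r c) M d Hd Hd0) as [N2 HN2].
    set (N := Nat.max N1 N2). specialize (HN1 N ltac:(lia)). specialize (HN2 N ltac:(lia)).
    set (f := trunc N (dil r c)).
    assert (Hf : l2_le f M) by (apply l2_le_trunc; auto).
    assert (EP : forall t, psum_upto f N (cis 1 t) = psum_upto c N (cis r t)).
    { intros t. apply csum_ext. intros k Hk. unfold f, trunc, dil. destruct (lt_dec k N); [|lia].
      rewrite !cis_pow, pow1. unfold cis, Cmult, RtoC. simpl. f_equal; ring. }
    pose proof (poisson_psum_upto f M N z (l2_le_bdd _ _ Hf) ltac:(intros; apply trunc_out; auto) Hz) as E.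
    rewrite <- (garsia_finite f N z) in E by (intros; apply trunc_out; auto). fold (poisson_sq f z) in E.
    pose proof (poisson_sq_close (dil r c) f M d z Hd Hf HN2 Hz) as H1.
    assert (H2 : Rabs (mean (fun t => poisson z t * Cmod (psum c (cis r t)) ^ 2) - poisson_sq f z) <= 2 * (K + 1) * d).
    { rewrite <- E.
      replace (mean (fun t => poisson z t * Cmod (psum_upto f N (cis 1 t)) ^ 2))
        with (mean (fun t => poisson z t * Cmod (psum_upto c N (cis r t)) ^ 2))
        by (apply mean_ext; intros t; now rewrite EP).
      rewrite <- mean_minus; try (apply cont_mult; auto; apply cont_pow, cont_Cmod; auto; apply ccont_psum_upto).
      eapply Rle_trans; [apply mean_abs|].
      { apply cont_minus; apply cont_mult; auto; apply cont_pow, cont_Cmod; auto; apply ccont_psum_upto. }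
      replace (2 * (K + 1) * d) with (2 * (K + 1) * d * mean (poisson z)) by (rewrite mean_poisson; auto; ring).
      rewrite <- mean_scal by auto. apply mean_le.
      - apply (cont_comp (fun t => poisson z t * Cmod (psum c (cis r t)) ^ 2 - poisson z t * Cmod (psum_upto c N (cis r t)) ^ 2) Rabs).
        + apply cont_minus; apply cont_mult; auto; apply cont_pow, cont_Cmod; auto; apply ccont_psum_upto.
        + intros t; apply continuous_Rabs.
      - apply cont_mult; auto using cont_const.
      - intros t. rewrite <- Rmult_minus_distr_l, Rabs_mult, Rabs_pos_eq by (apply poisson_nonneg; auto).
        rewrite Rmult_comm. apply Rmult_le_compat_r; [apply poisson_nonneg; auto|].
        rewrite Rabs_minus_sym. apply Cmod2_close; auto.
        apply HN1. rewrite Cmod_cis, Rabs_pos_eq; lra. }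
    replace (_ - poisson_sq (dil r c) z) with ((mean (fun t => poisson z t * Cmod (psum c (cis r t)) ^ 2) - poisson_sq f z)
      + - (poisson_sq (dil r c) z - poisson_sq f z)) by ring.
    eapply Rle_trans; [apply Rabs_triang|]. rewrite Rabs_Ropp. unfold L in HdL. lra. }
  pose proof (Rabs_pos (mean (fun t => poisson z t * Cmod (psum c (cis r t)) ^ 2) - poisson_sq (dil r c) z)).
  assert (E0 : Rabs (mean (fun t => poisson z t * Cmod (psum c (cis r t)) ^ 2) - poisson_sq (dil r c) z) = 0) by lra.
  destruct (Req_dec (mean (fun t => poisson z t * Cmod (psum c (cis r t)) ^ 2) - poisson_sq (dil r c) z) 0) as [|Hn]; [lra|].
  apply Rabs_no_R0 in Hn. lra.
Qed.

Lemma l2_le_dil_close (c : nat -> C) (M eps : R) :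
  l2_le c M -> 0 < eps -> exists r0, 0 < r0 < 1 /\ forall r, r0 < r < 1 -> l2_le (csub c (dil r c)) eps.
Proof.
  intros Hc He. pose proof (proj1 Hc) as HM.
  destruct (l2_le_tail c M (eps / 2) Hc ltac:(lra)) as [N HN]. specialize (HN N ltac:(lia)).
  destruct (pow_close_1 N (eps / 2 / (M + 1)) ltac:(apply Rdiv_lt_0_compat; lra)) as (d & Hd & HH).
  exists (Rmax (1 / 2) (1 - d)). split.
  { split; [apply Rlt_le_trans with (1 / 2); [lra | apply Rmax_l] | apply Rmax_lub_lt; lra]. }
  intros r Hr. pose proof (Rmax_l (1 / 2) (1 - d)). pose proof (Rmax_r (1 / 2) (1 - d)).
  specialize (HH r ltac:(lra)).
  assert (Hpow : forall k, 0 <= r ^ k <= 1)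
    by (intros k; split; [apply pow_le; lra | rewrite <- (pow1 k); apply pow_incr; lra]).
  assert (H1 : l2_le (fun k => ((1 - r ^ k)%R * trunc N c k)%C) (eps / 2)).
  { split; [lra|]. intros n.
    apply Rle_trans with ((eps / 2 / (M + 1)) ^ 2 * M ^ 2).
    - eapply Rle_trans; [|apply Rmult_le_compat_l; [apply pow2_ge_0 | apply (proj2 Hc n)]].
      rewrite <- rsum_scal. apply rsum_le. intros k _.
      rewrite Cmod_mult, Cmod_R, Rpow_mult_distr. specialize (Hpow k).
      rewrite Rabs_pos_eq by lra. unfold trunc. destruct (lt_dec k N).
      + apply Rmult_le_compat_r; [apply pow2_ge_0|]. apply pow_incr. split; [lra|].
        assert (r ^ N <= r ^ k).
        { replace N with (k + (N - k))%nat by lia. rewrite pow_add.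
          assert (0 <= r ^ (N - k) <= 1)
            by (split; [apply pow_le; lra | rewrite <- (pow1 (N - k)); apply pow_incr; lra]). nra. }
        lra.
      + rewrite Cmod_0. replace (0 ^ 2) with 0 by ring. rewrite Rmult_0_r.
        apply Rmult_le_pos; apply pow2_ge_0.
    - rewrite <- Rpow_mult_distr. apply pow_incr. split.
      + apply Rmult_le_pos; auto. left. apply Rdiv_lt_0_compat; lra.
      + apply Rle_trans with (eps / 2 / (M + 1) * (M + 1)); [|right; field; lra].
        apply Rmult_le_compat_l; [left; apply Rdiv_lt_0_compat; lra | lra]. }
  assert (H2 : l2_le (fun k => ((1 - r ^ k)%R * csub c (trunc N c) k)%C) (eps / 2)).
  { split; [lra|]. intros n. eapply Rle_trans; [|apply (proj2 HN n)]. apply rsum_le. intros k _.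
    rewrite Cmod_mult, Cmod_R. specialize (Hpow k). rewrite Rabs_pos_eq by lra.
    apply pow_incr. pose proof (Cmod_ge_0 (csub c (trunc N c) k)). nra. }
  replace eps with (eps / 2 + eps / 2) by field.
  apply (l2_le_ext (cadd (fun k => ((1 - r ^ k)%R * trunc N c k)%C) (fun k => ((1 - r ^ k)%R * csub c (trunc N c) k)%C))).
  - intros k. unfold cadd, csub, dil. rewrite RtoC_minus. ring.
  - apply l2_le_plus; auto.
Qed.

(** The radial integrals are the values of [poisson_sq] at dilations of [c], which tend to [c] in
    l^2. This turns the defining Garsia function into the explicit l^2 norm. *)
Lemma garsia_sq_eq (c : nat -> C) (M : R) (z : C) :
  l2_le c M -> Cmod z < 1 -> garsia_sq c z = garsia c z ^ 2.
Proof.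
  intros Hc Hz. unfold garsia_sq.
  assert (E : poisson_abs2 c z = poisson_sq c z).
  { unfold poisson_abs2. apply (@R_lim_eq R (at_left 1) (at_left_proper_filter 1)).
    apply filterlim_locally. intros eps. pose proof (cond_pos eps) as He.
    pose proof (poisson_sq_const_pos M z (proj1 Hc) Hz) as HG.
    destruct (l2_le_dil_close c M (eps / 2 / (poisson_sq_const M z + 1)) Hc) as (r0 & Hr0 & H).
    { repeat apply Rdiv_lt_0_compat; lra. }
    apply (at_left_1 r0); [lra|]. intros r Hr. specialize (H r Hr).
    change (/ (2 * PI) * RInt (fun t => poisson z t * Cmod (psum c (cis r t)) ^ 2) 0 (2 * PI))
      with (mean (fun t => poisson z t * Cmod (psum c (cis r t)) ^ 2)).
    rewrite (poisson_dil c M r z Hc ltac:(lra) Hz).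
    pose proof (poisson_sq_close c (dil r c) M _ z Hc (l2_le_dil c M r Hc ltac:(lra)) H Hz) as Hcl.
    change (Rabs (poisson_sq (dil r c) z - poisson_sq c z) < eps). rewrite Rabs_minus_sym.
    eapply Rle_lt_trans; [exact Hcl|].
    apply Rle_lt_trans with (eps / 2); [|lra].
    apply Rle_trans with ((poisson_sq_const M z + 1) * (eps / 2 / (poisson_sq_const M z + 1))); [|right; field; lra].
    apply Rmult_le_compat_r; [|lra]. left. repeat apply Rdiv_lt_0_compat; lra. }
  rewrite E. unfold poisson_sq. ring.
Qed.

(** * BMOA and VMOA *)

Definition bmo (c : nat -> C) : R := real (BMOAnorm c).

(** Parseval holds for partial sums, uniformly close to [c] on each circle. This bounds every finite
    sum of [|c k|^2 * r ^ (2 k)], and then [r] tends to 1. *)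
Lemma inH2_l2_le (c : nat -> C) : inH2 c -> exists M, l2_le c M.
Proof.
  intros [Hc Hn].
  assert (HM : exists M, forall r, 0 <= r < 1 -> circ_mean_pow 2 c r <= M).
  { exists (real (Hpnorm 2 c)). intros r Hr. unfold Hpnorm in *.
    destruct (Lub_Rbar_correct (fun x => exists r, 0 <= r < 1 /\ x = circ_mean_pow 2 c r)) as [H1 _].
    assert (Hx : exists r0, 0 <= r0 < 1 /\ circ_mean_pow 2 c r = circ_mean_pow 2 c r0) by (exists r; auto).
    specialize (H1 _ Hx). destruct (Lub_Rbar _) as [l| |]; simpl in *; tauto. }
  destruct HM as [M HM].
  assert (Hle : forall r n, 0 <= r < 1 -> rsum (fun k => Cmod (c k) ^ 2 * (r ^ 2) ^ k) n <= M).
  { intros r n Hr. eapply Rle_trans; [|apply (HM r Hr)].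
    destruct (holo_majorized c r Hc Hr) as [u Hu].
    assert (Hps : ccont (fun t => psum c (cis r t))) by (apply (ccont_psum c r u); auto; lra).
    set (K := Series u).
    assert (Hu0 := majorized_nonneg _ _ _ Hu).
    assert (HK : forall m t, Cmod (psum_upto c m (cis r t)) <= K).
    { intros m t. eapply Rle_trans; [apply (Cmod_csum _ u)|apply rsum_le_Series; auto; apply Hu].
      intros k _. rewrite Cmod_mult, Cmod_pow_n. apply (cis_majorized c r t u); auto. lra. }
    assert (HK0 : 0 <= K) by (eapply Rle_trans; [apply Cmod_ge_0 | apply (HK 0%nat 0)]).
    apply le_epsilon. intros e He.
    destruct (small_scale e (2 * (K + 1)) He ltac:(lra)) as (d & [Hd Hd1] & Hd2).
    destruct (tail_lim u d (proj1 Hu) Hd) as [N HN].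
    set (m := Nat.max N n). specialize (HN m ltac:(lia)). apply Rabs_lt_between in HN.
    assert (Hin : rsum (fun k => Cmod (c k) ^ 2 * (r ^ 2) ^ k) n
       <= rsum (fun k => Cmod (c k) ^ 2 * (r ^ 2) ^ k) m).
    { apply rsum_incr; [|lia]. intros k. apply Rmult_le_pos; [|apply pow_le]; apply pow2_ge_0. }
    rewrite <- (Parseval_psum_upto c m r) in Hin.
    change (circ_mean_pow 2 c r) with (mean (fun t => Cmod (psum c (cis r t)) ^ 2)).
    assert (Hcl : Rabs (mean (fun t => Cmod (psum_upto c m (cis r t)) ^ 2)
       - mean (fun t => Cmod (psum c (cis r t)) ^ 2)) <= 2 * (K + 1) * d).
    { apply mean_close; try (apply cont_pow, cont_Cmod; auto; apply ccont_psum_upto).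
      intros t. rewrite Rabs_minus_sym. apply Cmod2_close; auto.
      rewrite <- Cmod_opp, Copp_minus_distr.
      eapply Rle_trans; [apply (psum_approx c (cis r t) u m), cis_majorized; auto; lra | lra]. }
    apply Rabs_le_between in Hcl. lra. }
  assert (HM0 : 0 <= M) by (specialize (Hle 0 0%nat ltac:(lra)); simpl in Hle; lra).
  assert (Hfin : forall n, rsum (fun k => Cmod (c k) ^ 2) n <= M).
  { intros n. apply le_epsilon. intros e He.
    set (S := rsum (fun k => Cmod (c k) ^ 2) n).
    assert (HS : 0 <= S) by (apply rsum_nonneg; intros; apply pow2_ge_0).
    destruct (pow_close_1 (2 * n) (e / (S + 1)) ltac:(apply Rdiv_lt_0_compat; lra)) as (d & Hd & HH).
    set (r := Rmax 0 (1 - d / 2)).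
    assert (Hr : 0 <= r < 1) by (split; [apply Rmax_l | apply Rmax_lub_lt; lra]).
    assert (Hrd : 1 - d < r <= 1) by (pose proof (Rmax_r 0 (1 - d / 2)); fold r in H; lra).
    specialize (HH r Hrd). specialize (Hle r n Hr).
    assert (H1 : r ^ (2 * n) * S <= rsum (fun k => Cmod (c k) ^ 2 * (r ^ 2) ^ k) n).
    { unfold S. rewrite <- rsum_scal. apply rsum_le. intros k Hk. rewrite Rmult_comm.
      apply Rmult_le_compat_l; [apply pow2_ge_0|]. rewrite <- pow_mult.
      replace (2 * n)%nat with (2 * k + (2 * n - 2 * k))%nat by lia. rewrite pow_add.
      assert (0 <= r ^ (2 * k)) by (apply pow_le; lra).
      assert (r ^ (2 * n - 2 * k) <= 1) by (rewrite <- (pow1 (2 * n - 2 * k)); apply pow_incr; lra).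
      nra. }
    assert (H2 : e / (S + 1) * S <= e).
    { apply Rle_trans with (e / (S + 1) * (S + 1)); [|right; field; lra].
      apply Rmult_le_compat_l; [left; apply Rdiv_lt_0_compat; lra | lra]. }
    assert (H3 : (1 - e / (S + 1)) * S <= r ^ (2 * n) * S) by (apply Rmult_le_compat_r; lra).
    lra. }
  exists (sqrt M). split; [apply sqrt_pos|]. intros n. rewrite pow2_sqrt; auto.
Qed.

Lemma l2_le_inH2 (c : nat -> C) (M : R) : l2_le c M -> inH2 c.
Proof.
  intros Hc. pose proof (l2_le_bdd c M Hc) as Hb. split; [eapply bdd_holo; eauto|].
  assert (HM : forall r, 0 <= r < 1 -> circ_mean_pow 2 c r <= M ^ 2).
  { intros r Hr. change (circ_mean_pow 2 c r) with (mean (fun t => Cmod (psum c (cis r t)) ^ 2)).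
    assert (Hps : ccont (fun t => psum c (cis r t))) by exact (ccont_psum_bdd c M r Hb Hr).
    set (K := M / (1 - r)). pose proof (bdd_nonneg c M Hb) as HM0.
    assert (HK0 : 0 <= K) by (apply Rdiv_le_0_compat; lra).
    apply le_epsilon. intros e He.
    destruct (small_scale e (2 * (K + 1)) He ltac:(lra)) as (d & [Hd Hd1] & Hd2).
    destruct (bdd_unif c M r d Hb Hr Hd) as [m HN]. specialize (HN m ltac:(lia)).
    assert (Hin : mean (fun t => Cmod (psum_upto c m (cis r t)) ^ 2) <= M ^ 2).
    { rewrite Parseval_psum_upto. eapply Rle_trans; [|apply (proj2 Hc m)]. apply rsum_le. intros k _.
      rewrite <- (Rmult_1_r (Cmod (c k) ^ 2)) at 2. apply Rmult_le_compat_l; [apply pow2_ge_0|].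
      rewrite <- (pow1 k). apply pow_incr. simpl; nra. }
    assert (Hcl : Rabs (mean (fun t => Cmod (psum_upto c m (cis r t)) ^ 2)
       - mean (fun t => Cmod (psum c (cis r t)) ^ 2)) <= 2 * (K + 1) * d).
    { apply mean_close; try (apply cont_pow, cont_Cmod; auto; apply ccont_psum_upto).
      intros t. apply Cmod2_close; auto.
      - pose proof (bdd_psum_le c M (cis r t) Hb) as H. rewrite Cmod_cis, Rabs_pos_eq in H by lra. apply H; lra.
      - apply HN. rewrite Cmod_cis, Rabs_pos_eq; lra. }
    apply Rabs_le_between in Hcl. lra. }
  destruct (Lub_bounded (fun x => exists r, 0 <= r < 1 /\ x = circ_mean_pow 2 c r) (M ^ 2) (circ_mean_pow 2 c 0))
    as (H1 & _).
  - exists 0. split; [lra | auto].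
  - intros y [r [Hr ->]]. auto.
  - unfold Hpnorm. rewrite <- H1. exact I.
Qed.

Lemma sqrt_garsia (c : nat -> C) (M : R) (z : C) :
  l2_le c M -> Cmod z < 1 -> sqrt (garsia_sq c z) = garsia c z.
Proof. intros Hc Hz. rewrite (garsia_sq_eq c M z Hc Hz). apply sqrt_pow2, garsia_nonneg. Qed.

Lemma inBMOA_spec (c : nat -> C) :
  inBMOA c -> l2_le c (2 * bmo c) /\ 0 <= bmo c /\
    (forall z, Cmod z < 1 -> garsia_le c z (bmo c) /\ Cmod (c 0%nat) + garsia c z <= bmo c) /\ Cmod (c 0%nat) <= bmo c.
Proof.
  intros [H2 Hn]. destruct (inH2_l2_le c H2) as [M HM].
  assert (Hz : forall z, Cmod z < 1 -> Cmod (c 0%nat) + garsia c z <= bmo c).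
  { intros z Hz. unfold bmo, BMOAnorm in *.
    destruct (Lub_Rbar_correct (fun x => exists z, Cmod z < 1 /\ x = sqrt (garsia_sq c z))) as [H1 _].
    assert (Hx : exists z0, Cmod z0 < 1 /\ garsia c z = sqrt (garsia_sq c z0)).
    { exists z. split; auto. symmetry. eapply sqrt_garsia; eauto. }
    specialize (H1 _ Hx). destruct (Lub_Rbar _) as [l| |]; simpl in *; try tauto. lra. }
  assert (Hc0 : Cmod (c 0%nat) <= bmo c).
  { specialize (Hz (RtoC 0) ltac:(rewrite Cmod_0; lra)). pose proof (garsia_nonneg c (RtoC 0)). lra. }
  assert (Hg : forall z, Cmod z < 1 -> garsia_le c z (bmo c)).
  { intros z Hz1. destruct (garsia_le_self _ _ _ (garsia_le_l2_le c M z HM Hz1)) as [H _].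
    eapply l2_le_weaken; [exact H|]. specialize (Hz z Hz1). pose proof (Cmod_ge_0 (c 0%nat)). lra. }
  split; [|split; [|split; auto]].
  - apply garsia_le_0_l2_le; auto. apply Hg. rewrite Cmod_0. lra.
  - eapply Rle_trans; [apply Cmod_ge_0 | exact Hc0].
Qed.

Lemma inBMOA_intro (c : nat -> C) (H M : R) :
  l2_le c H -> (forall z, Cmod z < 1 -> Cmod (c 0%nat) + garsia c z <= M) ->
  inBMOA c /\ is_finite (BMOAnorm c) /\ bmo c <= M.
Proof.
  intros HH HM.
  destruct (Lub_bounded (fun x => exists z, Cmod z < 1 /\ x = sqrt (garsia_sq c z)) (M - Cmod (c 0%nat))
    (garsia c (RtoC 0))) as (H1 & H2 & H3).
  - exists (RtoC 0). assert (Hz : Cmod (RtoC 0) < 1) by (rewrite Cmod_0; lra). split; auto.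
    symmetry. eapply sqrt_garsia; eauto.
  - intros y [z [Hz ->]]. rewrite (sqrt_garsia c H z HH Hz). specialize (HM z Hz). lra.
  - assert (Hf : is_finite (BMOAnorm c)) by (unfold BMOAnorm; rewrite <- H1; reflexivity).
    assert (HN : bmo c <= M) by (unfold bmo, BMOAnorm; rewrite <- H1; simpl; lra).
    split; [|split; auto]. split; [eapply l2_le_inH2; eauto|]. rewrite <- Hf. exact I.
Qed.

Lemma inBMOA_intro2 (c : nat -> C) (H A G : R) :
  l2_le c H -> Cmod (c 0%nat) <= A -> (forall z, Cmod z < 1 -> garsia_le c z G) ->
  inBMOA c /\ is_finite (BMOAnorm c) /\ bmo c <= A + G.
Proof.
  intros HH HA HG. apply (inBMOA_intro c H); auto. intros z Hz.
  destruct (garsia_le_self _ _ _ (HG z Hz)) as [_ H1]. lra.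
Qed.

Lemma inBMOA_bdd (c : nat -> C) : inBMOA c -> bdd c (2 * bmo c).
Proof. intros H. apply l2_le_bdd, inBMOA_spec, H. Qed.

Lemma garsia_plus (f g : nat -> C) (z : C) :
  inBMOA f -> inBMOA g -> Cmod z < 1 -> garsia (cadd f g) z <= garsia f z + garsia g z.
Proof.
  intros Hf Hg Hz. destruct (inBMOA_spec f Hf) as (_ & _ & F & _).
  destruct (inBMOA_spec g Hg) as (_ & _ & G & _).
  destruct (garsia_le_self _ _ _ (proj1 (F z Hz))) as [F1 _]. destruct (garsia_le_self _ _ _ (proj1 (G z Hz))) as [G1 _].
  apply garsia_le_self. eapply garsia_le_plus; eauto using inBMOA_bdd.
Qed.

Lemma garsia_scal (l : C) (f : nat -> C) (z : C) :
  inBMOA f -> Cmod z < 1 -> garsia (cscal l f) z <= Cmod l * garsia f z.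
Proof.
  intros Hf Hz. destruct (inBMOA_spec f Hf) as (_ & _ & F & _).
  destruct (garsia_le_self _ _ _ (proj1 (F z Hz))) as [F1 _].
  apply garsia_le_self. eapply garsia_le_scal; eauto using inBMOA_bdd.
Qed.

Lemma inBMOA_plus (f g : nat -> C) :
  inBMOA f -> inBMOA g -> inBMOA (cadd f g) /\ is_finite (BMOAnorm (cadd f g)) /\ bmo (cadd f g) <= bmo f + bmo g.
Proof.
  intros Hf Hg. pose proof (inBMOA_spec f Hf) as (F1 & _ & F & _).
  pose proof (inBMOA_spec g Hg) as (G1 & _ & G & _).
  apply (inBMOA_intro _ (2 * bmo f + 2 * bmo g)); [apply l2_le_plus; auto|].
  intros z Hz. pose proof (garsia_plus f g z Hf Hg Hz). pose proof (Cmod_triangle (f 0%nat) (g 0%nat)).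
  pose proof (proj2 (F z Hz)). pose proof (proj2 (G z Hz)). unfold cadd at 1. lra.
Qed.

Lemma inBMOA_scal (l : C) (f : nat -> C) :
  inBMOA f -> inBMOA (cscal l f) /\ is_finite (BMOAnorm (cscal l f)) /\ bmo (cscal l f) <= Cmod l * bmo f.
Proof.
  intros Hf. pose proof (inBMOA_spec f Hf) as (F1 & _ & F & _).
  apply (inBMOA_intro _ (Cmod l * (2 * bmo f))); [apply l2_le_scal; auto|].
  intros z Hz. pose proof (garsia_scal l f z Hf Hz). pose proof (proj2 (F z Hz)).
  unfold cscal at 1. rewrite Cmod_mult.
  apply Rle_trans with (Cmod l * (Cmod (f 0%nat) + garsia f z)); [lra|].
  apply Rmult_le_compat_l; auto. apply Cmod_ge_0.
Qed.

Lemma inBMOA_sub (f g : nat -> C) :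
  inBMOA f -> inBMOA g -> inBMOA (csub f g) /\ is_finite (BMOAnorm (csub f g)) /\ bmo (csub f g) <= bmo f + bmo g.
Proof.
  intros Hf Hg. rewrite csub_cadd. destruct (inBMOA_scal (RtoC (-1)) g Hg) as (H1 & _ & H2).
  rewrite Cmod_m1' in H2. destruct (inBMOA_plus f _ Hf H1) as (H3 & H4 & H5).
  split; auto. split; auto. lra.
Qed.

(** Balls of BMOA are closed under coefficientwise convergence: every Garsia coefficient at a fixed
    point converges, and finitely many of them decide an l^2 bound. *)
Lemma inBMOA_lsc (y : nat -> nat -> C) (x : nat -> C) (M : R) :
  (forall i, inBMOA (y i) /\ bmo (y i) <= M) ->
  (forall k eps, 0 < eps -> exists I, forall i, (I <= i)%nat -> Cmod (y i k - x k) < eps) ->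
  inBMOA x /\ is_finite (BMOAnorm x) /\ bmo x <= M.
Proof.
  intros Hy Hlim.
  assert (Hb : forall i, bdd (y i) (2 * M)).
  { intros i k. destruct (Hy i) as [H1 H2]. pose proof (inBMOA_bdd _ H1 k). lra. }
  assert (Hx : bdd x (2 * M)) by (eapply bdd_coef_lim; eauto).
  (* The norm adds the modulus at 0 to the supremum, so only [M - Cmod (x 0)] remains for the
     seminorm; [e] absorbs the error in the constant coefficient. *)
  assert (Hgx : forall z e, Cmod z < 1 -> 0 < e -> garsia_le x z (M - Cmod (x 0%nat) + e)).
  { intros z e Hz He.
    destruct (Hlim 0%nat e He) as [I0 HI0].
    assert (Hgy : forall i, (I0 <= i)%nat -> garsia_le (y i) z (M - Cmod (x 0%nat) + e)).
    { intros i Hi. destruct (Hy i) as [H1 H2]. destruct (inBMOA_spec _ H1) as (_ & _ & F & _).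
      destruct (F z Hz) as [F1 F2]. destruct (garsia_le_self _ _ _ F1) as [F3 _].
      eapply l2_le_weaken; [exact F3|]. specialize (HI0 i Hi).
      pose proof (Cmod_triangle (- (y i 0%nat - x 0%nat)) (y i 0%nat)) as T. rewrite Cmod_opp in T.
      replace (- (y i 0%nat - x 0%nat) + y i 0%nat)%C with (x 0%nat) in T by ring. lra. }
    split; [apply (Hgy I0); lia|]. intros n. apply le_epsilon. intros d Hd.
    set (Rm := 2 * M / (1 - Cmod z)).
    pose proof (bdd_nonneg x _ Hx) as HM0.
    assert (HRm : 0 <= Rm) by (apply Rdiv_le_0_compat; lra).
    pose proof (pos_INR n) as Hn.
    set (d' := d / (2 * Rm * (INR n + 1) + 1)).
    assert (HdD : 0 < 2 * Rm * (INR n + 1) + 1).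
    { assert (0 <= 2 * Rm * (INR n + 1)) by (apply Rmult_le_pos; lra). lra. }
    assert (Hd' : 0 < d') by (apply Rdiv_lt_0_compat; auto).
    assert (HI : forall m, exists I, forall i k, (I <= i)%nat -> (k < m)%nat ->
       Cmod (psum (shift (S k) (y i)) z - psum (shift (S k) x) z) <= d').
    { induction m as [|m [I HI]]; [exists 0%nat; intros; lia|].
      destruct (psum_coef_lim (fun i => shift (S m) (y i)) (shift (S m) x) (2 * M) (Cmod z) d') as [I2 HI2]; auto.
      - intros i. apply bdd_shift, Hb.
      - split; [apply Cmod_ge_0 | auto].
      - intros k e' He'. apply (Hlim (S m + k)%nat e' He').
      - exists (Nat.max I I2). intros i k Hi Hk. destruct (Nat.eq_dec k m) as [->|Hne].
        + apply HI2; [lia | lra].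
        + apply HI; lia. }
    destruct (HI n) as [I1 HI1]. set (i := Nat.max I0 I1).
    pose proof (proj2 (Hgy i ltac:(lia)) n) as Hle.
    assert (Hcl : rsum (fun k => Cmod (garsia_coef x z k) ^ 2) n <= rsum (fun k => Cmod (garsia_coef (y i) z k) ^ 2 + 2 * Rm * d') n).
    { apply rsum_le. intros k Hk. specialize (HI1 i k ltac:(lia) Hk).
      unfold garsia_coef. rewrite !Cmod_mult, Cmod_R, Rabs_pos_eq by apply sqrt_pos.
      set (sg := sqrt (1 - Cmod z ^ 2)).
      assert (Hsg : 0 <= sg ^ 2 <= 1).
      { unfold sg. pose proof (Cmod_ge_0 z). rewrite pow2_sqrt by (simpl; nra).
        split; [simpl; nra|]. pose proof (pow2_ge_0 (Cmod z)). lra. }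
      set (a := psum (shift (S k) (y i)) z) in *. set (b := psum (shift (S k) x) z) in *.
      assert (Ha : Cmod a <= Rm) by (apply bdd_psum_le; auto; apply bdd_shift, Hb).
      assert (Hbb : Cmod b <= Rm) by (apply bdd_psum_le; auto; apply bdd_shift, Hx).
      assert (Hab : Rabs (Cmod b ^ 2 - Cmod a ^ 2) <= 2 * Rm * d').
      { apply sq_close; [|split; auto; apply Cmod_ge_0|split; auto; apply Cmod_ge_0].
        rewrite Rabs_minus_sym. eapply Rle_trans; [apply Cmod_diff | apply HI1]. }
      apply Rabs_le_between in Hab. rewrite !Rpow_mult_distr.
      assert (sg ^ 2 * (Cmod b ^ 2 - Cmod a ^ 2) <= 1 * (2 * Rm * d')).
      { assert (0 <= 2 * Rm * d') by (apply Rmult_le_pos; [apply Rmult_le_pos|]; lra).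
        apply Rle_trans with (sg ^ 2 * (2 * Rm * d')); [apply Rmult_le_compat_l; lra|].
        apply Rmult_le_compat_r; lra. }
      lra. }
    rewrite rsum_plus, rsum_const in Hcl.
    assert (2 * Rm * d' * INR n <= d).
    { apply Rle_trans with (d' * (2 * Rm * (INR n + 1) + 1)); [|unfold d'; right; field; lra].
      assert (0 <= d' * Rm) by (apply Rmult_le_pos; lra). nra. }
    lra. }
  apply (inBMOA_intro x (2 * (M + 1))).
  - apply garsia_le_0_l2_le.
    + eapply l2_le_weaken; [apply (Hgx (RtoC 0) 1); [rewrite Cmod_0; lra | lra]|].
      pose proof (Cmod_ge_0 (x 0%nat)). lra.
    + pose proof (proj1 (Hgx (RtoC 0) 1 ltac:(rewrite Cmod_0; lra) ltac:(lra))). lra.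
  - intros z Hz. apply le_epsilon. intros e He.
    destruct (garsia_le_self _ _ _ (Hgx z e Hz He)) as [_ H]. lra.
Qed.

(** * The pairing between H^1 and BMOA *)

Lemma lim_Cmod_le (f : R -> C) (L : C) (K : R) :
  filterlim f (at_left 1) (locally L) -> (forall r, 0 <= r < 1 -> Cmod (f r) <= K) -> Cmod L <= K.
Proof.
  intros HL HK. apply le_epsilon. intros e He.
  pose proof (proj1 (C_filterlim (at_left 1) f L) HL e He) as H1.
  assert (H2 : at_left 1 (fun r => 0 < r < 1)) by (apply (at_left_1 0); [lra | auto]).
  destruct (filter_ex (F := at_left 1) _ (filter_and _ _ H1 H2)) as [r [Hr1 Hr2]].
  specialize (HK r ltac:(lra)).
  replace L with (f r - (f r - L))%C by ring. unfold Cminus at 1.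
  eapply Rle_trans; [apply Cmod_triangle|]. rewrite Cmod_opp. lra.
Qed.

Lemma beta_bound_BMOA (g h : nat -> C) (r : R) :
  inH1 g -> inBMOA h -> 0 <= r < 1 -> Cmod (beta g h r) <= fefferman * bmo h * h1 g.
Proof.
  intros Hg Hh Hr. destruct (inBMOA_spec h Hh) as (H1 & H2 & H3 & H4).
  pose proof (h1_nonneg g Hg) as Hn. pose proof fefferman_pos as HC.
  apply le_epsilon. intros e He.
  (* [beta_bound] requires a positive Garsia bound, while [bmo h] may be 0; [d] supplies a
     margin. *)
  set (d := e / (fefferman * h1 g + 1)).
  assert (HD : 0 < fefferman * h1 g + 1) by (assert (0 <= fefferman * h1 g) by (apply Rmult_le_pos; lra); lra).
  assert (Hd : 0 < d) by (apply Rdiv_lt_0_compat; auto).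
  apply Rle_trans with (fefferman * (bmo h + d) * h1 g).
  - apply (beta_bound g h (2 * bmo h)); auto; try lra.
    intros z Hz. eapply l2_le_weaken; [apply H3; auto | lra].
  - assert (fefferman * h1 g * d <= e).
    { apply Rle_trans with ((fefferman * h1 g + 1) * d); [apply Rmult_le_compat_r; lra|].
      unfold d. right. field. lra. }
    lra.
Qed.

Lemma pairing_spec (g h : nat -> C) :
  inH1 g -> inBMOA h ->
  filterlim (beta g h) (at_left 1) (locally (pairing g h)) /\ Cmod (pairing g h) <= fefferman * bmo h * h1 g.
Proof.
  intros Hg Hh. destruct (inBMOA_spec h Hh) as (H1 & H2 & H3 & H4).
  destruct (beta_limit g h (2 * bmo h) (bmo h + 1) Hg H1) as [L HL]; [lra| |].
  { intros z Hz. eapply l2_le_weaken; [apply H3; auto | lra]. }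
  pose proof (pairing_lim g h _ _ L (proj1 (inH1_spec g Hg)) (inBMOA_bdd h Hh) HL) as E.
  rewrite E. split; auto. apply (lim_Cmod_le (beta g h) L); auto.
  intros r Hr. apply beta_bound_BMOA; auto.
Qed.

Lemma H1_dual_le_nonneg (h : nat -> C) (M : R) : H1_dual_le h M -> 0 <= M.
Proof. intros H. eapply Rle_trans; [apply Cmod_ge_0 | apply (H1_dual_le_coef h M 0 H)]. Qed.

(** The converse of Fefferman's inequality. One [M] is for the constant coefficient, the other for
    the Garsia seminorm. *)
Lemma H1_dual_le_inBMOA (h : nat -> C) (M : R) :
  H1_dual_le h M -> inBMOA h /\ is_finite (BMOAnorm h) /\ bmo h <= 2 * M.
Proof.
  intros HA. pose proof (H1_dual_le_nonneg h M HA) as HM. replace (2 * M) with (M + M) by ring.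
  apply (inBMOA_intro2 h (2 * M)).
  - apply H1_dual_le_l2_le; auto.
  - apply H1_dual_le_coef; auto.
  - intros z Hz. apply (H1_dual_le_garsia_le h M); auto. intros k. apply H1_dual_le_coef; auto.
Qed.

Lemma ex_series_finite (c : nat -> C) (n : nat) : ex_series (fun k => Cmod (trunc n c k)).
Proof.
  apply (ex_series_bounded _ (rsum (fun k => Cmod (trunc n c k)) n) (fun k => Cmod_ge_0 _)).
  intros m. rewrite <- (rsum_support (fun k => Cmod (trunc n c k)) n (n + m)).
  - apply rsum_incr; [intros; apply Cmod_ge_0 | lia].
  - intros k Hk. now rewrite trunc_out, Cmod_0 by auto.
  - lia.
Qed.

Lemma H1_dual_le_summable (c : nat -> C) : ex_series (fun k => Cmod (c k)) -> H1_dual_le c (Series (fun k => Cmod (c k))).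
Proof.
  intros Hs n q A HA.
  assert (Hp : forall k, 0 <= Cmod (c k)) by (intros; apply Cmod_ge_0).
  assert (Hh : holo_disk (trunc n q)) by exact (bdd_holo _ _ (summable_bdd _ (ex_series_finite q n))).
  pose proof (bdd_of_mean1 (trunc n q) A Hh HA) as Hb.
  eapply Rle_trans; [apply (Cmod_csum _ (fun k => A * Cmod (c k)))|].
  - intros k Hk. unfold cmul. rewrite Cmod_mult. apply Rmult_le_compat_r; auto.
    specialize (Hb k). unfold trunc in Hb. destruct (lt_dec k n); [auto|lia].
  - rewrite rsum_scal, Rmult_comm. apply Rmult_le_compat_r; [eapply bdd_nonneg; eauto|].
    apply rsum_le_Series; auto.
Qed.

(** * VMOA: closedness, summable sequences, dilations *)

Lemma inVMOA_spec (f : nat -> C) :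
  inVMOA f -> inBMOA f /\ forall eps, 0 < eps -> exists d, 0 <= d < 1 /\
    forall z, d < Cmod z < 1 -> garsia f z < eps.
Proof.
  intros [Hf Hv]. split; auto. intros eps He. destruct (inBMOA_spec f Hf) as (Hl & _).
  destruct (Hv (eps ^ 2) (pow_lt eps 2 He)) as (d & Hd & H).
  exists (Rmax 0 d). split; [split; [apply Rmax_l | apply Rmax_lub_lt; lra]|].
  intros z Hz. pose proof (Rmax_r 0 d). specialize (H z ltac:(lra)).
  rewrite (garsia_sq_eq f _ z Hl ltac:(lra)) in H.
  rewrite Rabs_pos_eq in H by apply pow2_ge_0.
  apply Rnot_le_lt. intros Hle. pose proof (pow_incr eps (garsia f z) 2 ltac:(lra)). lra.
Qed.

Lemma inVMOA_intro (f : nat -> C) :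
  inBMOA f -> (forall eps, 0 < eps -> exists d, d < 1 /\ forall z, d < Cmod z < 1 -> garsia f z < eps) ->
  inVMOA f.
Proof.
  intros Hf H. split; auto. intros eps He. destruct (inBMOA_spec f Hf) as (Hl & _).
  destruct (H (sqrt eps) (sqrt_lt_R0 eps He)) as (d & Hd & H1). exists d. split; auto.
  intros z Hz. rewrite (garsia_sq_eq f _ z Hl ltac:(lra)).
  rewrite Rabs_pos_eq by apply pow2_ge_0. specialize (H1 z Hz).
  rewrite <- (pow2_sqrt eps) by lra. pose proof (garsia_nonneg f z). nra.
Qed.

Lemma inVMOA_plus (f g : nat -> C) : inVMOA f -> inVMOA g -> inVMOA (cadd f g).
Proof.
  intros Hf Hg. destruct (inVMOA_spec f Hf) as [F1 F2]. destruct (inVMOA_spec g Hg) as [G1 G2].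
  apply inVMOA_intro; [apply inBMOA_plus; auto|]. intros eps He.
  destruct (F2 (eps / 2) ltac:(lra)) as (d1 & Hd1 & H1).
  destruct (G2 (eps / 2) ltac:(lra)) as (d2 & Hd2 & H2).
  exists (Rmax d1 d2). split; [apply Rmax_lub_lt; lra|]. intros z Hz.
  pose proof (Rmax_l d1 d2). pose proof (Rmax_r d1 d2).
  specialize (H1 z ltac:(lra)). specialize (H2 z ltac:(lra)).
  pose proof (garsia_plus f g z F1 G1 ltac:(lra)). lra.
Qed.

Lemma inVMOA_scal (l : C) (f : nat -> C) : inVMOA f -> inVMOA (cscal l f).
Proof.
  intros Hf. destruct (inVMOA_spec f Hf) as [F1 F2].
  apply inVMOA_intro; [apply inBMOA_scal; auto|]. intros eps He. pose proof (Cmod_ge_0 l).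
  destruct (F2 (eps / (Cmod l + 1)) ltac:(apply Rdiv_lt_0_compat; lra)) as (d & Hd & H1).
  exists d. split; [lra|]. intros z Hz. specialize (H1 z Hz).
  eapply Rle_lt_trans; [apply garsia_scal; auto; lra|]. pose proof (garsia_nonneg f z).
  apply Rle_lt_trans with ((Cmod l + 1) * garsia f z); [nra|].
  apply Rlt_le_trans with ((Cmod l + 1) * (eps / (Cmod l + 1))); [|right; field; lra].
  apply Rmult_lt_compat_l; lra.
Qed.

Lemma inVMOA_sub (f g : nat -> C) : inVMOA f -> inVMOA g -> inVMOA (csub f g).
Proof. intros Hf Hg. rewrite csub_cadd. apply inVMOA_plus; auto. apply inVMOA_scal; auto. Qed.

Lemma garsia_le_bmo (f : nat -> C) (z : C) : inBMOA f -> Cmod z < 1 -> garsia f z <= bmo f.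
Proof.
  intros Hf Hz. destruct (inBMOA_spec f Hf) as (_ & _ & H & _). destruct (H z Hz) as [_ H1].
  pose proof (Cmod_ge_0 (f 0%nat)). lra.
Qed.

Lemma inVMOA_closed (f : nat -> C) :
  inBMOA f -> (forall eps, 0 < eps -> exists p, inVMOA p /\ bmo (csub f p) <= eps) -> inVMOA f.
Proof.
  intros Hf H. apply inVMOA_intro; auto. intros eps He.
  destruct (H (eps / 2) ltac:(lra)) as (p & Hp & Hn). destruct (inVMOA_spec p Hp) as [P1 P2].
  destruct (P2 (eps / 2) ltac:(lra)) as (d & Hd & H1). exists d. split; [lra|].
  intros z Hz. specialize (H1 z Hz). destruct (inBMOA_sub f p Hf P1) as (H2 & _).
  rewrite <- (cadd_csub f p). pose proof (garsia_plus p (csub f p) z P1 H2 ltac:(lra)).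
  pose proof (garsia_le_bmo (csub f p) z H2 ltac:(lra)). lra.
Qed.

Lemma ex_series_trunc_sub (c : nat -> C) (n : nat) :
  ex_series (fun k => Cmod (c k)) ->
  ex_series (fun k => Cmod (csub c (trunc n c) k)) /\
  Series (fun k => Cmod (csub c (trunc n c) k)) <= tail (fun k => Cmod (c k)) n.
Proof.
  intros Hs. assert (Hp : forall k, 0 <= Cmod (c k)) by (intros; apply Cmod_ge_0).
  assert (Hle : forall m, rsum (fun k => Cmod (csub c (trunc n c) k)) m <= tail (fun k => Cmod (c k)) n).
  { intros m.
    eapply Rle_trans; [apply (rsum_incr _ m (n + m)%nat (fun k => Cmod_ge_0 _)); lia|].
    rewrite rsum_split. rewrite (rsum_ext _ (fun _ => 0)).
    - rewrite rsum_const, Rmult_0_r, Rplus_0_l.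
      rewrite (rsum_ext _ (fun k => Cmod (c (n + k)%nat))).
      + unfold tail. pose proof (rsum_le_Series _ (n + m)%nat Hp Hs) as H. rewrite rsum_split in H. lra.
      + intros k _. unfold csub. rewrite trunc_out by lia. f_equal. ring.
    - intros k Hk. unfold csub, trunc. destruct (lt_dec k n); [|lia].
      replace (c k - c k)%C with (RtoC 0) by ring. apply Cmod_0. }
  assert (Hex : ex_series (fun k => Cmod (csub c (trunc n c) k)))
    by (apply (ex_series_bounded _ _ (fun k => Cmod_ge_0 _) Hle)).
  split; auto. apply Series_le_bound; auto.
Qed.

Lemma inBMOA_summable (c : nat -> C) :
  ex_series (fun k => Cmod (c k)) ->
  inBMOA c /\ is_finite (BMOAnorm c) /\ bmo c <= 2 * Series (fun k => Cmod (c k)).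
Proof. intros Hs. apply H1_dual_le_inBMOA, H1_dual_le_summable, Hs. Qed.

Lemma inVMOA_trunc (c : nat -> C) (n : nat) : inVMOA (trunc n c).
Proof.
  pose proof (ex_series_finite c n) as Hs. destruct (inBMOA_summable _ Hs) as (Hb & _).
  apply inVMOA_intro; auto. intros eps He.
  pose proof (inBMOA_bdd _ Hb) as HB. set (B := 2 * bmo (trunc n c)) in *.
  pose proof (bdd_nonneg _ _ HB) as HB0. pose proof (pos_INR n) as Hn.
  (* There are [n] Garsia coefficients, each apart from its weight a sum of at most [n] terms
     bounded by [B]; the factor [1 - |z|^2] then drives the whole to 0. *)
  set (K := INR n * (INR n * B) ^ 2 + 1).
  assert (HK : 1 <= K) by (unfold K; assert (0 <= INR n * (INR n * B) ^ 2) by (apply Rmult_le_pos; auto; apply pow2_ge_0); lra).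
  destruct (pow_close_1 2 (eps ^ 2 / K) ltac:(apply Rdiv_lt_0_compat; [apply pow_lt; auto | lra])) as (d & Hd & HH).
  exists (1 - d). split; [lra|]. intros z Hz. specialize (HH (Cmod z) ltac:(lra)).
  pose proof (Cmod_ge_0 z) as Hz0.
  assert (Hpos : 0 <= 1 - Cmod z ^ 2) by (simpl; nra).
  assert (H1 : garsia (trunc n c) z ^ 2 <= (1 - Cmod z ^ 2) * (K - 1)).
  { rewrite (garsia_finite _ n) by (intros; apply trunc_out; auto).
    replace ((1 - Cmod z ^ 2) * (K - 1)) with (INR n * ((1 - Cmod z ^ 2) * (INR n * B) ^ 2)) by (unfold K; ring).
    rewrite <- rsum_const. apply rsum_le. intros m _. unfold garsia_coef.
    rewrite Cmod_mult, Cmod_R, Rabs_pos_eq, Rpow_mult_distr, pow2_sqrt by (auto; apply sqrt_pos).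
    apply Rmult_le_compat_l; auto. apply pow_incr. split; [apply Cmod_ge_0|].
    rewrite (psum_finite _ _ n) by (intros k Hk; apply trunc_out; lia).
    eapply Rle_trans; [apply Cmod_psum_upto_le; lra|]. rewrite <- rsum_const. apply rsum_le. intros k _. apply HB. }
  assert (H2 : (1 - Cmod z ^ 2) * (K - 1) < eps ^ 2).
  { apply Rle_lt_trans with ((1 - Cmod z ^ 2) * K); [apply Rmult_le_compat_l; lra|].
    apply Rlt_le_trans with (eps ^ 2 / K * K); [|right; field; lra]. apply Rmult_lt_compat_r; lra. }
  pose proof (garsia_nonneg (trunc n c) z). apply Rnot_le_lt. intros Hle.
  pose proof (pow_incr eps (garsia (trunc n c) z) 2 ltac:(lra)). lra.
Qed.

Lemma inVMOA_summable (c : nat -> C) : ex_series (fun k => Cmod (c k)) -> inVMOA c.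
Proof.
  intros Hs. apply inVMOA_closed; [apply inBMOA_summable; auto|]. intros eps He.
  destruct (tail_lim _ (eps / 2) Hs ltac:(lra)) as [N HN]. specialize (HN N ltac:(lia)).
  apply Rabs_lt_between in HN. exists (trunc N c). split; [apply inVMOA_trunc|].
  destruct (ex_series_trunc_sub c N Hs) as [H1 H2]. destruct (inBMOA_summable _ H1) as (_ & _ & H3). lra.
Qed.

(** The Garsia coefficient of index [m] of the dilation at [z] is that of [f] at [r z], multiplied
    by [r ^ (m + 1)] and with the smaller weight [1 - |z|^2] in place of [1 - |r z|^2]. *)
Lemma garsia_dil (f : nat -> C) (B M r : R) (z : C) :
  bdd f B -> 0 <= r < 1 -> Cmod z < 1 -> garsia_le f (RtoC r * z)%C M -> garsia_le (dil r f) z M.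
Proof.
  intros Hf Hr Hz [HM H]. split; auto. intros n. eapply Rle_trans; [|apply (H n)].
  apply rsum_le. intros m _. pose proof (Cmod_ge_0 z) as Hz0.
  assert (Hrz : Cmod (RtoC r * z)%C = r * Cmod z) by (rewrite Cmod_mult, Cmod_R, Rabs_pos_eq; lra).
  assert (E : psum (shift (S m) (dil r f)) z = (RtoC (r ^ S m) * psum (shift (S m) f) (RtoC r * z))%C).
  { rewrite <- psum_dil, <- psum_scal.
    - f_equal. apply functional_extensionality. intros k. unfold shift, dil, cscal.
      rewrite pow_add, RtoC_mult. ring.
    - apply (bdd_ex _ B); auto. apply bdd_dil; [|lra]. apply bdd_shift; auto. }
  unfold garsia_coef. rewrite E, !Cmod_mult, !Cmod_R, (Rabs_pos_eq r) by lra.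
  rewrite (Rabs_pos_eq (r ^ S m)) by (apply pow_le; lra). rewrite !Rabs_pos_eq by apply sqrt_pos.
  apply pow_incr. split.
  - apply Rmult_le_pos; [apply sqrt_pos|].
    apply Rmult_le_pos; [apply pow_le; lra | apply Cmod_ge_0].
  - assert (r ^ S m <= 1) by (rewrite <- (pow1 (S m)); apply pow_incr; lra).
    assert (0 <= r ^ S m) by (apply pow_le; lra).
    apply Rmult_le_compat.
    + apply sqrt_pos.
    + apply Rmult_le_pos; auto. apply Cmod_ge_0.
    + apply sqrt_le_1_alt.
      assert ((r * Cmod z) ^ 2 <= Cmod z ^ 2) by (apply pow_incr; split; [apply Rmult_le_pos; lra | nra]). lra.
    + pose proof (Cmod_ge_0 (psum (shift (S m) f) (RtoC r * z)%C)). nra.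
Qed.

(** On the disk of radius [d'] closeness in l^2 suffices. Outside it, [f] at [z] and its dilation
    are separately small, the latter because [garsia_dil] compares it with [f] at [r z]. *)
Lemma dil_close_VMOA (f : nat -> C) (eps : R) :
  inVMOA f -> 0 < eps -> exists r, 0 < r < 1 /\ inBMOA (csub f (dil r f)) /\ bmo (csub f (dil r f)) <= eps.
Proof.
  intros Hf He. destruct (inVMOA_spec f Hf) as [Hb Hv].
  destruct (inBMOA_spec f Hb) as (Hl & HN & Hg & _). pose proof (inBMOA_bdd f Hb) as HB.
  destruct (Hv (eps / 2) ltac:(lra)) as (d & Hd & H1).
  set (d' := (1 + d) / 2). assert (Hd' : d < d' < 1) by (unfold d'; lra).
  destruct (garsia_const_mono d' d') as [HG _]; [lra|].
  destruct (l2_le_dil_close f (2 * bmo f) (eps / garsia_const d') Hl ltac:(apply Rdiv_lt_0_compat; auto)) as (r0 & Hr0 & Hr).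
  (* The second entry keeps [|r z| > d] for [|z| > d']. *)
  set (r := Rmax ((1 + r0) / 2) (d / d')).
  assert (Hdd : 0 <= d / d' < 1).
  { split; [apply Rdiv_le_0_compat; lra|]. apply Rmult_lt_reg_r with d'; [lra|].
    unfold Rdiv. rewrite Rmult_assoc, Rinv_l; lra. }
  assert (Hr1 : r0 < r < 1).
  { split; [apply Rlt_le_trans with ((1 + r0) / 2); [lra | apply Rmax_l] | apply Rmax_lub_lt; lra]. }
  assert (Hrd : d <= r * d').
  { apply Rle_trans with (d / d' * d'); [right; field; lra|]. apply Rmult_le_compat_r; [lra | apply Rmax_r]. }
  specialize (Hr r Hr1). exists r. split; [lra|].
  assert (Hz : forall z, Cmod z < 1 -> garsia_le (csub f (dil r f)) z eps).
  { intros z Hz. destruct (Rle_lt_dec (Cmod z) d') as [Hzd|Hzd].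
    - eapply l2_le_weaken; [apply (garsia_le_l2_le _ _ z Hr Hz)|].
      apply Rle_trans with (garsia_const d' * (eps / garsia_const d')); [|right; field; lra].
      apply Rmult_le_compat_r; [left; apply Rdiv_lt_0_compat; auto|]. apply garsia_const_mono; lra.
    - assert (Hrz : Cmod (RtoC r * z)%C = r * Cmod z) by (rewrite Cmod_mult, Cmod_R, Rabs_pos_eq; lra).
      assert (Hrz1 : d < Cmod (RtoC r * z)%C < 1) by (rewrite Hrz; split; nra).
      destruct (garsia_le_self _ _ _ (proj1 (Hg z Hz))) as [A1 _].
      destruct (garsia_le_self _ _ _ (proj1 (Hg (RtoC r * z)%C (proj2 Hrz1)))) as [A2 _].
      assert (A3 : garsia_le (dil r f) z (garsia f (RtoC r * z)%C)) by (apply (garsia_dil f (2 * bmo f)); auto; lra).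
      eapply l2_le_weaken;
        [exact (garsia_le_sub f (dil r f) _ _ _ _ z HB (bdd_dil f _ r HB ltac:(lra)) Hz A1 A3)|].
      pose proof (H1 z ltac:(lra)). pose proof (H1 _ Hrz1). lra. }
  destruct (inBMOA_intro2 (csub f (dil r f)) (eps / garsia_const d') 0 eps) as (H2 & _ & H3); auto.
  - unfold csub, dil. simpl pow. replace (f 0%nat - f 0%nat * 1)%C with (RtoC 0) by ring. rewrite Cmod_0. lra.
  - split; auto. lra.
Qed.

(** * Uniform boundedness *)

Lemma ub_lub (E : R -> Prop) (C x : R) :
  E x -> (forall y, E y -> y <= C) -> exists K, (forall y, E y -> y <= K) /\
    forall e, 0 < e -> exists y, E y /\ K - e < y.
Proof.
  intros Hx HC. destruct (Lub_bounded E C x Hx HC) as (H1 & H2 & H3).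
  exists (real (Lub_Rbar E)). split; auto. intros e He. apply NNPP. intros Hno.
  destruct (Lub_Rbar_correct E) as [_ H4].
  specialize (H4 (Finite (real (Lub_Rbar E) - e))).
  assert (Hub : is_ub_Rbar E (real (Lub_Rbar E) - e)).
  { intros y Hy. simpl. apply Rnot_lt_le. intros Hlt. apply Hno. exists y. auto. }
  specialize (H4 Hub). rewrite <- H1 in H4. simpl in H4. lra.
Qed.

Lemma cscal_cscal (s t : R) (f : nat -> C) : s * t = 1 -> cscal (RtoC s) (cscal (RtoC t) f) = f.
Proof.
  intros H. apply functional_extensionality. intros k. unfold cscal.
  rewrite Cmult_assoc, <- RtoC_mult, H. ring.
Qed.

Section UniformBoundedness.

Variables (X : (nat -> C) -> Prop) (N : (nat -> C) -> R).
Hypothesis X_plus : forall f g, X f -> X g -> X (cadd f g) /\ N (cadd f g) <= N f + N g.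
Hypothesis X_scal : forall l f, X f -> X (cscal l f) /\ N (cscal l f) <= Cmod l * N f.
Hypothesis N_nonneg : forall f, X f -> 0 <= N f.
(** Completeness at the one rate used below. The bound is the geometric tail: the sum of [(/ 3) ^ i]
    over [i > j] equals [/ 2 * (/ 3) ^ j]. *)
Hypothesis X_complete : forall x : nat -> nat -> C, (forall j, X (x j)) ->
  (forall j, N (csub (x (S j)) (x j)) <= (/ 3) ^ j) ->
  exists y, X y /\ forall j, N (csub y (x (S j))) <= / 2 * (/ 3) ^ j.

Variables (I : Type) (q : I -> (nat -> C) -> R).
Hypothesis q_plus : forall i f g, X f -> X g -> q i (cadd f g) <= q i f + q i g.
Hypothesis q_scal : forall i l f, X f -> q i (cscal l f) <= Cmod l * q i f.
Hypothesis q_nonneg : forall i f, X f -> 0 <= q i f.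
Hypothesis q_bound : forall i, exists c, forall f, X f -> q i f <= c * N f.

Lemma X_sub (f g : nat -> C) : X f -> X g -> X (csub f g).
Proof. intros Hf Hg. rewrite csub_cadd. apply X_plus; auto. apply X_scal; auto. Qed.

(** [K] is the operator norm of [q i], nearly attained on the unit ball. Rescaling extends the bound
    to all of [X], except where [N f = 0]; there [q_bound] applies. *)
Lemma q_norm (i : I) (f0 : nat -> C) : X f0 -> exists K, 0 <= K /\ (forall f, X f -> q i f <= K * N f) /\
  forall e, 0 < e -> exists f, X f /\ N f <= 1 /\ K - e < q i f.
Proof.
  intros Hf0. destruct (q_bound i) as [c Hc].
  set (E := fun y => exists f, X f /\ N f <= 1 /\ y = q i f).
  set (o := cscal (RtoC 0) f0). destruct (X_scal (RtoC 0) f0 Hf0) as [Ho1 Ho2].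
  rewrite Cmod_0, Rmult_0_l in Ho2.
  destruct (ub_lub E (Rmax 0 c) (q i o)) as (K & HK1 & HK2).
  - exists o. repeat split; auto. unfold o. lra.
  - intros y (f & Hf & Hn & ->). eapply Rle_trans; [apply Hc; auto|].
    pose proof (N_nonneg f Hf). pose proof (Rmax_l 0 c). pose proof (Rmax_r 0 c). nra.
  - exists K. split; [|split].
    + eapply Rle_trans; [apply (q_nonneg i o Ho1)|]. apply HK1. exists o. repeat split; auto. unfold o. lra.
    + intros f Hf. pose proof (N_nonneg f Hf) as Hn. destruct (Req_dec (N f) 0) as [E0|E0].
      * specialize (Hc f Hf). rewrite E0, Rmult_0_r in *. auto.
      * assert (Hp : 0 < N f) by lra.
        set (g := cscal (RtoC (/ N f)) f).
        assert (Hm : Cmod (RtoC (/ N f)) = / N f).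
        { rewrite Cmod_R, Rabs_pos_eq; auto. left. now apply Rinv_0_lt_compat. }
        destruct (X_scal (RtoC (/ N f)) f Hf) as [Hg1 Hg2]. fold g in Hg1, Hg2.
        rewrite Hm, Rinv_l in Hg2 by lra.
        assert (HgK : q i g <= K) by (apply HK1; exists g; auto).
        assert (Ef : f = cscal (RtoC (N f)) g).
        { symmetry. apply cscal_cscal. apply Rinv_r. lra. }
        rewrite Ef at 1. eapply Rle_trans; [apply q_scal; auto|].
        rewrite Cmod_R, Rabs_pos_eq by lra. rewrite Rmult_comm. apply Rmult_le_compat_r; lra.
    + intros e He. destruct (HK2 e He) as (y & (f & Hf & Hn & ->) & Hy). exists f. auto.
Qed.

(* One step of the gliding hump: of [q (x + v)] and [q (x - v)] one is at least [q v]. *)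
Lemma gliding_step (j : nat) (x : nat -> C) :
  ~ (exists K, forall i f, X f -> q i f <= K * N f) -> X x ->
  exists x', X x' /\ N (csub x' x) <= (/ 3) ^ j /\
    exists i, forall w, X w -> N (csub w x') <= / 2 * (/ 3) ^ j -> INR j <= q i w.
Proof.
  intros q_unbounded Hx. set (t := (/ 3) ^ j). assert (Ht : 0 < t) by (apply pow_lt; lra).
  (* The hump has size at least [t * (3 / 4 * K)], and later points lose at most [K * (/ 2 * t)] of
     it. What remains is [t * K / 4], and [K > L] makes [t * K >= 12 * INR j]. *)
  set (L := 12 * INR j / t + 1). pose proof (pos_INR j) as Hj.
  assert (HL : 0 < L).
  { unfold L. assert (0 <= 12 * INR j / t) by (apply Rdiv_le_0_compat; lra). lra. }
  assert (Hi : exists i f, X f /\ L * N f < q i f).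
  { apply NNPP. intros Hno. apply q_unbounded. exists L. intros i f Hf. apply Rnot_lt_le.
    intros Hlt. apply Hno. exists i, f. auto. }
  destruct Hi as (i & f & Hf & Hlf).
  destruct (q_norm i x Hx) as (K & HK0 & HK1 & HK2).
  assert (HKL : L < K).
  { pose proof (HK1 f Hf) as H1. pose proof (N_nonneg f Hf) as H2. apply Rnot_le_lt. intros Hle.
    assert (K * N f <= L * N f) by (apply Rmult_le_compat_r; auto). lra. }
  destruct (HK2 (K / 4) ltac:(lra)) as (y & Hy & Hny & Hqy).
  set (v := cscal (RtoC t) y).
  destruct (X_scal (RtoC t) y Hy) as [Hv Hnv]. fold v in Hv, Hnv.
  rewrite Cmod_R, Rabs_pos_eq in Hnv by lra.
  assert (Hnv1 : N v <= t) by nra.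
  assert (Hqv : t * (3 / 4 * K) <= q i v).
  { assert (Ey : y = cscal (RtoC (/ t)) v).
    { symmetry. apply cscal_cscal. apply Rinv_l. lra. }
    assert (Hle : q i y <= / t * q i v).
    { rewrite Ey at 1. eapply Rle_trans; [apply q_scal; auto|].
      rewrite Cmod_R, Rabs_pos_eq; [lra|]. left. now apply Rinv_0_lt_compat. }
    apply Rle_trans with (t * q i y); [apply Rmult_le_compat_l; lra|].
    apply Rle_trans with (t * (/ t * q i v)); [apply Rmult_le_compat_l; lra|]. right. field. lra. }
  assert (Hmv : X (cscal (RtoC (-1)) v) /\ N (cscal (RtoC (-1)) v) <= t).
  { destruct (X_scal (RtoC (-1)) v Hv) as [H1 H2]. rewrite Cmod_m1' in H2. split; auto. lra. }
  assert (Hbig : exists v', X v' /\ N v' <= t /\ q i v <= q i (cadd x v')).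
  { set (a := cadd x v). set (b := cadd x (cscal (RtoC (-1)) v)).
    assert (Ha : X a) by (apply X_plus; auto). assert (Hb : X b) by (apply X_plus; auto; apply Hmv).
    assert (H2 : 2 * q i v <= q i a + q i b).
    { assert (Hb' : X (cscal (RtoC (-1)) b)) by (apply X_scal; auto).
      pose proof (q_plus i a _ Ha Hb') as H3. pose proof (q_scal i (RtoC (-1)) b Hb) as H4.
      rewrite Cmod_m1' in H4.
      assert (E : v = cscal (RtoC (/ 2)) (cadd a (cscal (RtoC (-1)) b))).
      { rewrite <- (cscal_cscal (/ 2) 2 v) by field. f_equal.
        apply functional_extensionality. intros k. unfold a, b, cadd, cscal. ring. }
      pose proof (q_scal i (RtoC (/ 2)) (cadd a (cscal (RtoC (-1)) b)) (proj1 (X_plus _ _ Ha Hb'))) as H5.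
      rewrite <- E, Cmod_R, Rabs_pos_eq in H5 by lra. lra. }
    destruct (Rle_lt_dec (q i v) (q i a)).
    - exists v. auto.
    - exists (cscal (RtoC (-1)) v). split; [apply Hmv|]. split; [apply Hmv|]. fold b. lra. }
  destruct Hbig as (v' & Hv' & Hnv' & Hq'). exists (cadd x v').
  assert (Hx' : X (cadd x v')) by (apply X_plus; auto). split; auto. split.
  - replace (csub (cadd x v') x) with v'; auto.
    apply functional_extensionality. intros k. unfold csub, cadd. ring.
  - exists i. intros w Hw Hnw.
    assert (Hs : X (csub w (cadd x v'))) by (apply X_sub; auto).
    assert (Hms : X (cscal (RtoC (-1)) (csub w (cadd x v')))) by (apply X_scal; auto).
    pose proof (q_plus i w _ Hw Hms) as H1. pose proof (q_scal i (RtoC (-1)) _ Hs) as H2.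
    rewrite Cmod_m1' in H2. pose proof (HK1 _ Hs) as H3.
    assert (E : cadd w (cscal (RtoC (-1)) (csub w (cadd x v'))) = cadd x v').
    { apply functional_extensionality. intros k. unfold csub, cadd, cscal. ring. }
    rewrite E in H1.
    assert (H4 : K * N (csub w (cadd x v')) <= K * (/ 2 * t)) by (apply Rmult_le_compat_l; auto).
    assert (H5 : 12 * INR j <= t * K).
    { apply Rle_trans with (t * L); [|apply Rmult_le_compat_l; lra].
      unfold L. replace (t * (12 * INR j / t + 1)) with (12 * INR j + t) by (field; lra). lra. }
    lra.
Qed.

(** Without a common bound, iterating [gliding_step] yields a limit [w] such that for each [j] some
    [q i w] is at least [INR j], against pointwise boundedness. *)
Lemma uniform_boundedness :
  (forall f, X f -> exists B, forall i, q i f <= B) ->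
  exists K, forall i f, X f -> q i f <= K * N f.
Proof.
  intros Hpt. apply NNPP. intros Hno.
  assert (Hx : exists x0, X x0).
  { apply NNPP. intros Hn. apply Hno. exists 0. intros i f Hf. exfalso. apply Hn. exists f. auto. }
  destruct Hx as [x0 Hx0].
  (* The membership [X x] is placed under the existential so that the choice function [step] is
     total. *)
  assert (Hch : forall j x, exists x', X x -> X x' /\ N (csub x' x) <= (/ 3) ^ j /\
    exists i, forall w, X w -> N (csub w x') <= / 2 * (/ 3) ^ j -> INR j <= q i w).
  { intros j x. destruct (classic (X x)) as [Hx|Hx].
    - destruct (gliding_step j x Hno Hx) as [x' H]. exists x'. auto.
    - exists x. tauto. }
  set (step := fun j x => proj1_sig (constructive_indefinite_description _ (Hch j x))).
  assert (Hstep : forall j x, X x -> X (step j x) /\ N (csub (step j x) x) <= (/ 3) ^ j /\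
    exists i, forall w, X w -> N (csub w (step j x)) <= / 2 * (/ 3) ^ j -> INR j <= q i w).
  { intros j x. unfold step. destruct (constructive_indefinite_description _ (Hch j x)). auto. }
  set (xs := fix xs (j : nat) := match j with O => x0 | S j => step j (xs j) end).
  assert (Hxs : forall j, X (xs j)).
  { induction j as [|j IH]; [exact Hx0|]. apply Hstep; auto. }
  destruct (X_complete xs Hxs) as (w & Hw & Hlim).
  { intros j. apply Hstep; auto. }
  destruct (Hpt w Hw) as [B HB].
  destruct (nfloor_ex (Rmax 0 B) (Rmax_l 0 B)) as [n Hn].
  destruct (Hstep (S n) (xs (S n)) (Hxs (S n))) as (_ & _ & i & Hi).
  specialize (Hi w Hw (Hlim (S n))). specialize (HB i). rewrite S_INR in Hi.
  pose proof (Rmax_r 0 B). lra.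
Qed.

End UniformBoundedness.

(** * Completeness *)

Lemma coef_complete (x : nat -> nat -> C) (c : R) :
  0 <= c ->
  (forall j n k, Cmod (x (S j + n)%nat k - x (S j) k) <= c * (/ 3) ^ j) ->
  exists y, forall k eps, 0 < eps -> exists I, forall i, (I <= i)%nat -> Cmod (x i k - y k) < eps.
Proof.
  intros Hc H.
  assert (Hk : forall k, exists l, forall eps, 0 < eps -> exists I, forall i, (I <= i)%nat -> Cmod (x i k - l) < eps).
  { intros k.
    destruct (proj1 (filterlim_locally_cauchy (U := C_CompleteNormedModule) (F := eventually) (fun i => x i k))) as [l Hl].
    - intros eps. pose proof (cond_pos eps) as He.
      destruct (pow_lt_1_zero (/ 3) ltac:(rewrite Rabs_pos_eq; lra) (eps / 2 / (c + 1))
        ltac:(repeat apply Rdiv_lt_0_compat; lra)) as [J HJ].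
      specialize (HJ J ltac:(lia)). rewrite Rabs_pos_eq in HJ by (apply pow_le; lra).
      exists (fun i => (S J <= i)%nat). split; [exists (S J); auto|].
      assert (Hx : forall i, (S J <= i)%nat -> Cmod (x i k - x (S J) k) < eps / 2).
      { intros i Hi. specialize (H J (i - S J)%nat k). replace (S J + (i - S J))%nat with i in H by lia.
        eapply Rle_lt_trans; [exact H|].
        apply Rle_lt_trans with ((c + 1) * (/ 3) ^ J).
        - apply Rmult_le_compat_r; [apply pow_le|]; lra.
        - apply Rlt_le_trans with ((c + 1) * (eps / 2 / (c + 1))); [apply Rmult_lt_compat_l; lra|].
          right. field. lra. }
      intros u v Hu Hv. apply C_NormedModule_mixin_compat1.
      change (minus (x v k) (x u k)) with (x v k - x u k)%C.
      replace (x v k - x u k)%C with ((x v k - x (S J) k) + - (x u k - x (S J) k))%C by ring.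
      eapply Rle_lt_trans; [apply Cmod_triangle|]. rewrite Cmod_opp.
      pose proof (Hx u Hu). pose proof (Hx v Hv). lra.
    - exists l. intros eps He. exact (proj1 (C_filterlim eventually (fun i => x i k) l) Hl eps He). }
  exists (fun k => proj1_sig (constructive_indefinite_description _ (Hk k))).
  intros k. destruct (constructive_indefinite_description _ (Hk k)) as [l Hl]. exact Hl.
Qed.

(** The factor [1 - (/ 3) ^ n] is the exact partial geometric sum; with it the induction closes. *)
Lemma telescope_bound (X : (nat -> C) -> Prop) (N : (nat -> C) -> R) (x : nat -> nat -> C) :
  (forall f g, X f -> X g -> X (cadd f g) /\ N (cadd f g) <= N f + N g) ->
  (forall l f, X f -> X (cscal l f) /\ N (cscal l f) <= Cmod l * N f) ->
  (forall j, X (x j)) -> (forall j, N (csub (x (S j)) (x j)) <= (/ 3) ^ j) ->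
  forall j n, X (csub (x (S j + n)%nat) (x (S j))) /\
    N (csub (x (S j + n)%nat) (x (S j))) <= / 2 * (/ 3) ^ j * (1 - (/ 3) ^ n).
Proof.
  intros Hp Hs Hx Hn j.
  assert (Hsub : forall f g, X f -> X g -> X (csub f g)).
  { intros f g Hf Hg. rewrite csub_cadd. apply Hp; auto. apply Hs; auto. }
  induction n as [|n [IH1 IH2]].
  - split; [apply Hsub; auto|]. rewrite Nat.add_0_r.
    replace (csub (x (S j)) (x (S j))) with (cscal (RtoC 0) (x (S j))).
    + destruct (Hs (RtoC 0) (x (S j)) (Hx _)) as [_ H]. rewrite Cmod_0 in H. simpl (_ ^ 0). lra.
    + apply functional_extensionality. intros k. unfold cscal, csub. ring.
  - split; [apply Hsub; auto|].
    assert (E : csub (x (S j + S n)%nat) (x (S j))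
      = cadd (csub (x (S (S j + n))) (x (S j + n)%nat)) (csub (x (S j + n)%nat) (x (S j)))).
    { apply functional_extensionality. intros k. unfold cadd, csub.
      replace (S j + S n)%nat with (S (S j + n)) by lia. ring. }
    rewrite E. eapply Rle_trans; [apply Hp; auto|].
    pose proof (Hn (S j + n)%nat) as H1. rewrite pow_add in H1.
    change ((/ 3) ^ S j) with (/ 3 * (/ 3) ^ j) in H1. change ((/ 3) ^ S n) with (/ 3 * (/ 3) ^ n).
    set (a := (/ 3) ^ j) in *. set (b := (/ 3) ^ n) in *. lra.
Qed.

(** Coefficients are dominated by the norm, so a coefficientwise limit exists; [mean1_lsc] carries
    the norm bounds over to it. *)
Lemma H1_complete (x : nat -> nat -> C) :
  (forall j, inH1 (x j)) -> (forall j, h1 (csub (x (S j)) (x j)) <= (/ 3) ^ j) ->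
  exists y, inH1 y /\ forall j, h1 (csub y (x (S j))) <= / 2 * (/ 3) ^ j.
Proof.
  intros Hx Hn.
  pose proof (telescope_bound inH1 h1 x inH1_plus inH1_scal Hx Hn) as HT.
  assert (HT' : forall j n, h1 (csub (x (S j + n)%nat) (x (S j))) <= / 2 * (/ 3) ^ j).
  { intros j n. destruct (HT j n) as [_ H]. eapply Rle_trans; [exact H|].
    assert (0 < (/ 3) ^ j) by (apply pow_lt; lra). assert (0 < (/ 3) ^ n) by (apply pow_lt; lra). nra. }
  destruct (coef_complete x (/ 2) ltac:(lra)) as [y Hy].
  { intros j n k. eapply Rle_trans; [|apply (HT' j n)]. apply (proj1 (inH1_spec _ (proj1 (HT j n)))). }
  assert (Hd : forall j, inH1 (csub y (x (S j))) /\ h1 (csub y (x (S j))) <= / 2 * (/ 3) ^ j).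
  { intros j.
    assert (Hr : forall r, 0 <= r < 1 -> bdd (csub y (x (S j))) (/ 2 * (/ 3) ^ j) /\
      mean1 (csub y (x (S j))) r <= / 2 * (/ 3) ^ j).
    { intros r Hr. apply (mean1_lsc (fun n => csub (x (S j + n)%nat) (x (S j)))); auto.
      - intros n k. eapply Rle_trans; [|apply (HT' j n)]. apply (proj1 (inH1_spec _ (proj1 (HT j n)))).
      - intros n. eapply Rle_trans; [|apply (HT' j n)]. apply (proj2 (inH1_spec _ (proj1 (HT j n)))); auto.
      - intros k eps He. destruct (Hy k eps He) as [I HI]. exists I. intros n Hn'.
        specialize (HI (S j + n)%nat ltac:(lia)). unfold csub.
        replace (x (S j + n)%nat k - x (S j) k - (y k - x (S j) k))%C with (x (S j + n)%nat k - y k)%C by ring.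
        exact HI. }
    destruct (inH1_intro (csub y (x (S j))) (/ 2 * (/ 3) ^ j)) as (A & _ & B); auto.
    - eapply bdd_holo. apply (Hr 0). lra.
    - intros r Hr'. apply Hr; auto. }
  exists y. split; [|intros j; apply Hd].
  rewrite <- (cadd_csub y (x 1%nat)). apply inH1_plus; [apply Hx | apply (Hd 0%nat)].
Qed.

(** As for H^1 but in BMOA, with [inBMOA_lsc]; the limit then lies in VMOA because VMOA is
    closed. *)
Lemma VMOA_complete (x : nat -> nat -> C) :
  (forall j, inVMOA (x j)) -> (forall j, bmo (csub (x (S j)) (x j)) <= (/ 3) ^ j) ->
  exists y, inVMOA y /\ forall j, bmo (csub y (x (S j))) <= / 2 * (/ 3) ^ j.
Proof.
  intros Hx Hn.
  assert (Hb : forall j, inBMOA (x j)) by (intros j; apply Hx).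
  assert (Bp : forall f g, inBMOA f -> inBMOA g -> inBMOA (cadd f g) /\ bmo (cadd f g) <= bmo f + bmo g).
  { intros f g Hf Hg. destruct (inBMOA_plus f g Hf Hg) as (A & _ & B). auto. }
  assert (Bs : forall l f, inBMOA f -> inBMOA (cscal l f) /\ bmo (cscal l f) <= Cmod l * bmo f).
  { intros l f Hf. destruct (inBMOA_scal l f Hf) as (A & _ & B). auto. }
  pose proof (telescope_bound inBMOA bmo x Bp Bs Hb Hn) as HT.
  assert (HT' : forall j n, bmo (csub (x (S j + n)%nat) (x (S j))) <= / 2 * (/ 3) ^ j).
  { intros j n. destruct (HT j n) as [_ H]. eapply Rle_trans; [exact H|].
    assert (0 < (/ 3) ^ j) by (apply pow_lt; lra). assert (0 < (/ 3) ^ n) by (apply pow_lt; lra). nra. }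
  destruct (coef_complete x 1 ltac:(lra)) as [y Hy].
  { intros j n k. pose proof (inBMOA_bdd _ (proj1 (HT j n)) k) as H. pose proof (HT' j n).
    unfold csub at 1 in H. lra. }
  assert (Hd : forall j, inBMOA (csub y (x (S j))) /\ bmo (csub y (x (S j))) <= / 2 * (/ 3) ^ j).
  { intros j.
    destruct (inBMOA_lsc (fun n => csub (x (S j + n)%nat) (x (S j))) (csub y (x (S j))) (/ 2 * (/ 3) ^ j))
      as (A & _ & B); auto.
    - intros n. split; [apply HT | apply HT'].
    - intros k eps He. destruct (Hy k eps He) as [I HI]. exists I. intros n Hn'.
      specialize (HI (S j + n)%nat ltac:(lia)). unfold csub.
      replace (x (S j + n)%nat k - x (S j) k - (y k - x (S j) k))%C with (x (S j + n)%nat k - y k)%C by ring.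
      exact HI. }
  exists y. split; [|intros j; apply Hd].
  apply inVMOA_closed.
  - rewrite <- (cadd_csub y (x 1%nat)). apply inBMOA_plus; [apply Hb | apply (Hd 0%nat)].
  - intros eps He.
    destruct (pow_lt_1_zero (/ 3) ltac:(rewrite Rabs_pos_eq; lra) eps He) as [J HJ].
    specialize (HJ J ltac:(lia)). rewrite Rabs_pos_eq in HJ by (apply pow_le; lra).
    exists (x (S J)). split; auto. destruct (Hd J) as [_ H]. assert (0 < (/ 3) ^ J) by (apply pow_lt; lra). lra.
Qed.

(** * Multipliers *)

Lemma ex_series_cmul (c f : nat -> C) (B : R) :
  ex_series (fun k => Cmod (c k)) -> bdd f B ->
  ex_series (fun k => Cmod (c k * f k)%C) /\
  Series (fun k => Cmod (c k * f k)%C) <= Series (fun k => Cmod (c k)) * B.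
Proof.
  intros Hc Hf. pose proof (bdd_nonneg f B Hf) as HB.
  assert (Hp : forall k, 0 <= Cmod (c k * f k)%C <= Cmod (c k) * B).
  { intros k. split; [apply Cmod_ge_0|]. rewrite Cmod_mult. apply Rmult_le_compat_l; auto using Cmod_ge_0. }
  assert (Hex : ex_series (fun k => Cmod (c k) * B)) by (apply ex_series_scal_r; auto).
  split; [apply (ex_series_mono _ _ Hp Hex)|].
  rewrite <- Series_scal_r. apply Series_le; auto.
Qed.

Lemma psum_1_le (c : nat -> C) :
  ex_series (fun k => Cmod (c k)) -> Cmod (psum c (RtoC 1)) <= Series (fun k => Cmod (c k)).
Proof.
  intros Hs. pose proof (psum_approx c (RtoC 1) _ 0 (majorized_1 c Hs)) as H.
  unfold psum_upto, tail in H. simpl in H. replace (0 - psum c 1)%C with (- psum c 1)%C in H by ring.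
  rewrite Cmod_opp in H. lra.
Qed.

Lemma ex_series_1 (c : nat -> C) :
  ex_series (fun k => Cmod (c k)) -> ex_series (fun k => (c k * pow_n (RtoC 1) k)%C).
Proof. intros H. apply (ex_series_majorized c (RtoC 1) _ (majorized_1 c H)). Qed.

Lemma bounded_of_limit (u : nat -> C) (l : C) :
  filterlim u eventually (locally l) -> exists B, forall n, Cmod (u n) <= B.
Proof.
  intros H. destruct (proj1 (C_filterlim eventually u l) H 1 ltac:(lra)) as [N HN].
  exists (Cmod l + 1 + rsum (fun k => Cmod (u k)) N). intros n.
  pose proof (rsum_nonneg (fun k => Cmod (u k)) N (fun j _ => Cmod_ge_0 _)).
  destruct (le_lt_dec N n) as [Hn|Hn].
  - specialize (HN n Hn). pose proof (Cmod_triangle (u n - l) l) as T.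
    replace (u n - l + l)%C with (u n) in T by ring. lra.
  - pose proof (rsum_incr (fun k => Cmod (u k)) (S n) N (fun j => Cmod_ge_0 _) ltac:(lia)) as H1.
    cbn [rsum] in H1. pose proof (rsum_nonneg (fun k => Cmod (u k)) n (fun j _ => Cmod_ge_0 _)).
    pose proof (Cmod_ge_0 l). lra.
Qed.

Definition delta (k : nat) (j : nat) : C := if Nat.eq_dec j k then RtoC 1 else RtoC 0.

Lemma ex_series_delta (k : nat) : ex_series (fun j => Cmod (delta k j)).
Proof.
  eapply ex_series_ext; [|apply (ex_series_finite (delta k) (S k))].
  intros j. unfold trunc, delta. destruct (lt_dec j (S k)), (Nat.eq_dec j k); auto; lia.
Qed.

Lemma psum_delta (c : nat -> C) (k : nat) : psum (cmul c (delta k)) (RtoC 1) = c k.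
Proof.
  rewrite (psum_finite _ _ (S k)).
  - unfold psum_upto. rewrite (csum_ext _ (fun j => if Nat.eq_dec j k then c j else RtoC 0)).
    + rewrite (csum_delta c k (S k)). destruct (lt_dec k (S k)); [auto|lia].
    + intros j _. rewrite pow_n_RtoC, pow1. unfold cmul, delta. destruct (Nat.eq_dec j k); ring.
  - intros j Hj. unfold cmul, delta. destruct (Nat.eq_dec j k); [lia|ring].
Qed.

(** Dominated convergence for series: the tail of [v] is cut off with the bound [K], and finitely
    many indices remain. *)
Lemma dominated_series (b : nat -> nat -> C) (v : nat -> R) (K eps : R) :
  (forall n k, Cmod (b n k) <= K) -> (forall k, 0 <= v k) -> ex_series v -> 0 < eps ->
  (forall k e, 0 < e -> exists M, forall n, (M <= n)%nat -> Cmod (b n k) < e) ->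
  exists M, forall n, (M <= n)%nat ->
    ex_series (fun k => Cmod (b n k) * v k) /\ Series (fun k => Cmod (b n k) * v k) <= eps.
Proof.
  intros Hb Hv Hs He Hlim.
  assert (HK : 0 <= K) by (eapply Rle_trans; [apply Cmod_ge_0 | apply (Hb 0%nat 0%nat)]).
  destruct (tail_lim v (eps / 2 / (K + 1)) Hs ltac:(repeat apply Rdiv_lt_0_compat; lra)) as [N HN].
  specialize (HN N ltac:(lia)). apply Rabs_lt_between in HN.
  set (S := rsum v N). assert (HS : 0 <= S) by (apply rsum_nonneg; auto).
  set (d := eps / 2 / (S + 1)). assert (Hd : 0 < d) by (repeat apply Rdiv_lt_0_compat; lra).
  assert (HM : forall m, exists M, forall n k, (M <= n)%nat -> (k < m)%nat -> Cmod (b n k) <= d).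
  { induction m as [|m [M1 H1]]; [exists 0%nat; intros; lia|].
    destruct (Hlim m d Hd) as [M2 H2]. exists (Nat.max M1 M2). intros n k Hn Hk.
    destruct (Nat.eq_dec k m) as [->|Hne]; [left; apply H2; lia | apply H1; lia]. }
  destruct (HM N) as [M H]. exists M. intros n Hn.
  assert (Hp : forall k, 0 <= Cmod (b n k) * v k) by (intros; apply Rmult_le_pos; auto using Cmod_ge_0).
  assert (Hle : forall m, rsum (fun k => Cmod (b n k) * v k) m <= eps).
  { intros m. eapply Rle_trans; [apply (rsum_incr _ m (N + m)%nat Hp); lia|]. rewrite rsum_split.
    assert (A1 : rsum (fun k => Cmod (b n k) * v k) N <= d * S).
    { unfold S. rewrite <- rsum_scal. apply rsum_le. intros k Hk. apply Rmult_le_compat_r; auto. }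
    assert (A2 : rsum (fun k => Cmod (b n (N + k)%nat) * v (N + k)%nat) m <= K * tail v N).
    { apply Rle_trans with (K * rsum (fun k => v (N + k)%nat) m).
      - rewrite <- rsum_scal. apply rsum_le. intros k Hk. apply Rmult_le_compat_r; auto.
      - apply Rmult_le_compat_l; auto. pose proof (rsum_le_Series v (N + m)%nat Hv Hs) as T.
        rewrite rsum_split in T. unfold tail. lra. }
    assert (A3 : d * S <= eps / 2).
    { apply Rle_trans with (d * (S + 1)); [apply Rmult_le_compat_l; lra|]. unfold d. right. field. lra. }
    assert (A4 : K * tail v N <= eps / 2).
    { apply Rle_trans with ((K + 1) * (eps / 2 / (K + 1))); [|right; field; lra].
      pose proof (tail_nonneg v N Hv Hs). apply Rmult_le_compat; lra. }
    lra. }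
  assert (Hex : ex_series (fun k => Cmod (b n k) * v k)) by (apply (ex_series_bounded _ eps); auto).
  split; auto. apply Series_le_bound; auto.
Qed.

(** A neighbourhood of a finite point in [Rbar] excludes the infinite values. Finiteness has to be
    recorded, since [real] alone would read an infinite norm as 0. *)
Lemma norm_cvg_iff (N : (nat -> C) -> Rbar) (u : nat -> nat -> C) (v : nat -> C) :
  norm_cvg N u v <->
  forall eps, 0 < eps -> exists M, forall n, (M <= n)%nat ->
    is_finite (N (csub (u n) v)) /\ Rabs (real (N (csub (u n) v))) < eps.
Proof.
  split.
  - intros H eps He.
    apply (H (fun x : Rbar => is_finite x /\ Rabs (real x) < eps)).
    exists (mkposreal eps He). intros y Hy. split; [reflexivity|].
    change (Rabs (y - 0) < eps) in Hy. now rewrite Rminus_0_r in Hy.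
  - intros H Q [e He]. destruct (H e (cond_pos e)) as [M HM].
    exists M. intros n Hn. destruct (HM n Hn) as [H1 H2]. rewrite <- H1.
    apply He. change (Rabs (real (N (csub (u n) v)) - 0) < e). now rewrite Rminus_0_r.
Qed.

Lemma weak_of_norm (X : (nat -> C) -> Prop) (N : (nat -> C) -> Rbar) (u : nat -> nat -> C) (v : nat -> C) :
  (forall n, X (u n)) -> X v -> (forall l f, X f -> X (cscal l f)) ->
  (forall f g, X f -> X g -> X (cadd f g)) -> (forall f, X f -> 0 <= real (N f)) ->
  norm_cvg N u v -> weak_cvg X N u v.
Proof.
  intros Hu Hv Hs Hp HN Hc L (L1 & L2 & M & HM).
  apply (C_filterlim eventually). intros eps He.
  set (K := Rmax 0 M + 1). pose proof (Rmax_l 0 M) as HM0. pose proof (Rmax_r 0 M) as HM1.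
  assert (HK : 0 < K) by (unfold K; lra).
  destruct (proj1 (norm_cvg_iff N u v) Hc (eps / K)) as [n0 H]; [apply Rdiv_lt_0_compat; unfold K; lra|].
  exists n0. intros n Hn. destruct (H n Hn) as [_ Hn']. clear H. rename Hn' into H.
  assert (Hm : X (cscal (RtoC (-1)) v)) by auto.
  assert (E : (L (u n) - L v)%C = L (csub (u n) v)).
  { rewrite csub_cadd, L1, L2; auto. ring. }
  assert (Hsub : X (csub (u n) v)) by (rewrite csub_cadd; auto).
  rewrite E. eapply Rle_lt_trans; [apply HM; auto|].
  pose proof (HN _ Hsub) as H0. rewrite Rabs_pos_eq in H by auto. set (x := real (N (csub (u n) v))) in *.
  apply Rle_lt_trans with (K * x); [apply Rmult_le_compat_r; unfold K; lra|].
  apply Rlt_le_trans with (K * (eps / K)); [apply Rmult_lt_compat_l; lra|].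
  right. field. lra.
Qed.

(** * Bilinearity of the pairing *)

Lemma beta_comm (g h : nat -> C) : beta g h = beta h g.
Proof.
  apply functional_extensionality. intros r. unfold beta. f_equal.
  apply functional_extensionality. intros k. unfold cmul. ring.
Qed.

Lemma at_left_1_unit : at_left 1 (fun r => Cmod (RtoC (r ^ 2)) < 1).
Proof.
  apply (at_left_1 0); [lra|]. intros r Hr. rewrite Cmod_R, Rabs_pos_eq; simpl; nra.
Qed.

Lemma beta_lim_plus (f g h : nat -> C) (A B D : R) (F G : C) :
  bdd f A -> bdd g B -> bdd h D ->
  filterlim (beta f h) (at_left 1) (locally F) -> filterlim (beta g h) (at_left 1) (locally G) ->
  filterlim (beta (cadd f g) h) (at_left 1) (locally (F + G)%C).
Proof.
  intros Hf Hg Hh HF HG. apply (C_filterlim (at_left 1)). intros eps He.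
  pose proof (proj1 (C_filterlim (at_left 1) _ _) HF (eps / 2) ltac:(lra)) as F1.
  pose proof (proj1 (C_filterlim (at_left 1) _ _) HG (eps / 2) ltac:(lra)) as G1.
  generalize (filter_and _ _ at_left_1_unit (filter_and _ _ F1 G1)). apply filter_imp.
  intros r (Hz & H1 & H2).
  assert (E : beta (cadd f g) h r = (beta f h r + beta g h r)%C).
  { unfold beta. rewrite <- psum_plus; [|eapply bdd_ex; eauto; apply bdd_cmul; eauto ..].
    f_equal. apply functional_extensionality. intros k. unfold cmul, cadd. ring. }
  rewrite E.
  replace (beta f h r + beta g h r - (F + G))%C with ((beta f h r - F) + (beta g h r - G))%C by ring.
  eapply Rle_lt_trans; [apply Cmod_triangle | lra].
Qed.

Lemma beta_lim_scal (l : C) (g h : nat -> C) (B D : R) (G : C) :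
  bdd g B -> bdd h D -> filterlim (beta g h) (at_left 1) (locally G) ->
  filterlim (beta (cscal l g) h) (at_left 1) (locally (l * G)%C).
Proof.
  intros Hg Hh HG. apply (C_filterlim (at_left 1)). intros eps He. pose proof (Cmod_ge_0 l).
  pose proof (proj1 (C_filterlim (at_left 1) _ _) HG (eps / (Cmod l + 1)) ltac:(apply Rdiv_lt_0_compat; lra)) as G1.
  generalize (filter_and _ _ at_left_1_unit G1). apply filter_imp. intros r (Hz & H1).
  assert (E : beta (cscal l g) h r = (l * beta g h r)%C).
  { unfold beta. rewrite <- psum_scal; [|eapply bdd_ex; eauto; apply bdd_cmul; eauto].
    f_equal. apply functional_extensionality. intros k. unfold cmul, cscal. ring. }
  rewrite E.
  replace (l * beta g h r - l * G)%C with (l * (beta g h r - G))%C by ring.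
  rewrite Cmod_mult. pose proof (Cmod_ge_0 (beta g h r - G)%C).
  apply Rle_lt_trans with ((Cmod l + 1) * Cmod (beta g h r - G)); [nra|].
  apply Rlt_le_trans with ((Cmod l + 1) * (eps / (Cmod l + 1))); [apply Rmult_lt_compat_l; lra|].
  right. field. lra.
Qed.

Lemma inH1_bdd (g : nat -> C) : inH1 g -> bdd g (h1 g).
Proof. intros H. apply (inH1_spec g H). Qed.

Lemma pairing_plus_l (f g h : nat -> C) :
  inH1 f -> inH1 g -> inBMOA h -> pairing (cadd f g) h = (pairing f h + pairing g h)%C.
Proof.
  intros Hf Hg Hh.
  apply (pairing_lim _ _ _ _ _ (bdd_plus f g _ _ (inH1_bdd f Hf) (inH1_bdd g Hg)) (inBMOA_bdd h Hh)).
  apply (beta_lim_plus f g h _ _ _ _ _ (inH1_bdd f Hf) (inH1_bdd g Hg) (inBMOA_bdd h Hh));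
    apply pairing_spec; auto.
Qed.

Lemma pairing_scal_l (l : C) (g h : nat -> C) :
  inH1 g -> inBMOA h -> pairing (cscal l g) h = (l * pairing g h)%C.
Proof.
  intros Hg Hh.
  apply (pairing_lim _ _ _ _ _ (bdd_scal l g _ (inH1_bdd g Hg)) (inBMOA_bdd h Hh)).
  apply (beta_lim_scal l g h _ _ _ (inH1_bdd g Hg) (inBMOA_bdd h Hh)). apply pairing_spec; auto.
Qed.

Lemma pairing_plus_r (g f h : nat -> C) :
  inH1 g -> inBMOA f -> inBMOA h -> pairing g (cadd f h) = (pairing g f + pairing g h)%C.
Proof.
  intros Hg Hf Hh.
  apply (pairing_lim _ _ _ _ _ (inH1_bdd g Hg) (bdd_plus f h _ _ (inBMOA_bdd f Hf) (inBMOA_bdd h Hh))).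
  rewrite beta_comm.
  apply (beta_lim_plus f h g _ _ _ _ _ (inBMOA_bdd f Hf) (inBMOA_bdd h Hh) (inH1_bdd g Hg));
    rewrite beta_comm; apply pairing_spec; auto.
Qed.

Lemma pairing_scal_r (l : C) (g h : nat -> C) :
  inH1 g -> inBMOA h -> pairing g (cscal l h) = (l * pairing g h)%C.
Proof.
  intros Hg Hh.
  apply (pairing_lim _ _ _ _ _ (inH1_bdd g Hg) (bdd_scal l h _ (inBMOA_bdd h Hh))).
  rewrite beta_comm. apply (beta_lim_scal l h g _ _ _ (inBMOA_bdd h Hh) (inH1_bdd g Hg)).
  rewrite beta_comm. apply pairing_spec; auto.
Qed.

(* The weakest of the five conditions: convergence of the multipliers tested on [H^1 x VMOA]. *)
Definition tested_cvg (a : nat -> nat -> C) : Prop :=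
  forall g f, inH1 g -> inVMOA f ->
    filterlim (fun n => pairing g (Tmult a n f)) eventually (locally (pairing g f)).

Section Multipliers.

Variable a : nat -> nat -> C.
Hypothesis ha : forall n : nat, ex_series (fun k => Cmod (a n k)).

(** Here the summability of [a n] enters. It puts the image under T_n of any bounded sequence into
    both H^1 and VMOA. *)
Lemma Tmult_summable (n : nat) (g : nat -> C) (B : R) :
  bdd g B -> ex_series (fun k => Cmod (Tmult a n g k)) /\
  Series (fun k => Cmod (Tmult a n g k)) <= Series (fun k => Cmod (a n k)) * B.
Proof. intros Hg. exact (ex_series_cmul (a n) g B (ha n) Hg). Qed.

Lemma Tmult_inH1 (n : nat) (g : nat -> C) : inH1 g -> inH1 (Tmult a n g).
Proof. intros Hg. apply inH1_summable. apply (Tmult_summable n g (h1 g) (inH1_bdd g Hg)). Qed.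

Lemma Tmult_inVMOA (n : nat) (f : nat -> C) : inBMOA f -> inVMOA (Tmult a n f).
Proof. intros Hf. apply inVMOA_summable. apply (Tmult_summable n f _ (inBMOA_bdd f Hf)). Qed.

Lemma cmul_Tmult (n : nat) (g f : nat -> C) : cmul g (Tmult a n f) = cmul (Tmult a n g) f.
Proof. apply functional_extensionality. intros k. unfold cmul, Tmult. ring. Qed.

Lemma cmul_Tmult_summable (n : nat) (g f : nat -> C) (B D : R) :
  bdd g B -> bdd f D -> ex_series (fun k => Cmod (cmul (Tmult a n g) f k)) /\
  Series (fun k => Cmod (cmul (Tmult a n g) f k)) <= Series (fun k => Cmod (a n k)) * B * D.
Proof.
  intros Hg Hf. destruct (Tmult_summable n g B Hg) as [H1 H2].
  destruct (ex_series_cmul (Tmult a n g) f D H1 Hf) as [H3 H4]. split; auto.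
  eapply Rle_trans; [exact H4|]. apply Rmult_le_compat_r; auto. eapply bdd_nonneg; eauto.
Qed.

(** T_n is symmetric for the pairing, both sides being the same absolutely convergent series. This
    is the bridge between the conditions on H^1 and those on BMOA. *)
Lemma pairing_Tmult (n : nat) (g f : nat -> C) :
  inH1 g -> inBMOA f ->
  pairing g (Tmult a n f) = psum (cmul (Tmult a n g) f) (RtoC 1) /\
  pairing (Tmult a n g) f = psum (cmul (Tmult a n g) f) (RtoC 1).
Proof.
  intros Hg Hf. pose proof (inH1_bdd g Hg) as Bg. pose proof (inBMOA_bdd f Hf) as Bf.
  destruct (cmul_Tmult_summable n g f _ _ Bg Bf) as [Hs _]. split.
  - rewrite <- cmul_Tmult.
    apply (pairing_summable g (Tmult a n f) _ _ Bg (inBMOA_bdd _ (proj1 (Tmult_inVMOA n f Hf)))).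
    now rewrite cmul_Tmult.
  - apply (pairing_summable (Tmult a n g) f _ _ (inH1_bdd _ (Tmult_inH1 n g Hg)) Bf Hs).
Qed.

Lemma delta_inH1 (k : nat) : inH1 (delta k).
Proof. apply inH1_summable, ex_series_delta. Qed.

Lemma delta_inVMOA (k : nat) : inVMOA (delta k).
Proof. apply inVMOA_summable, ex_series_delta. Qed.

Hypothesis Hw : tested_cvg a.

Lemma coef_cvg (k : nat) (e : R) : 0 < e -> exists M, forall n, (M <= n)%nat -> Cmod (a n k - 1) < e.
Proof.
  intros He. pose proof (Hw (delta k) (delta k) (delta_inH1 k) (delta_inVMOA k)) as H.
  destruct (proj1 (C_filterlim eventually _ _) H e He) as [M HM]. exists M. intros n Hn.
  specialize (HM n Hn). cbv beta in HM.
  destruct (pairing_Tmult n (delta k) (delta k) (delta_inH1 k) (proj1 (delta_inVMOA k))) as [E _].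
  rewrite E, psum_delta in HM.
  pose proof (inH1_bdd _ (delta_inH1 k)) as B1. pose proof (inBMOA_bdd _ (proj1 (delta_inVMOA k))) as B2.
  assert (E2 : pairing (delta k) (delta k) = RtoC 1).
  { rewrite (pairing_summable _ _ _ _ B1 B2).
    - rewrite psum_delta. unfold delta. destruct (Nat.eq_dec k k); [reflexivity | tauto].
    - apply (ex_series_cmul (delta k) (delta k) _ (ex_series_delta k) B1). }
  rewrite E2 in HM. unfold Tmult, delta in HM. destruct (Nat.eq_dec k k); [|tauto].
  now rewrite Cmult_1_r in HM.
Qed.

(** Uniform boundedness in [g] with [f] fixed; a convergent sequence of pairings is bounded. *)
Lemma form_bounded (f : nat -> C) : inVMOA f ->
  exists K, forall n g, inH1 g -> Cmod (psum (cmul (Tmult a n g) f) (RtoC 1)) <= K * h1 g.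
Proof.
  intros Hf. pose proof (inBMOA_bdd f (proj1 Hf)) as Bf.
  assert (Hs : forall n g, inH1 g -> ex_series (fun k => Cmod (cmul (Tmult a n g) f k))).
  { intros n g Hg. apply (cmul_Tmult_summable n g f _ _ (inH1_bdd g Hg) Bf). }
  apply (uniform_boundedness inH1 h1 inH1_plus inH1_scal h1_nonneg H1_complete nat
    (fun n g => Cmod (psum (cmul (Tmult a n g) f) (RtoC 1)))).
  - intros n g h Hg Hh.
    replace (cmul (Tmult a n (cadd g h)) f) with (cadd (cmul (Tmult a n g) f) (cmul (Tmult a n h) f)).
    + rewrite psum_plus by (apply ex_series_1; auto). apply Cmod_triangle.
    + apply functional_extensionality. intros k. unfold cmul, Tmult, cadd. ring.
  - intros n l g Hg.
    replace (cmul (Tmult a n (cscal l g)) f) with (cscal l (cmul (Tmult a n g) f)).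
    + rewrite psum_scal by (apply ex_series_1; auto). rewrite Cmod_mult. lra.
    + apply functional_extensionality. intros k. unfold cmul, Tmult, cscal. ring.
  - intros n g _. apply Cmod_ge_0.
  - intros n. exists (Series (fun k => Cmod (a n k)) * (2 * bmo f)). intros g Hg.
    eapply Rle_trans; [apply psum_1_le; auto|].
    destruct (cmul_Tmult_summable n g f _ _ (inH1_bdd g Hg) Bf) as [_ H]. lra.
  - intros g Hg. destruct (bounded_of_limit _ _ (Hw g f Hg Hf)) as [B HB]. exists B. intros n.
    rewrite <- (proj1 (pairing_Tmult n g f Hg (proj1 Hf))). auto.
Qed.

(** The bound of [form_bounded], read on polynomials, says that T_n f acts on H^1 with norm
    independent of [n]; the converse of Fefferman's inequality makes it a bound in BMOA. *)
Lemma Tmult_VMOA_orbit (f : nat -> C) : inVMOA f -> exists B, forall n, bmo (Tmult a n f) <= B.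
Proof.
  intros Hf. destruct (form_bounded f Hf) as [K HK]. exists (2 * Rmax 0 K). intros n.
  pose proof (Rmax_l 0 K). pose proof (Rmax_r 0 K).
  apply H1_dual_le_inBMOA. intros m q A HA.
  destruct (inH1_summable _ (ex_series_finite q m)) as (Hq & _).
  destruct (inH1_intro (trunc m q) A (proj1 Hq) HA) as (_ & _ & Hn).
  pose proof (h1_nonneg _ Hq) as Hn0.
  replace (csum (cmul q (Tmult a n f)) m) with (psum (cmul (Tmult a n (trunc m q)) f) (RtoC 1)).
  - eapply Rle_trans; [apply HK; auto|].
    apply Rle_trans with (Rmax 0 K * h1 (trunc m q)); [apply Rmult_le_compat_r; auto|].
    apply Rmult_le_compat_l; auto.
  - rewrite (psum_finite _ _ m).
    + apply csum_ext. intros k Hk. rewrite pow_n_RtoC, pow1. unfold cmul, Tmult, trunc.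
      destruct (lt_dec k m); [ring | lia].
    + intros k Hk. unfold cmul, Tmult. rewrite trunc_out by auto. ring.
Qed.

Lemma Tmult_VMOA_bounded : exists K, forall n f, inVMOA f -> bmo (Tmult a n f) <= K * bmo f.
Proof.
  apply (uniform_boundedness inVMOA bmo) with (q := fun n f => bmo (Tmult a n f)).
  - intros f g Hf Hg. split; [apply inVMOA_plus; auto | apply inBMOA_plus; [apply Hf | apply Hg]].
  - intros l f Hf. split; [apply inVMOA_scal; auto | apply inBMOA_scal; apply Hf].
  - intros f Hf. apply inBMOA_spec. apply Hf.
  - apply VMOA_complete.
  - intros n f g Hf Hg.
    replace (Tmult a n (cadd f g)) with (cadd (Tmult a n f) (Tmult a n g)).
    + apply inBMOA_plus; apply Tmult_inVMOA; [apply Hf | apply Hg].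
    + apply functional_extensionality. intros k. unfold Tmult, cadd. ring.
  - intros n l f Hf.
    replace (Tmult a n (cscal l f)) with (cscal l (Tmult a n f)).
    + apply inBMOA_scal; apply Tmult_inVMOA; apply Hf.
    + apply functional_extensionality. intros k. unfold Tmult, cscal. ring.
  - intros n f Hf. apply inBMOA_spec. apply Tmult_inVMOA. apply Hf.
  - intros n. exists (4 * Series (fun k => Cmod (a n k))). intros f Hf.
    destruct (Tmult_summable n f _ (inBMOA_bdd f (proj1 Hf))) as [H1 H2].
    destruct (inBMOA_summable _ H1) as (_ & _ & H3). lra.
  - apply Tmult_VMOA_orbit.
Qed.

(** The mean of T_n g on a circle is nearly its pairing with a witness [p] in VMOA of norm at most
    2. By symmetry this equals the pairing of [g] with T_n p, to which Fefferman's inequality and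
    the bound on VMOA apply. *)
Lemma Tmult_H1_bounded : exists K, 0 <= K /\ forall n g, inH1 g -> h1 (Tmult a n g) <= K * h1 g.
Proof.
  destruct Tmult_VMOA_bounded as [K0 HK0]. set (K := Rmax 0 K0).
  pose proof (Rmax_l 0 K0) as HK1. pose proof (Rmax_r 0 K0) as HK2. fold K in HK1, HK2.
  pose proof fefferman_pos as HC.
  exists (fefferman * (K * 2)). split; [apply Rmult_le_pos; lra|]. intros n g Hg.
  pose proof (h1_nonneg g Hg) as Hn.
  assert (HT := Tmult_inH1 n g Hg).
  apply (inH1_intro (Tmult a n g)); [apply HT|]. intros r Hr.
  apply le_epsilon. intros e He.
  destruct (dual_witness (Tmult a n g) _ r e (inH1_bdd _ HT) Hr He) as (p & Hp1 & Hp2 & Hp3).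
  assert (Hps : ex_series (fun k => Cmod (p k))).
  { apply (ex_series_mono _ (fun k => r ^ k)); [split; [apply Cmod_ge_0 | auto]|].
    apply ex_series_geom. rewrite Rabs_pos_eq; lra. }
  assert (Hp : inVMOA p) by (apply inVMOA_summable; auto).
  destruct (H1_dual_le_inBMOA p 1 Hp2) as (_ & _ & HNp).
  destruct (inBMOA_spec p (proj1 Hp)) as (_ & HNp0 & _).
  rewrite <- (proj1 (pairing_Tmult n g p Hg (proj1 Hp))) in Hp3.
  pose proof (proj2 (pairing_spec g (Tmult a n p) Hg (proj1 (Tmult_inVMOA n p (proj1 Hp))))) as H1.
  pose proof (HK0 n p Hp) as H2.
  assert (H3 : bmo (Tmult a n p) <= K * 2).
  { apply Rle_trans with (K * bmo p); [|apply Rmult_le_compat_l; lra].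
    eapply Rle_trans; [exact H2|]. apply Rmult_le_compat_r; auto. }
  assert (H4 : fefferman * bmo (Tmult a n p) * h1 g <= fefferman * (K * 2) * h1 g).
  { apply Rmult_le_compat_r; auto. apply Rmult_le_compat_l; lra. }
  lra.
Qed.

Lemma coef_bounded : exists K, forall n k, Cmod (a n k) <= K.
Proof.
  destruct Tmult_H1_bounded as (K & HK0 & HK). exists K. intros n k.
  pose proof (delta_inH1 k) as Hd. pose proof (Tmult_inH1 n _ Hd) as HT.
  replace (a n k) with (Tmult a n (delta k) k).
  - eapply Rle_trans; [apply (inH1_bdd _ HT)|]. eapply Rle_trans; [apply HK; auto|].
    assert (H1 : h1 (delta k) <= 1).
    { destruct (inH1_summable _ (ex_series_delta k)) as (_ & _ & H).
      eapply Rle_trans; [exact H|]. apply Series_le_bound; [apply ex_series_delta|].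
      intros m.
      assert (E : rsum (fun j => Cmod (delta k j)) m = if lt_dec k m then 1 else 0).
      { induction m as [|m IH]; cbn [rsum].
        - destruct (lt_dec k 0); [lia | reflexivity].
        - rewrite IH. unfold delta.
          destruct (lt_dec k m), (lt_dec k (S m)), (Nat.eq_dec m k);
            rewrite ?Cmod_1, ?Cmod_0; try lia; lra. }
      rewrite E. destruct (lt_dec k m); lra. }
    nra.
  - unfold Tmult, delta. destruct (Nat.eq_dec k k); [ring | tauto].
Qed.

(** The coefficients of a dilation decay geometrically, so [a n k -> 1] under a uniform bound gives
    convergence in l^1. This dominates the norms of both H^1 and BMOA. *)
Lemma Tmult_dil_cvg (g : nat -> C) (B r eps : R) :
  bdd g B -> 0 < r < 1 -> 0 < eps ->
  exists M, forall n, (M <= n)%nat ->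
    ex_series (fun k => Cmod (csub (Tmult a n (dil r g)) (dil r g) k)) /\
    Series (fun k => Cmod (csub (Tmult a n (dil r g)) (dil r g) k)) <= eps.
Proof.
  intros Hg Hr He. destruct coef_bounded as [K HK].
  assert (Hv : ex_series (fun k => Cmod (dil r g k))).
  { apply (ex_series_mono _ (fun k => B * r ^ k)).
    - intros k. split; [apply Cmod_ge_0|]. unfold dil.
      rewrite Cmod_mult, Cmod_R, Rabs_pos_eq by (apply pow_le; lra).
      apply Rmult_le_compat_r; auto. apply pow_le; lra.
    - apply (ex_series_scal_l B (fun k => r ^ k)), ex_series_geom. rewrite Rabs_pos_eq; lra. }
  destruct (dominated_series (fun n k => (a n k - 1)%C) (fun k => Cmod (dil r g k)) (K + 1) eps) as [M HM];
    auto using Cmod_ge_0.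
  - intros n k. unfold Cminus. eapply Rle_trans; [apply Cmod_triangle|].
    rewrite Cmod_opp, Cmod_1. specialize (HK n k). lra.
  - intros k e Hee. apply coef_cvg; auto.
  - exists M. intros n Hn. destruct (HM n Hn) as [H1 H2].
    assert (E : (fun k => Cmod (csub (Tmult a n (dil r g)) (dil r g) k))
      = (fun k => Cmod (a n k - 1) * Cmod (dil r g k))).
    { apply functional_extensionality. intros k. rewrite <- Cmod_mult. f_equal. unfold csub, Tmult. ring. }
    rewrite E. auto.
Qed.

(** The splitting for the density argument, with [d] a dilation of [g]: the uniform bound on T_n
    handles the first term, [Tmult_dil_cvg] the second, closeness of the dilation the third. *)
Lemma Tmult_split (n : nat) (g d : nat -> C) :
  csub (Tmult a n g) g = cadd (Tmult a n (csub g d)) (csub (csub (Tmult a n d) d) (csub g d)).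
Proof. apply functional_extensionality. intros k. unfold csub, cadd, Tmult. ring. Qed.

Lemma tested_H1 (g : nat -> C) : inH1 g -> norm_cvg H1norm (fun n => Tmult a n g) g.
Proof.
  intros Hg. apply norm_cvg_iff. intros eps He.
  destruct Tmult_H1_bounded as (K & HK0 & HK).
  destruct (dil_close g (eps / 4 / (K + 1)) Hg ltac:(repeat apply Rdiv_lt_0_compat; lra)) as (r & Hr & Hd).
  destruct (Tmult_dil_cvg g (h1 g) r (eps / 4) (inH1_bdd g Hg) Hr ltac:(lra)) as [M HM].
  exists M. intros n Hn. destruct (HM n Hn) as [H1 H2].
  destruct (inH1_summable _ H1) as (A1 & _ & A2).
  assert (Hdil : inH1 (dil r g)).
  { destruct (inH1_intro (dil r g) (h1 g)) as (H & _); auto.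
    - eapply bdd_holo, (bdd_dil g (h1 g) r); [apply inH1_bdd; auto | lra].
    - intros s Hs. destruct (inH1_spec g Hg) as [Bg Mg].
      replace (mean1 (dil r g) s) with (mean1 g (r * s)).
      + apply Mg. nra.
      + apply mean_ext. intros t. rewrite psum_dil. do 2 f_equal.
        unfold cis, Cmult, RtoC. simpl. f_equal; ring. }
  destruct (inH1_sub g _ Hg Hdil) as [A3 _].
  pose proof (HK n _ A3) as A4. pose proof (Tmult_inH1 n _ A3) as A5.
  destruct (inH1_sub _ _ A1 A3) as [A6 A7].
  destruct (inH1_plus _ _ A5 A6) as [A8 A9]. rewrite <- Tmult_split in A8, A9.
  pose proof (h1_nonneg _ A8) as A10. fold (h1 (csub (Tmult a n g) g)).
  assert (A11 : (K + 1) * h1 (csub g (dil r g)) <= eps / 4).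
  { apply Rle_trans with ((K + 1) * (eps / 4 / (K + 1))); [apply Rmult_le_compat_l; lra|]. right. field. lra. }
  destruct (inH1_intro _ (h1 (csub (Tmult a n g) g)) (proj1 A8) (proj2 (inH1_spec _ A8))) as (_ & A12 & _).
  split; auto. rewrite Rabs_pos_eq by auto. lra.
Qed.

Lemma tested_VMOA (f : nat -> C) : inVMOA f -> norm_cvg BMOAnorm (fun n => Tmult a n f) f.
Proof.
  intros Hf. apply norm_cvg_iff. intros eps He.
  destruct Tmult_VMOA_bounded as (K0 & HK).
  set (K := Rmax 0 K0). pose proof (Rmax_l 0 K0) as HK1. pose proof (Rmax_r 0 K0) as HK2.
  fold K in HK1, HK2.
  destruct (dil_close_VMOA f (eps / 4 / (K + 1)) Hf ltac:(repeat apply Rdiv_lt_0_compat; lra)) as (r & Hr & _ & Hd).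
  pose proof (inBMOA_bdd f (proj1 Hf)) as Bf.
  (* One eighth instead of one quarter, because [inBMOA_summable] costs a factor 2. *)
  destruct (Tmult_dil_cvg f _ r (eps / 8) Bf Hr ltac:(lra)) as [M HM].
  exists M. intros n Hn. destruct (HM n Hn) as [H1 H2].
  destruct (inBMOA_summable _ H1) as (A1 & _ & A2).
  assert (Hdil : inVMOA (dil r f)).
  { apply inVMOA_summable. apply (ex_series_mono _ (fun k => 2 * bmo f * r ^ k)).
    - intros k. split; [apply Cmod_ge_0|]. unfold dil.
      rewrite Cmod_mult, Cmod_R, Rabs_pos_eq by (apply pow_le; lra).
      apply Rmult_le_compat_r; auto. apply pow_le; lra.
    - apply (ex_series_scal_l (2 * bmo f) (fun k => r ^ k)), ex_series_geom. rewrite Rabs_pos_eq; lra. }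
  pose proof (inVMOA_sub f _ Hf Hdil) as A3.
  pose proof (HK n _ A3) as A4. pose proof (Tmult_inVMOA n _ (proj1 A3)) as A5.
  destruct (inBMOA_sub _ _ A1 (proj1 A3)) as (A6 & _ & A7).
  destruct (inBMOA_plus _ _ (proj1 A5) A6) as (A8 & A9 & A10). rewrite <- Tmult_split in A8, A9, A10.
  destruct (inBMOA_spec _ A8) as (_ & A11 & _). fold (bmo (csub (Tmult a n f) f)).
  destruct (inBMOA_spec _ (proj1 A3)) as (_ & A12 & _).
  assert (A13 : (K + 1) * bmo (csub f (dil r f)) <= eps / 4).
  { apply Rle_trans with ((K + 1) * (eps / 4 / (K + 1))); [apply Rmult_le_compat_l; lra|]. right. field. lra. }
  assert (A14 : K0 * bmo (csub f (dil r f)) <= K * bmo (csub f (dil r f))) by (apply Rmult_le_compat_r; auto).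
  split; auto. rewrite Rabs_pos_eq by auto. lra.
Qed.

End Multipliers.

Theorem theorem5p1 (a : nat -> nat -> C)
  (ha : forall n : nat, ex_series (fun k => Cmod (a n k))) :
  let P1 := forall g, inH1 g -> weak_cvg inH1 H1norm (fun n => Tmult a n g) g in
  let P2 := forall g, inH1 g -> norm_cvg H1norm (fun n => Tmult a n g) g in
  let P3 := forall h, inBMOA h -> weakstar_BMOA (fun n => Tmult a n h) h in
  let P4 := forall f, inVMOA f -> weak_cvg inVMOA BMOAnorm (fun n => Tmult a n f) f in
  let P5 := forall f, inVMOA f -> norm_cvg BMOAnorm (fun n => Tmult a n f) f in
  (P1 <-> P2) /\ (P2 <-> P3) /\ (P3 <-> P4) /\ (P4 <-> P5).
Proof.
  intros P1 P2 P3 P4 P5.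
  assert (W2 : tested_cvg a -> P2) by (intros W g Hg; apply tested_H1; auto).
  assert (W5 : tested_cvg a -> P5) by (intros W f Hf; apply tested_VMOA; auto).
  assert (H21 : P2 -> P1).
  { intros H g Hg. refine (weak_of_norm _ _ _ _ _ Hg _ _ _ (H g Hg)).
    - intros n. apply Tmult_inH1; auto.
    - intros l f Hf. apply inH1_scal; auto.
    - intros f h Hf Hh. apply inH1_plus; auto.
    - apply h1_nonneg. }
  assert (H54 : P5 -> P4).
  { intros H f Hf. refine (weak_of_norm _ _ _ _ _ Hf _ _ _ (H f Hf)).
    - intros n. apply Tmult_inVMOA; auto. apply Hf.
    - apply inVMOA_scal.
    - apply inVMOA_plus.
    - intros h Hh. apply inBMOA_spec. apply Hh. }
  (* By Fefferman's inequality, pairing with [f] is a bounded functional on H^1; symmetry of T_n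
     then moves the multiplier onto [f]. *)
  assert (H1W : P1 -> tested_cvg a).
  { intros H g f Hg Hf.
    assert (HL : bdd_lin_functional inH1 H1norm (fun g => pairing g f)).
    { split; [|split].
      - intros x y Hx Hy. apply pairing_plus_l; auto. apply Hf.
      - intros l x Hx. apply pairing_scal_l; auto. apply Hf.
      - exists (fefferman * bmo f). intros x Hx. apply pairing_spec; auto. apply Hf. }
    pose proof (H g Hg _ HL) as Hc. cbv beta in Hc.
    eapply filterlim_ext; [|exact Hc]. intros n. cbv beta.
    destruct (pairing_Tmult a ha n g f Hg (proj1 Hf)) as [E1 E2]. now rewrite E1, E2. }
  (* The same inequality read in the other variable: pairing with [g] is bounded on VMOA. *)
  assert (H4W : P4 -> tested_cvg a).
  { intros H g f Hg Hf. apply (H f Hf (fun f => pairing g f)). split; [|split].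
    - intros x y Hx Hy. apply pairing_plus_r; auto; [apply Hx | apply Hy].
    - intros l x Hx. apply pairing_scal_r; auto. apply Hx.
    - exists (fefferman * h1 g). intros x Hx.
      destruct (pairing_spec g x Hg (proj1 Hx)) as [_ Hb]. fold (bmo x). lra. }
  assert (H3W : P3 -> tested_cvg a).
  { intros H g f Hg Hf. apply (H f (proj1 Hf) g Hg). }
  (* Here [h] ranges over all of BMOA. Symmetry moves T_n onto [g], where convergence holds in
     norm. *)
  assert (H23 : P2 -> P3).
  { intros H h Hh g Hg. apply (C_filterlim eventually). intros eps He.
    destruct (inBMOA_spec h Hh) as (_ & HN & _). pose proof fefferman_pos as HC.
    set (K := fefferman * bmo h + 1).
    assert (HK : 0 < K) by (unfold K; assert (0 <= fefferman * bmo h) by (apply Rmult_le_pos; lra); lra).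
    destruct (proj1 (norm_cvg_iff _ _ _) (H g Hg) (eps / K) ltac:(apply Rdiv_lt_0_compat; lra)) as [M HM].
    exists M. intros n Hn. destruct (HM n Hn) as [_ H1]. fold (h1 (csub (Tmult a n g) g)) in H1.
    pose proof (Tmult_inH1 a ha n g Hg) as HT. destruct (inH1_sub _ _ HT Hg) as [HS _].
    pose proof (h1_nonneg _ HS) as H0. rewrite Rabs_pos_eq in H1 by auto.
    destruct (pairing_Tmult a ha n g h Hg Hh) as [E1 E2].
    assert (E : (pairing g (Tmult a n h) - pairing g h)%C = pairing (csub (Tmult a n g) g) h).
    { destruct (inH1_scal (RtoC (-1)) g Hg) as [Hm _].
      rewrite csub_cadd, pairing_plus_l, pairing_scal_l by auto. rewrite E1, E2. ring. }
    rewrite E. destruct (pairing_spec _ h HS Hh) as [_ Hb]. eapply Rle_lt_trans; [exact Hb|].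
    apply Rle_lt_trans with (K * h1 (csub (Tmult a n g) g)); [apply Rmult_le_compat_r; unfold K; lra|].
    apply Rlt_le_trans with (K * (eps / K)); [apply Rmult_lt_compat_l; auto|]. right. field. lra. }
  repeat split; auto.
Qed.
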